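(* Let $\alpha\in[1,2]$, let $u_0\in H^{1+\alpha}_p(I)$ be smooth, and let $t_c$ be the critical (gradient catastrophe) time of the inviscid Burgers equation $v_t+6vv_x=0$, $v(x,0)=u_0(x)$. Let $T_c$ be any positive time with $T_c<t_c$. For $\varepsilon>0$ let $u(x,t;\varepsilon)\in C([0,T_c];H^{1+\alpha}_p(I))\cap C^1([0,T_c];L^2_p(I))$ be the unique solution of the fractional KdV equation \[ u_t+6uu_x-\varepsilon^2\mathcal{D}^\alpha u_x=0,\qquad u(x,0)=u_0(x). \] Then the map $\varepsilon\mapsto u(\cdot,\cdot;\varepsilon)$ is continuous from $\mathbb{R}^+$ to $C([0,T_c];H^{1+\alpha}_p(I))\cap C^1([0,T_c];L^2_p(I))$. Moreover, \[ \lim_{\varepsilon\to0}\|u(t;\varepsilon)-v^b(t)\|_{1+\alpha}=0 \] uniformly in $t\in[0,T_c]$, where $v^b$ solves $v^b_t+6v^bv^b_x=0$, $v^b(x,0)=u_0(x)$.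
   Context: $I=[-\pi,\pi]$; functions are $2\pi$-periodic. For $f\in L^2(I)$, $\hat f(k)=\frac{1}{2\pi}\int_I f(x)e^{-ikx}dx$. $H^r_p(I)$ is the space of $2\pi$-periodic functions with finite norm $\|f\|_r=\left(\sum_{k\in\mathbb{Z}}(1+|k|^2)^r|\hat f(k)|^2\right)^{1/2}$, $L^2_p=H^0_p$. $\mathcal{D}^\alpha f=\sum_k|k|^\alpha\hat f(k)e^{ikx}$. The critical time $t_c$ is the time at which the smooth solution of $v_t+6vv_x=0$, $v(\cdot,0)=u_0$, first develops an infinite gradient, namely $t_c=1/\max_x[-6u_0'(x)]$; for $t<t_c$ this equation has a smooth solution. *)

(* Defs.v *)
From HB Require Import structures.
From mathcomp Require Import all_boot all_order all_algebra.
From mathcomp Require Import all_classical all_reals all_analysis.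
Import Order.TTheory GRing.Theory Num.Theory.
Import numFieldNormedType.Exports.
Local Open Scope classical_set_scope.
Local Open Scope ring_scope.

Section FKdV.
Context {R : realType}.

Definition Iper : set R := `[(- pi)%R, pi]%classic.

Definition periodic2pi (f : R -> R) : Prop := forall x, f (x + 2 * pi) = f x.

(* Fourier coefficient of a real function f:
   \hat f(k) = (1/2pi) \int_I f(x) e^{-ikx} dx = fcoef_re f k + i * fcoef_im f k *)
Definition fcoef_re (f : R -> R) (k : int) : R :=
  (2 * pi)^-1 * \int[lebesgue_measure]_(x in Iper) (f x * cos (k%:~R * x)).
Definition fcoef_im (f : R -> R) (k : int) : R :=
  - ((2 * pi)^-1 * \int[lebesgue_measure]_(x in Iper) (f x * sin (k%:~R * x))).

Definition fcoef_sq (f : R -> R) (k : int) : R :=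
  fcoef_re f k ^+ 2 + fcoef_im f k ^+ 2.

Definition sob_weight (r : R) (k : int) : R := (1 + (k%:~R) ^+ 2) `^ r.

(* the terms k = 0, then (k = n, k = -n) for n >= 1 of the sum over Z *)
Definition sob_term (r : R) (f : R -> R) (n : nat) : R :=
  if n is 0 then sob_weight r 0 * fcoef_sq f 0
  else sob_weight r n%:Z * fcoef_sq f n%:Z
       + sob_weight r (- n%:Z) * fcoef_sq f (- n%:Z).

Definition sob_sum (r : R) (f : R -> R) : \bar R :=
  (\sum_(n <oo) (sob_term r f n)%:E)%E.

Definition Hnorm (r : R) (f : R -> R) : R := Num.sqrt (fine (sob_sum r f)).

Definition in_Hp (r : R) (f : R -> R) : Prop :=
  [/\ periodic2pi f, measurable_fun Iper f,
      lebesgue_measure.-integrable Iper (fun x => (f x ^+ 2)%:E)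
    & (sob_sum r f < +oo)%E].

Definition smooth (f : R -> R) : Prop :=
  forall (n : nat) (x : R), derivable (derive1n n f) x 1.

Definition burgers_sol (u0 : R -> R) (Tc : R) (v : R -> R -> R) : Prop :=
  [/\ forall x, v 0 x = u0 x,
      forall t x, v t (x + 2 * pi) = v t x,
      forall t x, t \in `[0, Tc] ->
        [/\ derivable (fun s => v s x) t 1, derivable (v t) x 1 &
            derive1 (fun s => v s x) t + 6 * v t x * derive1 (v t) x = 0],
      {within `[0, Tc] `*` setT,
         continuous (fun p : R * R => derive1 (fun s => v s p.2) p.1)}
    & {within `[0, Tc] `*` setT,
         continuous (fun p : R * R => derive1 (v p.1) p.2)}].

Definition Hcont (r Tc : R) (g : R -> R -> R) : Prop :=
  forall t, t \in `[0, Tc] -> forall e : R, 0 < e -> exists2 d : R, 0 < d &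
    forall s, s \in `[0, Tc] -> `|s - t| < d -> Hnorm r (g s \- g t) < e.

(* u : [0,Tc] -> H^{1+alpha}_p is a solution of the fractional KdV equation
   u_t + 6 u u_x - eps^2 D^alpha u_x = 0, u(0) = u0, in the class
   C([0,Tc]; H^{1+alpha}_p) cap C^1([0,Tc]; L^2_p), with time derivative
   (in L^2_p) w.  The equation is an identity in L^2_p at every time; it is
   expressed on Fourier coefficients, using
   (u u_x)^(k) = (1/2) ((u^2)_x)^(k) = (ik/2) (u^2)^(k) and
   (D^alpha u_x)^(k) = |k|^alpha (ik) \hat u(k):
     \hat w(k) + 3ik (u^2)^(k) - i eps^2 |k|^alpha k \hat u(k) = 0. *)
Definition fkdv_sol (alpha eps : R) (u0 : R -> R) (Tc : R)
    (u w : R -> R -> R) : Prop :=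
  [/\ (forall t, t \in `[0, Tc] -> in_Hp (1 + alpha) (u t)) /\
        Hcont (1 + alpha) Tc u,
      (forall t, t \in `[0, Tc] -> in_Hp 0 (w t)) /\ Hcont 0 Tc w,
      (forall t, t \in `[0, Tc] -> forall e : R, 0 < e -> exists2 d : R, 0 < d &
        forall s, s \in `[0, Tc] -> 0 < `|s - t| < d ->
          Hnorm 0 ((fun x => (u s x - u t x) / (s - t)) \- w t) < e),
      Hnorm 0 (u 0 \- u0) = 0 &
      (forall t, t \in `[0, Tc] -> forall k : int,
        let u2 := fun x => u t x ^+ 2 in
        let c := eps ^+ 2 * (`|k|%:~R `^ alpha) * k%:~R in
        fcoef_re (w t) k - 3 * k%:~R * fcoef_im u2 k + c * fcoef_im (u t) k = 0
        /\
        fcoef_im (w t) k + 3 * k%:~R * fcoef_re u2 k - c * fcoef_re (u t) k = 0)].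

End FKdV.

(* Main.v *)
(** All estimates are made on the Fourier modes [z_k] of a solution, for which
    the dispersive term is skew and drops out of every energy identity.

    Persistence.  For the weight [W k = 1 + min(|k|, B)^8] the cubic form
    [sum W_k k Im (z_k z_l z_m)] over [k + l + m = 0] is symmetric in its three
    indices, and [|W_k k + W_l l + W_m m|] is at most a constant times the
    smallest of [|k|, |l|, |m|] times the smaller of the other two weights.
    Gronwall's inequality for the energy truncated to [|k| <= M] then bounds
    [(1 + k^8) |z_k|^2] in terms of the Wiener norm [sum |k| |z_k|] only, letting
    first [M] and then [B] tend to infinity.  Replacing [u^2] by the square of
    the truncated series costs [O(1/M)]; this uses the completeness of the
    trigonometric system, proved by approximating indicators of arcs by
    [(1 - t^n)^(m^n)] with [t] affine in [cos (x - a)].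

    Difference.  With unit weight the cubic form vanishes, so two solutions with
    parameters [eps] and [eps0] and the same datum differ by
    [O(|eps^2 - eps0^2|)] in [L^2], hence mode by mode; with the uniform decay
    of the modes this gives convergence in [H^(1+alpha)], and in [L^2] for the
    time derivatives.  A continuity argument in [t] removes the a priori
    assumption on the Wiener norm of [u(eps)], so it is needed for the reference
    solution only.

    The Burgers solution is a solution with [eps = 0].  It is constant along
    characteristics, and before the critical time the flow map
    [x + 6 t u0(x)] is a uniform diffeomorphism, so its third derivative in [x]
    is bounded and its Wiener norm is finite. *)
Require Import Defs.
From HB Require Import structures.
From mathcomp Require Import all_boot all_order all_algebra.
From mathcomp Require Import all_classical all_reals all_analysis.
From mathcomp Require Import measurable_realfun ring lra zify.
Import Order.TTheory GRing.Theory Num.Theory.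
Import numFieldNormedType.Exports.
Local Open Scope classical_set_scope.
Local Open Scope ring_scope.
Set Implicit Arguments.
Unset Strict Implicit.
Unset Printing Implicit Defensive.

(** * Averages over one period *)

Section Mean.
Context {R : realType}.
Notation mu := (@lebesgue_measure R).
Implicit Types (f g : R -> R) (k : int).

(** A solution is only known to lie in [H^(1+alpha)] with a time derivative in [L^2], so an energy
    of higher order cannot be differentiated directly. A single mode can, hence so can any finite
    energy; but its derivative involves the coefficients of the full [u^2], not a finite
    convolution. Comparing the two needs [k^2 |z_k|] bounded, which [H^2] provides since
    [alpha >= 1]. The weight is capped at [B] so that the comparison error, multiplied by
    [W_k k z_k], is summed against [|k| |z_k|] alone and is still [O(1/M)].

    The exponent 8 is 6 + 2. As [alpha <= 2], both the square of the symbol [|k|^(1+alpha)] and the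
    weight of [H^(1+alpha)] are of order at most [k^6]; the two further powers leave [sum 1/k^2],
    with tails uniform in time and in the parameter.

    The constants of the continuity argument are fixed by the datum and the reference solution
    before [eps] is chosen. One approximation theorem therefore serves both claims, the reference
    being [u(eps0)] for continuity and the Burgers solution for the limit. *)

Definition integrableI f := mu.-integrable (@Iper R) (EFin \o f).
Definition mean f : R := (2 * pi)^-1 * \int[mu]_(x in Iper) f x.

Lemma measurable_Iper : measurable (@Iper R : set (measurableTypeR R)).
Proof. exact: measurable_itv. Qed.
Hint Resolve measurable_Iper : core.

Lemma pi2_gt0 : 0 < 2 * pi :> R.
Proof. by rewrite mulr_gt0// pi_gt0. Qed.

Lemma measure_Iper : mu Iper = (2 * pi)%:E.
Proof.
rewrite /Iper lebesgue_measure_itv/= lte_fin; have := @pi_gt0 R => p0.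
by rewrite ifT; [congr EFin; lra|lra].
Qed.

Lemma continuous_integrableI f : continuous f -> integrableI f.
Proof.
move=> cf; apply: continuous_compact_integrable; first exact: segment_compact.
exact: continuous_subspaceT.
Qed.

Lemma integrableID f g : integrableI f -> integrableI g ->
  integrableI (fun x => f x + g x).
Proof.
by move=> If Ig; exact: (integrableD measurable_Iper If Ig).
Qed.

Lemma integrableIZ (c : R) f : integrableI f -> integrableI (fun x => c * f x).
Proof.
by move=> If; exact: (integrableZl measurable_Iper c If).
Qed.

Lemma integrableIB f g : integrableI f -> integrableI g ->
  integrableI (fun x => f x - g x).
Proof.
by move=> If Ig; exact: (integrableB measurable_Iper If Ig).
Qed.

Lemma integrableI_sum I (s : seq I) (F : I -> R -> R) :
  (forall i, integrableI (F i)) -> integrableI (fun x => \sum_(i <- s) F i x).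
Proof.
move=> IF; elim: s => [|i s ih].
  under eq_fun do rewrite big_nil.
  by apply: continuous_integrableI; exact: cst_continuous.
by under eq_fun do rewrite big_cons; exact: integrableID.
Qed.

Lemma integrableI_measurable f : integrableI f -> measurable_fun Iper f.
Proof. by move=> /measurable_int/measurable_EFinP. Qed.

Lemma le_integrableI f g : measurable_fun Iper f -> integrableI g ->
  (forall x, Iper x -> `|f x| <= `|g x|) -> integrableI f.
Proof.
move=> mf Ig fg; apply: (le_integrable measurable_Iper _ _ Ig).
  exact/measurable_EFinP.
by move=> x Ix /=; rewrite lee_fin fg.
Qed.

Lemma integrableIMr f g : integrableI f -> continuous g ->
  (forall x, `|g x| <= 1) -> integrableI (fun x => f x * g x).
Proof.
move=> If cg g1; apply: (@le_integrableI _ f) => //.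
  apply: measurable_funM; first exact: integrableI_measurable.
  by apply: measurable_funTS; exact: continuous_measurable_fun.
by move=> x _; rewrite normrM ler_piMr.
Qed.

Lemma eq_mean f g : (forall x, Iper x -> f x = g x) -> mean f = mean g.
Proof.
by move=> fg; congr (_ * _); apply: eq_Rintegral => x /set_mem; exact: fg.
Qed.

Lemma meanD f g : integrableI f -> integrableI g ->
  mean (fun x => f x + g x) = mean f + mean g.
Proof. by move=> If Ig; rewrite /mean RintegralD// mulrDr. Qed.

Lemma meanB f g : integrableI f -> integrableI g ->
  mean (fun x => f x - g x) = mean f - mean g.
Proof. by move=> If Ig; rewrite /mean RintegralB// mulrBr. Qed.

Lemma meanZ (c : R) f : integrableI f -> mean (fun x => c * f x) = c * mean f.
Proof. by move=> If; rewrite /mean RintegralZl// mulrCA. Qed.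

Lemma mean_cst (c : R) : mean (fun=> c) = c.
Proof.
have mI : fine (mu Iper) = 2 * pi by rewrite measure_Iper.
rewrite /mean Rintegral_cst//; transitivity ((2 * pi)^-1 * (c * (2 * pi))).
  by congr (_ * (_ * _)).
by rewrite mulrCA mulVf ?mulr1// gt_eqF// pi2_gt0.
Qed.

Lemma mean_sum I (s : seq I) (F : I -> R -> R) :
  (forall i, integrableI (F i)) ->
  mean (fun x => \sum_(i <- s) F i x) = \sum_(i <- s) mean (F i).
Proof.
move=> IF; elim: s => [|i s ih].
  under eq_mean do rewrite big_nil; by rewrite mean_cst big_nil.
under eq_mean do rewrite big_cons.
by rewrite meanD// ?ih ?big_cons//; exact: integrableI_sum.
Qed.

Lemma le_mean f g : integrableI f -> integrableI g ->
  (forall x, Iper x -> f x <= g x) -> mean f <= mean g.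
Proof.
move=> If Ig fg; rewrite ler_pM2l ?invr_gt0 ?pi2_gt0//.
exact: le_Rintegral.
Qed.

Lemma integrableI_norm f : integrableI f -> integrableI (fun x => `|f x|).
Proof. by move=> If; exact: (integrable_norm If). Qed.

Lemma le_norm_mean f : integrableI f -> `|mean f| <= mean (fun x => `|f x|).
Proof.
move=> If; rewrite normrM gtr0_norm ?invr_gt0 ?pi2_gt0//.
by rewrite ler_pM2l ?invr_gt0 ?pi2_gt0//; exact: le_normr_Rintegral.
Qed.

Lemma norm_mean_le f (C : R) : integrableI f ->
  (forall x, Iper x -> `|f x| <= C) -> `|mean f| <= C.
Proof.
move=> If fC; apply: (le_trans (le_norm_mean If)).
rewrite -[leRHS]mean_cst; apply: le_mean => //.
  exact: integrableI_norm.
by apply: continuous_integrableI; exact: cst_continuous.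
Qed.

Lemma aeW (P Q : R -> Prop) : (forall x, P x -> Q x) ->
  {ae mu, forall x, P x} -> {ae mu, forall x, Q x}.
Proof.
move=> PQ [N [mN N0 PN]]; exists N; split => //.
by apply: subset_trans PN => x /= nQ Px; exact: nQ (PQ _ Px).
Qed.

Lemma ae_eq_mean f g : measurable_fun Iper f -> measurable_fun Iper g ->
  {ae mu, forall x, Iper x -> f x = g x} -> mean f = mean g.
Proof.
move=> mf mg fg; congr (_ * _); rewrite /Rintegral; congr fine.
apply: ae_eq_integral => //; [exact/measurable_EFinP..|].
by apply: aeW fg => x h /h /= ->.
Qed.

End Mean.
#[global] Hint Resolve measurable_Iper : core.

(** * Fourier coefficients of real functions *)

Section FourierCoefficients.
Context {R : realType}.
Notation mu := (@lebesgue_measure R).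
Implicit Types (f g : R -> R) (k : int).

Lemma continuous_cosM (c : R) : continuous (fun x : R => cos (c * x)).
Proof.
move=> x; apply: (continuous_comp (f := fun y : R => c * y) (g := cos)).
  by apply: continuousM; [exact: cst_continuous|exact: cvg_id].
exact: continuous_cos.
Qed.

Lemma continuous_sinM (c : R) : continuous (fun x : R => sin (c * x)).
Proof.
move=> x; apply: (continuous_comp (f := fun y : R => c * y) (g := sin)).
  by apply: continuousM; [exact: cst_continuous|exact: cvg_id].
exact: continuous_sin.
Qed.

Lemma integrableI_cos f (c : R) : integrableI f ->
  integrableI (fun x => f x * cos (c * x)).
Proof.
move=> If; apply: integrableIMr => //; first exact: continuous_cosM.
by move=> x; exact: cos_max.
Qed.

Lemma integrableI_sin f (c : R) : integrableI f ->
  integrableI (fun x => f x * sin (c * x)).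
Proof.
move=> If; apply: integrableIMr => //; first exact: continuous_sinM.
by move=> x; exact: sin_max.
Qed.

Lemma fcoef_reE f k : fcoef_re f k = mean (fun x => f x * cos (k%:~R * x)).
Proof. by []. Qed.

Lemma fcoef_imE f k : fcoef_im f k = - mean (fun x => f x * sin (k%:~R * x)).
Proof. by []. Qed.

Lemma fcoef_reZ (c : R) f k : integrableI f ->
  fcoef_re (fun x => c * f x) k = c * fcoef_re f k.
Proof.
move=> If; rewrite !fcoef_reE -meanZ; [|exact: integrableI_cos..].
by apply: eq_mean => x _; rewrite mulrA.
Qed.

Lemma fcoef_imZ (c : R) f k : integrableI f ->
  fcoef_im (fun x => c * f x) k = c * fcoef_im f k.
Proof.
move=> If; rewrite !fcoef_imE mulrN -meanZ; [|exact: integrableI_sin..].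
by congr (- _); apply: eq_mean => x _; rewrite mulrA.
Qed.

Lemma fcoef_reB f g k : integrableI f -> integrableI g ->
  fcoef_re (fun x => f x - g x) k = fcoef_re f k - fcoef_re g k.
Proof.
move=> If Ig; rewrite !fcoef_reE -meanB; [|exact: integrableI_cos..].
by apply: eq_mean => x _; rewrite mulrBl.
Qed.

Lemma fcoef_imB f g k : integrableI f -> integrableI g ->
  fcoef_im (fun x => f x - g x) k = fcoef_im f k - fcoef_im g k.
Proof.
move=> If Ig; rewrite !fcoef_imE -opprD; congr (- _).
rewrite -meanB; [|exact: integrableI_sin..].
by apply: eq_mean => x _; rewrite mulrBl.
Qed.

Lemma fcoef_reN f k : fcoef_re f (- k) = fcoef_re f k.
Proof.
by rewrite !fcoef_reE; apply: eq_mean => x _; rewrite intrN mulNr cosN.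
Qed.

Lemma fcoef_imN f k : integrableI f -> fcoef_im f (- k) = - fcoef_im f k.
Proof.
move=> If; rewrite !fcoef_imE; congr (- _).
rewrite -[RHS]mulN1r -meanZ; last exact: integrableI_sin.
by apply: eq_mean => x _; rewrite intrN mulNr sinN; ring.
Qed.

Lemma fcoef_sq_ge0 f k : 0 <= fcoef_sq f k.
Proof. by rewrite addr_ge0// sqr_ge0. Qed.

Lemma norm_fcoef_re_le f k (C : R) : integrableI f ->
  (forall x, Iper x -> `|f x| <= C) -> `|fcoef_re f k| <= C.
Proof.
move=> If fC; rewrite fcoef_reE; apply: norm_mean_le; first exact: integrableI_cos.
move=> x Ix; rewrite normrM; apply: le_trans (fC _ Ix).
by rewrite ler_piMr// cos_max.
Qed.

Lemma norm_fcoef_im_le f k (C : R) : integrableI f ->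
  (forall x, Iper x -> `|f x| <= C) -> `|fcoef_im f k| <= C.
Proof.
move=> If fC; rewrite fcoef_imE normrN; apply: norm_mean_le; first exact: integrableI_sin.
move=> x Ix; rewrite normrM; apply: le_trans (fC _ Ix).
by rewrite ler_piMr// sin_max.
Qed.

Lemma sin_intpi k : sin (k%:~R * pi) = 0 :> R.
Proof.
have sn (n : nat) : sin (n%:R * pi) = 0 :> R.
  elim: n => [|n ih]; first by rewrite mul0r sin0.
  by rewrite -natr1 mulrDl mul1r sinDpi ih oppr0.
by case: k => n; [exact: sn|rewrite NegzE intrN mulNr sinN -pmulrn sn oppr0].
Qed.

Lemma is_derive_mull (c x : R) : is_derive x (1 : R) (fun y : R => c * y) c.
Proof.
have -> : (fun y : R => c * y) = c *: (@id R) by [].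
have -> : c = c *: (1 : R) by rewrite /GRing.scale/= mulr1.
rewrite {2}/GRing.scale/= mulr1; exact: is_deriveZ.
Qed.

Lemma is_derive_sinM (c x : R) : is_derive x 1 (fun y : R => sin (c * y)) (c * cos (c * x)).
Proof.
have -> : (fun y : R => sin (c * y)) = sin \o (fun y => c * y) by [].
have h := is_derive_mull c x.
by rewrite mulrC; exact: is_derive1_comp.
Qed.

Lemma is_derive_cosM (c x : R) : is_derive x 1 (fun y : R => cos (c * y)) (- (c * sin (c * x))).
Proof.
have -> : (fun y : R => cos (c * y)) = cos \o (fun y => c * y) by [].
have h := is_derive_mull c x.
by rewrite mulrC -mulNr; exact: is_derive1_comp.
Qed.

Lemma derivable_LRcontinuous (f : R -> R) (a b : R) : (forall x : R, derivable f x 1) ->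
  derivable_oo_LRcontinuous f a b.
Proof.
move=> df; have cf : continuous f.
  by move=> x; exact/differentiable_continuous/derivable1_diffP.
split; first by move=> x _.
- by apply: cvg_at_right_filter; exact: cf.
- by apply: cvg_at_left_filter; exact: cf.
Qed.

Lemma mean_derive (F f : R -> R) : continuous f ->
  (forall x : R, is_derive x 1 F (f x)) -> mean f = (2 * pi)^-1 * (F pi - F (- pi)).
Proof.
move=> cf dF; rewrite /mean /Rintegral (@continuous_FTC2 _ f F)//.
- by have := @pi_gt0 R; lra.
- exact: continuous_subspaceT.
- by apply: derivable_LRcontinuous => x; case: (dF x).
- by move=> x _; rewrite derive1E; case: (dF x).
Qed.

Lemma mean_cos k : mean (fun x : R => cos (k%:~R * x)) = (k == 0)%:R.
Proof.
have [->|k0] := eqVneq k 0.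
  rewrite (_ : (fun=> _) = fun=> 1) ?mean_cst//.
  by apply/funext => x; rewrite mul0r cos0.
have kR : k%:~R != 0 :> R by rewrite intr_eq0.
have dF (x : R) : is_derive x 1 (fun x => k%:~R^-1 * sin (k%:~R * x)) (cos (k%:~R * x)).
  rewrite -[X in is_derive _ _ _ X](mulKf kR).
  exact: (is_deriveZ _ (is_derive_sinM _ _)).
rewrite (mean_derive _ dF); last exact: continuous_cosM.
by rewrite mulrN sinN sin_intpi oppr0 mulr0 subrr mulr0.
Qed.

Lemma mean_sin k : mean (fun x : R => sin (k%:~R * x)) = 0.
Proof.
have [->|k0] := eqVneq k 0.
  rewrite (_ : (fun=> _) = fun=> 0) ?mean_cst//.
  by apply/funext => x; rewrite mul0r sin0.
have kR : k%:~R != 0 :> R by rewrite intr_eq0.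
have dF (x : R) : is_derive x 1 (fun x => - k%:~R^-1 * cos (k%:~R * x)) (sin (k%:~R * x)).
  rewrite (_ : sin _ = - k%:~R^-1 * - (k%:~R * sin (k%:~R * x))); last by field.
  exact: (is_deriveZ _ (is_derive_cosM _ _)).
rewrite (mean_derive _ dF); last exact: continuous_sinM.
by rewrite mulrN cosN subrr mulr0.
Qed.

(** Integration by parts, read off from the mean of the derivative of [f] times a cosine or a sine:
    the boundary terms cancel by periodicity for the cosine and vanish for the sine. *)
Lemma fcoef_derive f (f' : R -> R) k :
  periodic2pi f -> (forall x : R, is_derive x 1 f (f' x)) -> continuous f' ->
  fcoef_re f' k = - k%:~R * fcoef_im f k /\ fcoef_im f' k = k%:~R * fcoef_re f k.
Proof.
move=> pf df cf'.
have cf : continuous f.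
  by move=> x; apply/differentiable_continuous/derivable1_diffP; case: (df x).
have If := continuous_integrableI cf.
have If' := continuous_integrableI cf'.
have fpi : f pi = f (- pi) by rewrite -(pf (- pi)); congr f; ring.
split.
- rewrite fcoef_reE fcoef_imE mulrNN.
  rewrite -meanZ; last exact: integrableI_sin.
  apply/eqP; rewrite -subr_eq0 -meanB.
  + have dF (x : R) : is_derive x 1 (fun x => f x * cos (k%:~R * x))
        (f' x * cos (k%:~R * x) - k%:~R * (f x * sin (k%:~R * x))).
      have := is_deriveM (df x) (is_derive_cosM k%:~R x).
      rewrite (_ : _ *: _ + _ = f' x * cos (k%:~R * x) - k%:~R * (f x * sin (k%:~R * x)))//.
      by rewrite /GRing.scale/=; ring.
    rewrite (mean_derive _ dF); first by rewrite fpi mulrN cosN subrr mulr0.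
    move=> x; apply: cvgB; first by apply: cvgM; [exact: cf'|exact: continuous_cosM].
    apply: cvgM; first exact: cvg_cst.
    by apply: cvgM; [exact: cf|exact: continuous_sinM].
  + exact: integrableI_cos.
  + by apply: integrableIZ; exact: integrableI_sin.
- rewrite fcoef_reE fcoef_imE -meanZ; last exact: integrableI_cos.
  apply/eqP; rewrite eq_sym -addr_eq0 -meanD.
  + have dF (x : R) : is_derive x 1 (fun x => f x * sin (k%:~R * x))
        (k%:~R * (f x * cos (k%:~R * x)) + f' x * sin (k%:~R * x)).
      have := is_deriveM (df x) (is_derive_sinM k%:~R x).
      rewrite (_ : _ *: _ + _ = k%:~R * (f x * cos (k%:~R * x)) + f' x * sin (k%:~R * x))//.
      by rewrite /GRing.scale/=; ring.
    rewrite (mean_derive _ dF).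
      by rewrite fpi mulrN sinN sin_intpi oppr0 mulr0 subrr mulr0.
    move=> x; apply: cvgD; last by apply: cvgM; [exact: cf'|exact: continuous_sinM].
    apply: cvgM; first exact: cvg_cst.
    by apply: cvgM; [exact: cf|exact: continuous_cosM].
  + by apply: integrableIZ; exact: integrableI_cos.
  + exact: integrableI_sin.
Qed.

End FourierCoefficients.

(** * Completeness of the trigonometric system *)

Section Completeness.
Context {R : realType}.
Notation mu := (@lebesgue_measure R).
Implicit Types (f g : R -> R) (k : int).

(** The linear span of the characters, given inductively so that orthogonality extends to it by
    induction. The product-to-sum formulas make it an algebra, hence it contains every polynomial in
    [cos (x - a)]. *)
Inductive trig : (R -> R) -> Prop :=
| trig_cos k : trig (fun x => cos (k%:~R * x))
| trig_sin k : trig (fun x => sin (k%:~R * x))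
| trigD f g : trig f -> trig g -> trig (fun x => f x + g x)
| trigZ (c : R) f : trig f -> trig (fun x => c * f x).

Lemma eq_trig f g : (forall x, f x = g x) -> trig f -> trig g.
Proof. by move=> /funext ->. Qed.

Lemma trigM f g : trig f -> trig g -> trig (fun x => f x * g x).
Proof.
move=> tf tg; elim: tf => [k|k|f1 f2 _ t1 _ t2|c f1 _ t1].
- elim: tg => [l|l|g1 g2 _ t1 _ t2|c g1 _ t1].
  + apply: (eq_trig _ (trigD (trigZ 2^-1 (trig_cos (k + l))) (trigZ 2^-1 (trig_cos (k - l))))).
    by move=> x; rewrite (intrD _ k l) (intrB _ k l) !mulrDl !mulNr !cosD cosN sinN; field.
  + apply: (eq_trig _ (trigD (trigZ 2^-1 (trig_sin (k + l))) (trigZ (- 2^-1) (trig_sin (k - l))))).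
    by move=> x; rewrite (intrD _ k l) (intrB _ k l) !mulrDl !mulNr !sinD cosN sinN; field.
  + by apply: (eq_trig _ (trigD t1 t2)) => x; rewrite mulrDr.
  + by apply: (eq_trig _ (trigZ c t1)) => x; rewrite mulrCA.
- elim: tg => [l|l|g1 g2 _ t1 _ t2|c g1 _ t1].
  + apply: (eq_trig _ (trigD (trigZ 2^-1 (trig_sin (k + l))) (trigZ 2^-1 (trig_sin (k - l))))).
    by move=> x; rewrite (intrD _ k l) (intrB _ k l) !mulrDl !mulNr !sinD cosN sinN; field.
  + apply: (eq_trig _ (trigD (trigZ 2^-1 (trig_cos (k - l))) (trigZ (- 2^-1) (trig_cos (k + l))))).
    by move=> x; rewrite (intrD _ k l) (intrB _ k l) !mulrDl !mulNr !cosD cosN sinN; field.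
  + by apply: (eq_trig _ (trigD t1 t2)) => x; rewrite mulrDr.
  + by apply: (eq_trig _ (trigZ c t1)) => x; rewrite mulrCA.
- by apply: (eq_trig _ (trigD t1 t2)) => x; rewrite mulrDl.
- by apply: (eq_trig _ (trigZ c t1)) => x; rewrite mulrA.
Qed.

Lemma trig_cst (c : R) : trig (fun=> c).
Proof.
by apply: (eq_trig _ (trigZ c (trig_cos 0))) => x; rewrite mul0r cos0 mulr1.
Qed.

Lemma trigX f n : trig f -> trig (fun x => f x ^+ n).
Proof.
move=> tf; elim: n => [|n ih]; first exact: trig_cst.
by apply: (eq_trig _ (trigM tf ih)) => x; rewrite exprS.
Qed.

Lemma trig_cosB (a : R) : trig (fun x => cos (x - a)).
Proof.
apply: (eq_trig _ (trigD (trigZ (cos a) (trig_cos 1)) (trigZ (sin a) (trig_sin 1)))).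
by move=> x; rewrite mul1r cosB; ring.
Qed.

Lemma continuous_trig f : trig f -> continuous f.
Proof.
elim => [k|k|f1 f2 _ c1 _ c2|c f1 _ c1].
- exact: continuous_cosM.
- exact: continuous_sinM.
- by move=> x; apply: cvgD; [exact: c1|exact: c2].
- by move=> x; apply: cvgM; [exact: cvg_cst|exact: c1].
Qed.

Lemma trig_mean0 f g : integrableI f ->
  (forall k, fcoef_re f k = 0) -> (forall k, fcoef_im f k = 0) ->
  trig g -> integrableI (fun x => f x * g x) /\ mean (fun x => f x * g x) = 0.
Proof.
move=> If re0 im0; elim => [k|k|g1 g2 _ [I1 m1] _ [I2 m2]|c g1 _ [I1 m1]].
- by split; [exact: integrableI_cos|rewrite -fcoef_reE].
- split; first exact: integrableI_sin.
  by apply/eqP; rewrite -oppr_eq0 -fcoef_imE im0.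
- have -> : (fun x => f x * (g1 x + g2 x)) = (fun x => f x * g1 x + f x * g2 x).
    by apply/funext => x; rewrite mulrDr.
  by split; [exact: integrableID|rewrite meanD// m1 m2 addr0].
- have -> : (fun x => f x * (c * g1 x)) = (fun x => c * (f x * g1 x)).
    by apply/funext => x; rewrite mulrCA.
  by split; [exact: integrableIZ|rewrite meanZ// m1 mulr0].
Qed.

Lemma bernoulli_ineq (t : R) n : 0 <= t <= 1 -> 1 - n%:R * t <= (1 - t) ^+ n.
Proof.
move=> /andP[t0 t1]; elim: n => [|n ih]; first by rewrite mul0r subr0 expr0.
rewrite exprS; have h : (1 - t) * (1 - n%:R * t) <= (1 - t) * (1 - t) ^+ n.
  by rewrite ler_wpM2l// subr_ge0.
apply: le_trans h; rewrite -natr1.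
have : 0 <= n%:R * t * t :> R by rewrite !mulr_ge0.
by nra.
Qed.

Lemma bernoulli_ineq_inv (t : R) n : 0 <= t <= 1 -> (1 - t) ^+ n * (1 + n%:R * t) <= 1.
Proof.
move=> /andP[t0 t1]; elim: n => [|n ih]; first by rewrite mul0r addr0 expr0 mulr1.
apply: le_trans ih; rewrite exprS mulrAC mulrC.
rewrite ler_wpM2l ?exprn_ge0 ?subr_ge0// -natr1.
have : 0 <= n%:R * t * t :> R by rewrite !mulr_ge0.
by nra.
Qed.

(** The polynomials of the Brosowski-Deutsch proof of the Stone-Weierstrass theorem. On [[0, 1]]
    they tend to 1 where [m t < 1] and to 0 where [m t > 1]: Bernoulli's inequality gives
    [1 - (m t)^n] from below, its inverse form [(m t)^-n] from above. *)
Definition stepn (m : nat) (t : R) n := (1 - t ^+ n) ^+ (m ^ n).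

Lemma stepn_itv m t n : 0 <= t <= 1 -> 0 <= stepn m t n <= 1.
Proof.
move=> /andP[t0 t1]; have tn0 : 0 <= t ^+ n by rewrite exprn_ge0.
have tn1 : t ^+ n <= 1 by rewrite exprn_ile1.
by rewrite exprn_ge0 ?exprn_ile1 ?subr_ge0// lerBlDr lerDl.
Qed.

Lemma stepn_cvg1 m t : 0 <= t <= 1 -> m%:R * t < 1 -> stepn m t n @[n --> \oo] --> (1 : R).
Proof.
move=> /andP[t0 t1] mt; have mt0 : 0 <= m%:R * t by rewrite mulr_ge0.
apply: (@squeeze_cvgr _ _ _ _ (fun n => 1 - (m%:R * t) ^+ n) (fun=> 1)).
- apply: nearW => n; have /andP[_ ->] := @stepn_itv m t n (introT andP (conj t0 t1)).
  rewrite andbT exprMn -natrX; apply: bernoulli_ineq.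
  by rewrite exprn_ge0//= exprn_ile1.
- rewrite -[X in _ --> X]subr0; apply: cvgB; first exact: cvg_cst.
  by apply: cvg_expr; rewrite ger0_norm.
- exact: cvg_cst.
Qed.

Lemma stepn_cvg0 m t : 0 <= t <= 1 -> 1 < m%:R * t -> stepn m t n @[n --> \oo] --> (0 : R).
Proof.
move=> /andP[t0 t1] mt; set q := m%:R * t in mt *.
have q0 : 0 < q by lra.
apply: (@squeeze_cvgr _ _ _ _ (fun=> 0) (fun n => (q^-1) ^+ n)).
- apply: nearW => n; have /andP[-> _] /= := @stepn_itv m t n (introT andP (conj t0 t1)).
  have tn : 0 <= t ^+ n <= 1 by rewrite exprn_ge0//= exprn_ile1.
  have := bernoulli_ineq_inv (m ^ n) tn; rewrite natrX -exprMn -/q => h.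
  have qn : 0 < q ^+ n by rewrite exprn_gt0.
  rewrite exprVn -[leRHS]mul1r ler_pdivlMr//; apply: le_trans h.
  rewrite ler_wpM2l; [by []| |by lra].
  by have /andP[] := @stepn_itv m t n (introT andP (conj t0 t1)).
- exact: cvg_cst.
- apply: cvg_expr; rewrite ger0_norm ?invr_ge0 ?(ltW q0)//.
  by rewrite invf_lt1.
Qed.

Section Arc.
Variables (f : R -> R) (a d : R).
Hypotheses (If : integrableI f) (re0 : forall k, fcoef_re f k = 0)
  (im0 : forall k, fcoef_im f k = 0) (d0 : 0 < d) (ad : `|a| + d < pi).

(** With this [lam], [m * tt x] equals [(1 - cos (x - a)) / (1 - cos d)], which crosses 1 exactly
    where [|x - a| = d]. The integer [m] is taken large enough for [lam <= 1], which keeps [tt] in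
    [[0, 1]]. *)
Let m := (Num.truncn (2 / (1 - cos d))).+1.
Let lam : R := 2 / (m%:R * (1 - cos d)).
Let tt x : R := lam * ((1 - cos (x - a)) / 2).

Let a0 : 0 <= `|a|. Proof. exact: normr_ge0. Qed.

Let cd1 : 0 < 1 - cos d.
Proof.
have dp : d <= pi by move: ad a0; lra.
have : cos d < cos 0.
  by rewrite ltr_cos// in_itv/= ?lexx ?pi_ge0// (ltW d0).
by rewrite cos0; lra.
Qed.

Let mlam : m%:R * lam * (1 - cos d) = 2.
Proof. by rewrite /lam; field; rewrite pnatr_eq0 gt_eqF. Qed.

Let lam01 : 0 < lam <= 1.
Proof.
have m0 : 0 < m%:R :> R by rewrite ltr0n.
rewrite /lam divr_gt0 ?mulr_gt0//= ler_pdivrMr ?mulr_gt0// mul1r.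
rewrite -ler_pdivrMr//; apply: ltW; exact: truncnS_gt.
Qed.

Let m0 : 0 < m%:R :> R. Proof. by rewrite ltr0n. Qed.

Let tt01 x : 0 <= tt x <= 1.
Proof.
have /andP[l0 l1] := lam01; have := cos_le1 (x - a); have := cos_geN1 (x - a) => h1 h2.
apply/andP; split; first by rewrite mulr_ge0 ?(ltW l0)//; lra.
by apply: mulr_ile1; lra.
Qed.

Let tt_in x : `|x - a| < d -> m%:R * tt x < 1.
Proof.
move=> xa; have : cos d < cos `|x - a|.
  rewrite ltr_cos// in_itv/= ?normr_ge0 ?(ltW d0)//=; move: ad a0; lra.
rewrite cos_norm => h; have /andP[l0 l1] := lam01.
have : (m%:R * lam) * (1 - cos (x - a)) < (m%:R * lam) * (1 - cos d).
  by rewrite (ltr_pM2l (mulr_gt0 m0 l0)); lra.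
by rewrite mlam /tt => hm; rewrite mulrA; lra.
Qed.

Let tt_out x : Iper x -> d < `|x - a| -> 1 < m%:R * tt x.
Proof.
rewrite /Iper/= in_itv/= => /andP[x1 x2] xa.
have ha : `|x - a| <= `|x| + `|a| by exact: ler_normB.
have hx : `|x| <= pi by rewrite ler_norml x1.
have : cos `|x - a| < cos d.
  have [xp|xp] := leP `|x - a| pi.
    rewrite ltr_cos// in_itv/= ?normr_ge0 ?(ltW d0)//=; move: ad a0; lra.
  (* Beyond [pi] the cosine increases again, but [|a| + d < pi] keeps the reflected distance
     [2 * pi - |x - a|] larger than [d]. *)
  have -> : cos `|x - a| = cos (2 * pi - `|x - a|).
    by rewrite cosB mulr_natl cos2pi sin2pi; ring.
  rewrite ltr_cos ?in_itv/=; move: ad a0 d0; lra.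
rewrite cos_norm => h; have /andP[l0 l1] := lam01.
have : (m%:R * lam) * (1 - cos d) < (m%:R * lam) * (1 - cos (x - a)).
  by rewrite (ltr_pM2l (mulr_gt0 m0 l0)); lra.
by rewrite mlam /tt => hm; rewrite mulrA; lra.
Qed.

Let trig_step n : trig (fun x => stepn m (tt x) n).
Proof.
apply: trigX.
apply: (@eq_trig (fun x => 1 + (-1) * (tt x) ^+ n)); first by move=> x; ring.
apply: trigD; first exact: trig_cst.
apply: trigZ; apply: trigX; apply: trigZ.
apply: (@eq_trig (fun x => 2^-1 + (- 2^-1) * cos (x - a))); first by move=> x; field.
by apply: trigD; [exact: trig_cst|apply: trigZ; exact: trig_cosB].
Qed.

Let step_le x n : `|f x * stepn m (tt x) n| <= `|f x|.
Proof.
rewrite normrM ler_piMr//.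
by have /andP[h1 h2] := stepn_itv m n (tt01 x); rewrite ger0_norm.
Qed.

(** Each [stepn m (tt x) n] is a trigonometric polynomial, so [f] integrates to zero against it.
    Dominated convergence, with dominating function [|f|], passes to the indicator of the arc; the
    two end points, where the limit is not controlled, form a null set. *)
Lemma integral_ball_eq0 : (\int[mu]_(x in ball a d) (f x)%:E = 0)%E.
Proof.
have bE : ball a d = `]a - d, a + d[%classic by rewrite -ball_itv.
have bI : ball a d `<=` Iper.
  rewrite bE => x; rewrite /Iper/= !in_itv/= => /andP[h1 h2].
  by have := ler_norm a; have := ler_norm (- a); rewrite normrN; move: ad a0; lra.
pose fl := (f \_ (ball a d)).
have mf : measurable_fun Iper f by exact: integrableI_measurable.
have mb : measurable (ball a d : set (measurableTypeR R)) by rewrite bE; exact: measurable_itv.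
have mfl : measurable_fun Iper fl.
  apply/(measurable_restrict f mb measurable_Iper).
  by apply: (measurable_funS measurable_Iper _ mf) => x [].
have mfn n : measurable_fun Iper (fun x => (f x * stepn m (tt x) n)%:E).
  apply/measurable_EFinP/measurable_funM => //.
  apply: measurable_funTS; apply: continuous_measurable_fun.
  by apply: continuous_trig; exact: trig_step.
have ffl : {ae mu, forall x, Iper x ->
    (fun n => (f x * stepn m (tt x) n)%:E) @ \oo --> (fl x)%:E}.
  exists [set a - d; a + d]; split.
  - exact: measurableU.
  - apply: countable_lebesgue_measure0.
    by apply: finite_set_countable; exact: finite_set2.
  move=> x /= /existsNP[Ix]; apply: contra_notP => xad.
  have xd : `|x - a| != d.
    apply/eqP => h; apply: xad.
    by move: h; case: ger0P => _ h; [right|left]; rewrite -h; ring.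
  apply: cvg_EFin; first exact: nearW.
  rewrite /= (_ : _ \o _ = fun n => f x * stepn m (tt x) n)//.
  rewrite /fl patchE; case: ifPn => [/set_mem|/negP/(contra_not (@mem_set _ _ _))]; rewrite /ball/= distrC => h.
    rewrite -[X in _ --> X]mulr1; apply: cvgM; first exact: cvg_cst.
    by apply: stepn_cvg1; [exact: tt01|exact: tt_in].
  rewrite -[X in _ --> X](mulr0 (f x)); apply: cvgM; first exact: cvg_cst.
  apply: stepn_cvg0; [exact: tt01|apply: tt_out => //].
  by rewrite lt_neqAle eq_sym xd/= leNgt; apply/negP.
have [] := dominated_convergence measurable_Iper mfn _ ffl (integrable_norm If).
- exact/measurable_EFinP.
- by apply: aeW ffl => x _ n Ix; rewrite lee_fin step_le.
move=> _ _ h.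
have z n : (\int[mu]_(x in Iper) (f x * stepn m (tt x) n)%:E = 0)%E.
  have [Ig mg] := trig_mean0 If re0 im0 (trig_step n).
  rewrite -[LHS]fineK; last exact: (integrable_fin_num measurable_Iper Ig).
  congr EFin; move/eqP: mg; rewrite mulf_eq0 invr_eq0 gt_eqF ?pi2_gt0//=.
  by move/eqP.
have fl0 : (\int[mu]_(x in Iper) (fl x)%:E = 0)%E.
  apply: (cvg_unique _ h) => //.
  rewrite (_ : [sequence _]_n = fun=> 0%E); first exact: cvg_cst.
  by apply/funext => n; exact: z.
have -> : ball a d = Iper `&` ball a d by rewrite setIC; apply/esym/setIidPl.
rewrite integral_mkcondr -[RHS]fl0; apply: eq_integral => x _.
by rewrite /fl restrict_EFin.
Qed.
End Arc.

(** Lebesgue differentiation recovers [f] almost everywhere from its integrals over small balls, all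
    of which vanish. The points [- pi] and [pi] are discarded because no ball around them stays
    inside the period. *)
Theorem fcoef_eq0_ae f : integrableI f ->
  (forall k, fcoef_re f k = 0) -> (forall k, fcoef_im f k = 0) ->
  {ae mu, forall x, Iper x -> f x = 0}.
Proof.
move=> If re0 im0.
have locf := integrable_locally_restrict measurable_Iper If.
have end0 : {ae mu, forall x, x != - pi /\ x != pi}.
  exists [set - pi; pi]; split.
  - exact: measurableU.
  - apply: countable_lebesgue_measure0.
    by apply: finite_set_countable; exact: finite_set2.
  move=> x /= h; have [->|x1] := eqVneq x (- pi); first by left.
  have [->|x2] := eqVneq x pi; first by right.
  by exfalso; apply: h.
have := lebesgue_differentiation locf; move: end0.
apply: filterS2; first exact: (ae_filter_ringOfSetsType mu).
move=> x [xn1 xn2] lx Ix.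
have r0 (n : nat) : 0 < (n.+1%:R^-1 : R) by rewrite invr_gt0.
have hE : forall y : R, nicely_shrinking y (fun n : nat => ball y (n.+1%:R^-1 : R)).
  move=> y; split; first by move=> n; exact: measurable_ball.
  exists (1, fun n => PosNum (r0 n)); split => //=.
  - exact: cvg_harmonic.
  - by move=> n; exact: subset_refl.
  - by move=> n; rewrite mul1e.
have := nice_lebesgue_differentiation hE locf lx.
have xpi : `|x| < pi.
  move: Ix xn1 xn2; rewrite /Iper/= in_itv/= => /andP[h1 h2] n1 n2.
  by rewrite ltr_norml !lt_neqAle h1 h2 n2 eq_sym n1.
rewrite patchE mem_set// => h.
apply/EFin_inj; apply: (cvg_unique _ h) => //.
have pix : 0 < pi - `|x| by lra.
apply: cvg_near_cst.
near=> n.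
have nx : n.+1%:R^-1 < pi - `|x|.
  by near: n; exact: (near_infty_natSinv_lt (PosNum pix)).
have z : (\int[mu]_(y in ball x n.+1%:R^-1) (f y)%:E = 0)%E.
  by apply: integral_ball_eq0 => //; rewrite addrC -ltrBrDr.
rewrite -[LHS]/((mu (ball x n.+1%:R^-1))^-1 * _)%E.
rewrite (_ : (\int[_]_(_ in _) _ = 0)%E) ?mule0// -[RHS]z.
apply: eq_integral => y /set_mem; rewrite ball_itv/= in_itv/= => /andP[y1 y2].
rewrite patchE mem_set// /Iper/= in_itv/=.
move: nx y1 y2; move: (n.+1%:R^-1) => r nx y1 y2.
by have := ler_norm x; have := ler_norm (- x); rewrite normrN; lra.
Unshelve. all: by end_near. Qed.

End Completeness.

(** * Symmetric ranges of frequencies *)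

Section Zrange.

Definition zrange (M : nat) : seq int :=
  [seq n%:Z | n <- iota 0 M.+1] ++ [seq - n%:Z | n <- iota 1 M].

Lemma mem_zrange (k : int) M : (k \in zrange M) = (`|k| <= M)%N.
Proof.
rewrite mem_cat; apply/idP/idP.
- case/orP => /mapP[n]; rewrite mem_iota => /andP[n1 n2] ->; lia.
- move=> kM; have [k0|k0] := leP 0 k.
    apply/orP; left; apply/mapP; exists `|k|%N; last by lia.
    by rewrite mem_iota; lia.
  apply/orP; right; apply/mapP; exists `|k|%N; last by lia.
  by rewrite mem_iota; lia.
Qed.

Lemma uniq_zrange M : uniq (zrange M).
Proof.
rewrite cat_uniq !map_inj_uniq ?iota_uniq//=; [|by move=> x y; lia..].
rewrite andbT; apply/hasPn => x /mapP[n]; rewrite mem_iota => /andP[n1 _] ->.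
apply/negP => h.
by have /mapP[m _] : - n%:Z \in [seq n%:Z | n <- iota 0 M.+1] := h; lia.
Qed.

Lemma sum_zrangeN (V : nmodType) (F : int -> V) M :
  \sum_(k <- zrange M) F (- k) = \sum_(k <- zrange M) F k.
Proof.
rewrite -(big_map (fun k : int => - k) xpredT F); apply: perm_big.
apply: uniq_perm; [|exact: uniq_zrange|].
  by rewrite map_inj_uniq ?uniq_zrange//; exact: oppr_inj.
move=> k; rewrite mem_zrange; apply/mapP/idP => [[l]|kM].
  by rewrite mem_zrange => lM ->; lia.
by exists (- k); rewrite ?opprK// mem_zrange; lia.
Qed.

Lemma sum_zrange_odd (V : zmodType) (F : int -> V) M :
  (forall k, F (- k) = - F k) -> (\sum_(k <- zrange M) F k) *+ 2 = 0.
Proof.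
move=> oF; rewrite mulr2n; apply/eqP; rewrite addr_eq0 -sumrN.
by rewrite -[eqbLHS]sum_zrangeN; apply/eqP; apply: eq_bigr => k _; rewrite oF.
Qed.

Lemma sum_zrangeS (V : zmodType) (F : int -> V) M :
  \sum_(k <- zrange M.+1) F k =
  \sum_(k <- zrange M) F k + (F M.+1%:Z + F (- M.+1%:Z)).
Proof.
have iotaS m n : iota m n.+1 = rcons (iota m n) (m + n)%N.
  by rewrite -addn1 iotaD cats1.
rewrite /zrange (iotaS 0%N M.+1) (iotaS 1%N M) !map_rcons -!cats1 !big_cat.
by rewrite !big_seq1 add0n add1n addrACA.
Qed.

Lemma sum_zrange0 (V : zmodType) (F : int -> V) :
  \sum_(k <- zrange 0) F k = F 0.
Proof. by rewrite /zrange/= big_seq1. Qed.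

Lemma sum_zrange_delta (R : pzRingType) (F : int -> R) M j :
  \sum_(k <- zrange M) (k == j)%:R * F k = (j \in zrange M)%:R * F j.
Proof.
case: (boolP (j \in zrange M)) => jM.
  rewrite (bigD1_seq j jM (uniq_zrange M)) eqxx big1; first exact: addr0.
  by move=> i /negbTE ->; rewrite mul0r.
rewrite mul0r big_seq big1// => i iM; case: eqP => [ij|_]; last by rewrite mul0r.
by rewrite -ij iM in jM.
Qed.

End Zrange.

(** * Trigonometric polynomials and their squares *)

Section TrigPolynomials.
Context {R : realType}.
Implicit Types (a b : int -> R) (k : int) (M : nat).

(** Real and imaginary parts of the sum of [z_l z_m] over [l + m = k], where [z = a + i b]. *)
Definition conv_re M a b k : R :=
  \sum_(l <- zrange M) \sum_(m <- zrange M) (l + m == k)%:R * (a l * a m - b l * b m).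
Definition conv_im M a b k : R :=
  \sum_(l <- zrange M) \sum_(m <- zrange M) (l + m == k)%:R * (a l * b m + b l * a m).

(** [tpoly] and [tpolyc] are the real and imaginary parts of the sum of [z_l e^(i l x)]. For the
    modes of a real function the second vanishes, by parity. *)
Definition tpoly M a b (x : R) : R :=
  \sum_(l <- zrange M) (a l * cos (l%:~R * x) - b l * sin (l%:~R * x)).
Definition tpolyc M a b (x : R) : R :=
  \sum_(l <- zrange M) (a l * sin (l%:~R * x) + b l * cos (l%:~R * x)).

Lemma tpolyc0 M a b x : (forall k, a (- k) = a k) -> (forall k, b (- k) = - b k) ->
  tpolyc M a b x = 0.
Proof.
move=> ea ob; have : tpolyc M a b x *+ 2 = 0.
  by apply: sum_zrange_odd => k; rewrite ea ob intrN mulNr sinN cosN; ring.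
by move/eqP; rewrite mulrn_eq0 => /eqP.
Qed.

Lemma continuous_sum (I : Type) (s : seq I) (F : I -> R -> R) :
  (forall i, continuous (F i)) -> continuous (fun x => \sum_(i <- s) F i x).
Proof.
move=> cF; elim: s => [|i s ih].
  by under eq_fun do rewrite big_nil; exact: cst_continuous.
under eq_fun do rewrite big_cons.
by move=> x; apply: cvgD; [exact: cF|exact: ih].
Qed.

Lemma continuous_tpoly M a b : continuous (tpoly M a b).
Proof.
apply: continuous_sum => l x; apply: cvgB; apply: cvgM; try exact: cvg_cst.
  exact: continuous_cosM.
exact: continuous_sinM.
Qed.

Lemma mean_delta (c d : R) (j : int) :
  mean (fun x => c * cos (j%:~R * x) - d * sin (j%:~R * x)) = (j == 0)%:R * c.
Proof.
rewrite meanB; [|apply: integrableIZ; apply: continuous_integrableI..]; last 2 first.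
- exact: continuous_cosM.
- exact: continuous_sinM.
rewrite !meanZ ?mean_cos ?mean_sin ?mulr0 ?subr0 1?mulrC//; apply: continuous_integrableI.
  exact: continuous_sinM.
exact: continuous_cosM.
Qed.

Lemma integrableI_trig (c d : R) (j : int) :
  integrableI (fun x => c * cos (j%:~R * x) - d * sin (j%:~R * x)).
Proof.
by apply: integrableIB; apply: integrableIZ; apply: continuous_integrableI;
  [exact: continuous_cosM|exact: continuous_sinM].
Qed.

Section Parity.
Variables (M : nat) (a b : int -> R).
Hypotheses (ea : forall k, a (- k) = a k) (ob : forall k, b (- k) = - b k).

Lemma fcoef_re_tpoly k : fcoef_re (tpoly M a b) k = (k \in zrange M)%:R * a k.
Proof.
rewrite fcoef_reE.
transitivity (mean (fun x => \sum_(l <- zrange M)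
    (a l * cos ((l - k)%:~R * x) - b l * sin ((l - k)%:~R * x)))).
  apply: eq_mean => x _.
  have c0 := tpolyc0 M x ea ob.
  (* Adding a multiple of the vanishing [tpolyc] completes the product to the real part of
     [p(x) e^(-i k x)], so that each term has the single frequency [l - k]. *)
  transitivity (tpoly M a b x * cos (k%:~R * x) + tpolyc M a b x * sin (k%:~R * x)).
    by rewrite c0 mul0r addr0.
  rewrite /tpoly /tpolyc !mulr_suml -big_split/=; apply: eq_bigr => l _.
  have -> : (l - k)%:~R * x = l%:~R * x - k%:~R * x by rewrite intrB mulrBl.
  by rewrite cosB sinB; ring.
rewrite mean_sum; last by move=> l; exact: integrableI_trig.
under eq_bigr do rewrite mean_delta subr_eq0.
exact: sum_zrange_delta.
Qed.

Lemma fcoef_im_tpoly k : fcoef_im (tpoly M a b) k = (k \in zrange M)%:R * b k.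
Proof.
rewrite fcoef_imE.
transitivity (mean (fun x => \sum_(l <- zrange M)
    (b l * cos ((l - k)%:~R * x) - (- a l) * sin ((l - k)%:~R * x)))).
  rewrite -[LHS]mulN1r -meanZ; last first.
    by apply/integrableI_sin/continuous_integrableI/continuous_tpoly.
  apply: eq_mean => x _.
  have c0 := tpolyc0 M x ea ob.
  transitivity (tpolyc M a b x * cos (k%:~R * x) - tpoly M a b x * sin (k%:~R * x)).
    by rewrite c0; ring.
  rewrite /tpoly /tpolyc !mulr_suml -sumrB; apply: eq_bigr => l _.
  have -> : (l - k)%:~R * x = l%:~R * x - k%:~R * x by rewrite intrB mulrBl.
  by rewrite cosB sinB; ring.
rewrite mean_sum; last by move=> l; exact: integrableI_trig.
under eq_bigr do rewrite mean_delta subr_eq0.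
exact: sum_zrange_delta.
Qed.

Let sumE (F : int -> R) (G : int -> R) :
  (\sum_(l <- zrange M) F l) * (\sum_(m <- zrange M) G m) =
  \sum_(l <- zrange M) \sum_(m <- zrange M) F l * G m.
Proof. by rewrite big_distrlr. Qed.

Let mean_sum2 (F : int -> int -> R -> R) : (forall l m, integrableI (F l m)) ->
  mean (fun x => \sum_(l <- zrange M) \sum_(m <- zrange M) F l m x) =
  \sum_(l <- zrange M) \sum_(m <- zrange M) mean (F l m).
Proof.
move=> IF; rewrite mean_sum; last by move=> l; exact: integrableI_sum.
by apply: eq_bigr => l _; rewrite mean_sum.
Qed.

Lemma fcoef_re_tpoly_sq k : fcoef_re (fun x => tpoly M a b x ^+ 2) k = conv_re M a b k.
Proof.
rewrite fcoef_reE.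
transitivity (mean (fun x => \sum_(l <- zrange M) \sum_(m <- zrange M)
    ((a l * a m - b l * b m) * cos ((l + m - k)%:~R * x)
     - (a l * b m + b l * a m) * sin ((l + m - k)%:~R * x)))).
  apply: eq_mean => x _; have c0 := tpolyc0 M x ea ob.
  (* The added terms are zero; they complete the product to the real part of [p(x)^2 e^(-i k x)]. *)
  transitivity (tpoly M a b x * tpoly M a b x * cos (k%:~R * x)
    + ((tpoly M a b x * tpolyc M a b x + tpolyc M a b x * tpoly M a b x) * sin (k%:~R * x)
    - tpolyc M a b x * tpolyc M a b x * cos (k%:~R * x))).
    by rewrite c0; ring.
  rewrite /tpoly /tpolyc !sumE -big_split/= !mulr_suml -sumrB -big_split/=.
  apply: eq_bigr => l _; rewrite -big_split/= !mulr_suml -sumrB -big_split/=.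
  apply: eq_bigr => m _.
  have -> : (l + m - k)%:~R * x = l%:~R * x + m%:~R * x - k%:~R * x.
    by rewrite intrB intrD mulrBl mulrDl.
  by rewrite cosB sinB cosD sinD; ring.
rewrite mean_sum2; last by move=> l m; exact: integrableI_trig.
by apply: eq_bigr => l _; apply: eq_bigr => m _; rewrite mean_delta subr_eq0.
Qed.

Lemma fcoef_im_tpoly_sq k : fcoef_im (fun x => tpoly M a b x ^+ 2) k = conv_im M a b k.
Proof.
rewrite fcoef_imE.
transitivity (mean (fun x => \sum_(l <- zrange M) \sum_(m <- zrange M)
    ((a l * b m + b l * a m) * cos ((l + m - k)%:~R * x)
     - (- (a l * a m - b l * b m)) * sin ((l + m - k)%:~R * x)))).
  rewrite -[LHS]mulN1r -meanZ; last first.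
    apply/integrableI_sin/continuous_integrableI => x.
    by apply: (cvgM (f := tpoly M a b) (g := tpoly M a b)); exact: continuous_tpoly.
  apply: eq_mean => x _; have c0 := tpolyc0 M x ea ob.
  transitivity ((tpoly M a b x * tpolyc M a b x + tpolyc M a b x * tpoly M a b x) * cos (k%:~R * x)
    - (tpoly M a b x * tpoly M a b x - tpolyc M a b x * tpolyc M a b x) * sin (k%:~R * x)).
    by rewrite c0; ring.
  rewrite /tpoly /tpolyc !sumE -big_split/= -sumrB !mulr_suml -sumrB.
  apply: eq_bigr => l _; rewrite -big_split/= -sumrB !mulr_suml -sumrB.
  apply: eq_bigr => m _.
  have -> : (l + m - k)%:~R * x = l%:~R * x + m%:~R * x - k%:~R * x.
    by rewrite intrB intrD mulrBl mulrDl.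
  by rewrite cosB sinB cosD sinD; ring.
rewrite mean_sum2; last by move=> l m; exact: integrableI_trig.
by apply: eq_bigr => l _; apply: eq_bigr => m _; rewrite mean_delta subr_eq0.
Qed.

End Parity.
End TrigPolynomials.

(** * Fourier inversion under quadratic decay of the coefficients *)

Section FourierInversion.
Context {R : realType}.
Notation mu := (@lebesgue_measure R).
Implicit Types (f : R -> R) (a b : int -> R) (A x : R) (k : int).

Definition amp f k : R := Num.sqrt (fcoef_sq f k).

Lemma amp_ge0 f k : 0 <= amp f k.
Proof. exact: sqrtr_ge0. Qed.

Lemma sqr_amp f k : amp f k ^+ 2 = fcoef_sq f k.
Proof. by rewrite sqr_sqrtr// fcoef_sq_ge0. Qed.

Lemma norm_fcoef_re_amp f k : `|fcoef_re f k| <= amp f k.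
Proof. by rewrite -sqrtr_sqr ler_wsqrtr// lerDl sqr_ge0. Qed.

Lemma norm_fcoef_im_amp f k : `|fcoef_im f k| <= amp f k.
Proof. by rewrite -sqrtr_sqr ler_wsqrtr// lerDr sqr_ge0. Qed.

Section Tails.
Variables (a b : int -> R) (A : R).
Hypotheses (Ha : forall k, k%:~R ^+ 2 * `|a k| <= A) (Hb : forall k, k%:~R ^+ 2 * `|b k| <= A).

Lemma decay_ge0 : 0 <= A.
Proof. by apply: le_trans (Ha 0); rewrite mulr_ge0// sqr_ge0. Qed.

Lemma tpoly_incr n x :
  `|tpoly n.+1 a b x - tpoly n a b x| <= 4 * A / n.+1%:R ^+ 2.
Proof.
rewrite /tpoly sum_zrangeS addrAC subrr add0r.
have n0 : 0 < n.+1%:R ^+ 2 :> R by rewrite exprn_gt0.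
have term (k : int) : (k%:~R : R) ^+ 2 = n.+1%:R ^+ 2 ->
    `|a k * cos (k%:~R * x) - b k * sin (k%:~R * x)| <= 2 * A / n.+1%:R ^+ 2.
  move=> kn; have := Ha k; have := Hb k; rewrite kn => hb ha.
  have ca := cos_max (k%:~R * x); have sa := sin_max (k%:~R * x).
  apply: (le_trans (ler_normB _ _)); rewrite !normrM.
  apply: (@le_trans _ _ (`|a k| + `|b k|)).
    by apply: lerD; rewrite ler_piMr.
  rewrite ler_pdivlMr// mulrDl; move: ha hb.
  by rewrite ![n.+1%:R ^+ 2 * _]mulrC; lra.
apply: (le_trans (ler_normD _ _)).
have -> : 4 * A / n.+1%:R ^+ 2 = 2 * A / n.+1%:R ^+ 2 + 2 * A / n.+1%:R ^+ 2 :> R by ring.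
by apply: lerD; apply: term; rewrite ?intrN ?sqrrN.
Qed.

Lemma invr_sqr_telescope n : (0 < n)%N ->
  (n.+1%:R ^+ 2)^-1 <= n%:R^-1 - n.+1%:R^-1 :> R.
Proof.
move=> n0; have n0R : 0 < n%:R :> R by rewrite ltr0n.
have -> : n%:R^-1 - n.+1%:R^-1 = (n%:R * n.+1%:R)^-1 :> R.
  by rewrite -natr1; field; lra.
rewrite lef_pV2 ?posrE ?mulr_gt0 ?exprn_gt0 ?ltr0n//.
by rewrite expr2 ler_pM2r ?ltr0n// ler_nat.
Qed.

Lemma tpoly_dist n m x : (0 < n)%N ->
  `|tpoly (n + m) a b x - tpoly n a b x| <= 4 * A * (n%:R^-1 - (n + m)%:R^-1).
Proof.
move=> n0; elim: m => [|m ih]; first by rewrite addn0 !subrr normr0 mulr0.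
have -> : tpoly (n + m.+1) a b x - tpoly n a b x =
  (tpoly (n + m).+1 a b x - tpoly (n + m) a b x) + (tpoly (n + m) a b x - tpoly n a b x).
  by rewrite addnS; ring.
apply: (le_trans (ler_normD _ _)); apply: (le_trans (lerD (tpoly_incr _ _) ih)).
rewrite -mulrDr ler_wpM2l ?mulr_ge0 ?decay_ge0//.
have nm : (0 < n + m)%N by rewrite addn_gt0 n0.
rewrite addnS (_ : n%:R^-1 - (n + m).+1%:R^-1 =
  ((n + m)%:R^-1 - (n + m).+1%:R^-1) + (n%:R^-1 - (n + m)%:R^-1)); last by ring.
by rewrite lerD2r; exact: invr_sqr_telescope.
Qed.

Lemma tpoly_dist_le n m x : (0 < n)%N -> (n <= m)%N ->
  `|tpoly m a b x - tpoly n a b x| <= 4 * A / n%:R.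
Proof.
move=> n0 nm; rewrite -(subnKC nm); apply: (le_trans (tpoly_dist _ _ n0)).
rewrite ler_wpM2l ?mulr_ge0 ?decay_ge0// lerBlDr lerDl invr_ge0//.
Qed.

Lemma tpoly_bounded n x : `|tpoly n a b x| <= `|a 0| + 8 * A.
Proof.
have A0 := decay_ge0.
have t0 : tpoly 0 a b x = a 0.
  by rewrite /tpoly sum_zrange0 mul0r cos0 sin0 mulr1 mulr0 subr0.
case: n => [|n]; first by rewrite t0; lra.
have h1 := tpoly_incr 0 x; have h2 := tpoly_dist_le x (ltn0Sn 0) (ltn0Sn n).
rewrite t0 expr1n divr1 in h1; rewrite divr1 in h2.
have -> : tpoly n.+1 a b x = a 0 + (tpoly 1 a b x - a 0) + (tpoly n.+1 a b x - tpoly 1 a b x) by ring.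
apply: (le_trans (ler_normD _ _)); apply: (le_trans (lerD (ler_normD _ _) (lexx _))).
by move: h1 h2 A0; lra.
Qed.

Definition tsum x : R := lim (tpoly n a b x @[n --> \oo]).

Lemma tsum_cvg x : tpoly n a b x @[n --> \oo] --> tsum x.
Proof.
have A0 := decay_ge0.
suff : cvg (tpoly n a b x @[n --> \oo]) by [].
apply/cauchy_cvgP; apply: cauchy_exP => e e0.
pose N := (Num.truncn (4 * A / e)).+1.
exists (tpoly N a b x); exists N => //= m /= Nm.
rewrite /ball/= distrC; apply: (le_lt_trans (tpoly_dist_le x (ltn0Sn _) Nm)).
rewrite ltr_pdivrMr ?ltr0n// [e * _]mulrC -ltr_pdivrMr//.
exact: truncnS_gt.
Qed.

Lemma tsum_dist n x : (0 < n)%N -> `|tsum x - tpoly n a b x| <= 4 * A / n%:R.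
Proof.
move=> n0.
have h : `|tpoly m a b x - tpoly n a b x| @[m --> \oo] --> `|tsum x - tpoly n a b x|.
  by apply: cvg_norm; apply: cvgB; [exact: tsum_cvg|exact: cvg_cst].
rewrite -(cvg_lim _ h)//; apply: limr_le; first by apply/cvg_ex; eexists; exact: h.
by exists n => // m /= nm; exact: tpoly_dist_le.
Qed.

Lemma tsum_bounded x : `|tsum x| <= `|a 0| + 8 * A.
Proof.
have h : `|tpoly m a b x| @[m --> \oo] --> `|tsum x|.
  by apply: cvg_norm; exact: tsum_cvg.
rewrite -(cvg_lim _ h)//; apply: limr_le; first by apply/cvg_ex; eexists; exact: h.
by apply: nearW => m; exact: tpoly_bounded.
Qed.

Lemma measurable_tsum : measurable_fun (@Iper R) tsum.
Proof.
apply: (@measurable_fun_cvg _ _ _ _ (fun n => tpoly n a b)) => [n|x _].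
  by apply: measurable_funTS; apply: continuous_measurable_fun; exact: continuous_tpoly.
exact: tsum_cvg.
Qed.

Lemma integrableI_bounded f (C : R) : measurable_fun Iper f ->
  (forall x, Iper x -> `|f x| <= C) -> integrableI f.
Proof.
move=> mf fC; apply: (@le_integrableI _ _ (fun=> C)) => //.
  by apply: continuous_integrableI; exact: cst_continuous.
by move=> x Ix; rewrite (le_trans (fC _ Ix))// ler_norm.
Qed.

Lemma integrableI_tsum : integrableI tsum.
Proof.
by apply: integrableI_bounded measurable_tsum _ => x _; exact: tsum_bounded.
Qed.

(** Truncation errors below all have the form [C / n]; this discards them at once, with no limit of
    sequences in the estimates themselves. *)
Lemma le_archi (x y C : R) : (exists N, forall n : nat, (N <= n)%N -> (0 < n)%N -> x <= y + C / n%:R) -> x <= y.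
Proof.
move=> [N h]; rewrite leNgt; apply/negP => yx.
pose n := (maxn N (Num.truncn (C / (x - y))).+1).
have n0 : (0 < n)%N by rewrite /n; lia.
have := h n (leq_maxl _ _) n0; rewrite leNgt => /negP; apply.
rewrite -ltrBrDl ltr_pdivrMr ?ltr0n// mulrC -ltr_pdivrMr ?subr_gt0//.
apply: (lt_le_trans (truncnS_gt _)); rewrite ler_nat /n; exact: leq_maxr.
Qed.

Hypotheses (ea : forall k, a (- k) = a k) (ob : forall k, b (- k) = - b k).

Lemma fcoef_tsum k : fcoef_re tsum k = a k /\ fcoef_im tsum k = b k.
Proof.
have It n : integrableI (tpoly n a b).
  by apply: continuous_integrableI; exact: continuous_tpoly.
have mem n : (`|k| <= n)%N -> (k \in zrange n) by rewrite mem_zrange.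
split; apply/eqP; rewrite -subr_eq0 -normr_le0; apply: (@le_archi _ _ (4 * A)); exists `|k|%N => n kn n0.
- have -> : a k = fcoef_re (tpoly n a b) k by rewrite fcoef_re_tpoly// mem// mul1r.
  rewrite add0r -fcoef_reB//; last exact: integrableI_tsum.
  apply: norm_fcoef_re_le; first by apply: integrableIB => //; exact: integrableI_tsum.
  by move=> x _; exact: tsum_dist.
- have -> : b k = fcoef_im (tpoly n a b) k by rewrite fcoef_im_tpoly// mem// mul1r.
  rewrite add0r -fcoef_imB//; last exact: integrableI_tsum.
  apply: norm_fcoef_im_le; first by apply: integrableIB => //; exact: integrableI_tsum.
  by move=> x _; exact: tsum_dist.
Qed.

Lemma fcoef_tsum_sq k n : (0 < n)%N ->
  `|fcoef_re (fun x => tsum x ^+ 2) k - conv_re n a b k|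
    <= 8 * A * (`|a 0| + 8 * A) / n%:R /\
  `|fcoef_im (fun x => tsum x ^+ 2) k - conv_im n a b k|
    <= 8 * A * (`|a 0| + 8 * A) / n%:R.
Proof.
move=> n0.
have B0 : 0 <= `|a 0| + 8 * A by rewrite addr_ge0 ?mulr_ge0 ?decay_ge0.
have I1 : integrableI (fun x => tsum x ^+ 2).
  apply: (@integrableI_bounded _ ((`|a 0| + 8 * A) ^+ 2)).
    by apply: measurable_funX; exact: measurable_tsum.
  by move=> x _; rewrite normrX lerXn2r ?nnegrE ?tsum_bounded.
have I2 : integrableI (fun x => tpoly n a b x ^+ 2).
  apply: continuous_integrableI => x.
  by apply: (cvgM (f := tpoly n a b) (g := tpoly n a b)); exact: continuous_tpoly.
have bd x : `|tsum x ^+ 2 - tpoly n a b x ^+ 2| <= 8 * A * (`|a 0| + 8 * A) / n%:R.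
  rewrite subr_sqr normrM.
  (* Difference of squares: one factor is the truncation error [4 A / n], the other a sum of two
     functions bounded by [|a 0| + 8 A]. *)
  have -> : 8 * A * (`|a 0| + 8 * A) / n%:R = (4 * A / n%:R) * (2 * (`|a 0| + 8 * A)) by ring.
  apply: ler_pM => //; first exact: tsum_dist.
  apply: (le_trans (ler_normD _ _)).
  by have := tsum_bounded x; have := tpoly_bounded n x; lra.
split.
- rewrite -fcoef_re_tpoly_sq// -fcoef_reB//.
  by apply: norm_fcoef_re_le => //; exact: integrableIB.
- rewrite -fcoef_im_tpoly_sq// -fcoef_imB//.
  by apply: norm_fcoef_im_le => //; exact: integrableIB.
Qed.

End Tails.

Section SquareCoefficients.
Variables (f : R -> R) (A : R).
Hypotheses (If : integrableI f) (fA : forall k, k%:~R ^+ 2 * amp f k <= A).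

(** By completeness [f] agrees almost everywhere with the sum [tsum] of its Fourier series. The
    coefficients of [f^2] are therefore those of [tsum^2], and the latter is a uniform limit, at
    rate [1/n], of squares of trigonometric polynomials. *)
Lemma fcoef_sqr_conv k n : (0 < n)%N ->
  `|fcoef_re (fun x => f x ^+ 2) k - conv_re n (fcoef_re f) (fcoef_im f) k|
    <= 8 * A * (amp f 0 + 8 * A) / n%:R /\
  `|fcoef_im (fun x => f x ^+ 2) k - conv_im n (fcoef_re f) (fcoef_im f) k|
    <= 8 * A * (amp f 0 + 8 * A) / n%:R.
Proof.
move=> n0; set a := fcoef_re f; set b := fcoef_im f.
have Ha j : j%:~R ^+ 2 * `|a j| <= A.
  by apply: le_trans (fA j); rewrite ler_wpM2l ?sqr_ge0// norm_fcoef_re_amp.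
have Hb j : j%:~R ^+ 2 * `|b j| <= A.
  by apply: le_trans (fA j); rewrite ler_wpM2l ?sqr_ge0// norm_fcoef_im_amp.
have ea j : a (- j) = a j by exact: fcoef_reN.
have ob j : b (- j) = - b j by exact: fcoef_imN.
have A0 := decay_ge0 Ha.
have fg : {ae mu, forall x, Iper x -> f x = tsum a b x}.
  have : {ae mu, forall x, Iper x -> f x - tsum a b x = 0}.
    apply: fcoef_eq0_ae.
    - by apply: integrableIB => //; exact: integrableI_tsum.
    - move=> j; rewrite fcoef_reB//; last exact: integrableI_tsum.
      by have [-> _] := fcoef_tsum Ha Hb ea ob j; rewrite subrr.
    - move=> j; rewrite fcoef_imB//; last exact: integrableI_tsum.
      by have [_ ->] := fcoef_tsum Ha Hb ea ob j; rewrite subrr.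
  by apply: aeW => x h /h /eqP; rewrite subr_eq0 => /eqP.
have mt := measurable_tsum Ha Hb.
have mf := integrableI_measurable If.
have mc : measurable_fun (@Iper R) (fun x => cos (k%:~R * x)).
  by apply: measurable_funTS; apply: continuous_measurable_fun; exact: continuous_cosM.
have ms : measurable_fun (@Iper R) (fun x => sin (k%:~R * x)).
  by apply: measurable_funTS; apply: continuous_measurable_fun; exact: continuous_sinM.
have -> : fcoef_re (fun x => f x ^+ 2) k = fcoef_re (fun x => tsum a b x ^+ 2) k.
  rewrite !fcoef_reE; apply: ae_eq_mean.
  - by apply: measurable_funM => //; exact: measurable_funX.
  - by apply: measurable_funM => //; exact: measurable_funX.
  - by apply: aeW fg => x h /h ->.
have -> : fcoef_im (fun x => f x ^+ 2) k = fcoef_im (fun x => tsum a b x ^+ 2) k.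
  rewrite !fcoef_imE; congr (- _); apply: ae_eq_mean.
  - by apply: measurable_funM => //; exact: measurable_funX.
  - by apply: measurable_funM => //; exact: measurable_funX.
  - by apply: aeW fg => x h /h ->.
have a0 : 8 * A * (`|a 0| + 8 * A) / n%:R <= 8 * A * (amp f 0 + 8 * A) / n%:R.
  rewrite ler_wpM2r ?invr_ge0// ler_wpM2l ?mulr_ge0// lerD2r.
  exact: norm_fcoef_re_amp.
have [h1 h2] := fcoef_tsum_sq Ha Hb ea ob k n0.
by split; apply: le_trans a0.
Qed.

End SquareCoefficients.
End FourierInversion.

(** * Derivatives on a closed time interval and Gronwall's inequality *)

Section Dwithin.
Context {R : realType}.
Implicit Types (f g : R -> R) (T t l m : R).

(* One-sided at the end points of the time interval; [phi] is Caratheodory's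
   difference quotient. *)
Definition dwithin T f t l := exists2 phi : R -> R,
  (forall s, s \in `[0, T] -> f s - f t = phi s * (s - t)) &
  phi s @[s --> within `[0, T] (nbhs t)] --> l.

Lemma dwithin_eps T f t l :
  (forall e : R, 0 < e -> exists2 d : R, 0 < d & forall s, s \in `[0, T] ->
     0 < `|s - t| < d -> `|(f s - f t) / (s - t) - l| <= e) -> dwithin T f t l.
Proof.
move=> h; exists (fun s => if s == t then l else (f s - f t) / (s - t)).
  move=> s _; case: eqP => [->|/eqP st]; first by rewrite !subrr mulr0.
  by rewrite divfK// subr_eq0.
apply/cvgrPdist_le => e e0; have [d d0 hd] := h e e0.
rewrite near_withinE; exists d => //= s /= ts sT.
case: eqP => [_|/eqP st]; first by rewrite subrr normr0 ltW.
by rewrite distrC hd// normr_gt0 subr_eq0 st distrC.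
Qed.

Lemma is_derive_dwithin T f t l : is_derive t 1 f l -> dwithin T f t l.
Proof.
move=> /is_derive1_caratheodory[g [fg cg gl]]; exists g; first by move=> s _.
by apply: cvg_within_filter; rewrite -gl; exact: cg.
Qed.

Lemma dwithinD T f g t l m : dwithin T f t l -> dwithin T g t m ->
  dwithin T (fun s => f s + g s) t (l + m).
Proof.
move=> [p hp cp] [q hq cq]; exists (fun s => p s + q s); last exact: cvgD.
by move=> s sT; rewrite mulrDl -hp// -hq//; ring.
Qed.

Lemma dwithin_cst T t (c : R) : dwithin T (fun=> c) t 0.
Proof. by exists (fun=> 0); [move=> s _; rewrite subrr mul0r|exact: cvg_cst]. Qed.

Lemma dwithinM T f g t l m : dwithin T f t l -> dwithin T g t m ->
  dwithin T (fun s => f s * g s) t (l * g t + f t * m).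
Proof.
move=> [p hp cp] [q hq cq].
exists (fun s => p s * (g t + q s * (s - t)) + f t * q s).
  move=> s sT; have := hp s sT; have := hq s sT => hqs hps.
  by rewrite mulrDl -hqs mulrAC -hps -mulrA -hqs; ring.
apply: cvgD; last by apply: cvgM => //; exact: cvg_cst.
apply: cvgM => //; rewrite -[X in _ --> X]addr0; apply: cvgD; first exact: cvg_cst.
rewrite -[X in _ --> X](mulr0 m); apply: cvgM => //.
rewrite -[X in _ --> X](subrr t).
by apply: cvg_within_filter; apply: cvgB; [exact: cvg_id|exact: cvg_cst].
Qed.

Lemma dwithinZ T (c : R) f t l : dwithin T f t l ->
  dwithin T (fun s => c * f s) t (c * l).
Proof.
move=> h; have := dwithinM (dwithin_cst T t c) h.
by rewrite mul0r add0r.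
Qed.

Lemma dwithinB T f g t l m : dwithin T f t l -> dwithin T g t m ->
  dwithin T (fun s => f s - g s) t (l - m).
Proof.
move=> [p hp cp] [q hq cq]; exists (fun s => p s - q s); last exact: cvgB.
by move=> s sT; rewrite mulrBl -hp// -hq//; ring.
Qed.

Lemma dwithin_sqr T f t l : dwithin T f t l -> dwithin T (fun s => f s ^+ 2) t (2 * f t * l).
Proof. by move=> h; have := dwithinM h h; rewrite (_ : l * _ + _ = 2 * f t * l)//; ring. Qed.

Lemma dwithin_sum T (I : Type) (s : seq I) (F : I -> R -> R) (L : I -> R) t :
  (forall i, dwithin T (F i) t (L i)) ->
  dwithin T (fun x => \sum_(i <- s) F i x) t (\sum_(i <- s) L i).
Proof.
move=> h; elim: s => [|i s ih].
  by under eq_fun do rewrite big_nil; rewrite big_nil; exact: dwithin_cst.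
by under eq_fun do rewrite big_cons; rewrite big_cons; exact: dwithinD.
Qed.

Lemma dwithinW T S f t l : S <= T -> dwithin T f t l -> dwithin S f t l.
Proof.
move=> ST [p hp cp]; exists p.
  by move=> s; rewrite in_itv/= => /andP[s0 sS]; apply: hp; rewrite in_itv/= s0 (le_trans sS).
apply: cvg_trans cp; apply: cvg_app; move=> A [e /= e0 he]; exists e => //= s ts sS.
by apply: he => //; move: sS; rewrite /= !in_itv/= => /andP[-> sS]; rewrite (le_trans sS).
Qed.

Lemma dwithin_continuous T f : (forall t, t \in `[0, T] -> exists l, dwithin T f t l) ->
  {within `[0, T], continuous f}.
Proof.
move=> df; apply/subspace_continuousP => t tT.
have [l [p hp cp]] := df t tT.
have : (f t + p s * (s - t)) @[s --> within `[0, T] (nbhs t)] --> f t.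
  rewrite -[X in _ --> X]addr0; apply: cvgD; first exact: cvg_cst.
  rewrite -[X in _ --> X](mulr0 l); apply: cvgM => //.
  rewrite -[X in _ --> X](subrr t).
  by apply: cvg_within_filter; apply: cvgB; [exact: cvg_id|exact: cvg_cst].
apply: cvg_trans; apply: near_eq_cvg; rewrite near_withinE; apply: nearW => s sT.
by rewrite -hp// addrC subrK.
Qed.

Lemma dwithin_is_derive T f t l : t \in `]0, T[ -> dwithin T f t l -> is_derive t 1 f l.
Proof.
rewrite in_itv/= => /andP[t0 tT] [p hp cp].
apply/is_derive1_caratheodory.
exists (fun s => if s == t then l else (f s - f t) / (s - t)); split.
- move=> s; case: eqP => [->|/eqP st]; first by rewrite !subrr mulr0.
  by rewrite divfK// subr_eq0.
- rewrite /prop_for /continuous_at eqxx; apply/cvgrPdist_le => e e0.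
  move/cvgrPdist_le: cp => /(_ e e0); rewrite near_withinE => cp.
  have h : \forall s \near t, s \in `[0, T].
    near=> s; rewrite in_itv/=; apply/andP; split; apply: ltW; near: s.
      exact: lt_nbhsr.
    exact: lt_nbhsl.
  near=> s; case: eqP => [_|/eqP st]; first by rewrite subrr normr0 ltW.
  have sT : s \in `[0, T] by near: s.
  rewrite hp// mulfK ?subr_eq0//.
  by move: (sT); near: s.
- by rewrite eqxx.
Unshelve. all: by end_near. Qed.

Lemma dwithin_nonincreasing T f (f' : R -> R) : 0 <= T ->
  (forall t, t \in `[0, T] -> dwithin T f t (f' t)) ->
  (forall t, t \in `[0, T] -> f' t <= 0) -> f T <= f 0.
Proof.
move=> T0 df f'0.
have sub t : t \in `]0, T[ -> t \in `[0, T].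
  by rewrite !in_itv/= => /andP[h1 h2]; rewrite !ltW.
have dd t : t \in `]0, T[ -> is_derive t 1 f (f' t).
  by move=> tT; apply: (dwithin_is_derive tT); apply: df; exact: sub.
have cf : {within `[0, T], continuous f}.
  by apply: dwithin_continuous => t tT; exists (f' t); exact: df.
have [<-//|T1] := eqVneq 0 T; have {T1} T1 : 0 < T by rewrite lt_neqAle T1.
have [c cT fE] := MVT T1 dd cf.
rewrite -subr_le0 fE subr0 mulr_le0_ge0// f'0//; exact: sub.
Qed.

Lemma is_derive_expRM (c t : R) : is_derive t 1 (fun s : R => expR (c * s)) (c * expR (c * t)).
Proof.
have -> : (fun s : R => expR (c * s)) = expR \o (fun s => c * s) by [].
have h := is_derive_mull c t.
by rewrite mulrC; exact: is_derive1_comp.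
Qed.

(** The function [f t * expR (- A * t) - B * t] is nonincreasing. The bound is stated at the right
    end only: an earlier time is reached by shrinking the interval, which [dwithinW] allows. *)
Lemma gronwall T f (f' : R -> R) (A B : R) : 0 <= T -> 0 <= A -> 0 <= B ->
  (forall t, t \in `[0, T] -> dwithin T f t (f' t)) ->
  (forall t, t \in `[0, T] -> f' t <= A * f t + B) ->
  f T <= (f 0 + B * T) * expR (A * T).
Proof.
move=> T0 A0 B0 df f'A.
pose g t := f t * expR (- A * t) - B * t.
have dg t : t \in `[0, T] ->
    dwithin T g t ((f' t * expR (- A * t) + f t * (- A * expR (- A * t))) - B).
  move=> tT; apply: dwithinB.
    by apply: dwithinM; [exact: df|exact: is_derive_dwithin (is_derive_expRM _ _)].
  rewrite -[X in dwithin _ _ _ X]mulr1; apply: dwithinZ.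
  exact: (is_derive_dwithin _ (is_derive_id _ _)).
have : g T <= g 0.
  apply: (dwithin_nonincreasing T0 dg) => t tT.
  have e0 := expR_gt0 (- A * t).
  have e1 : expR (- A * t) <= 1.
    rewrite -expR0 ler_expR mulNr oppr_le0 mulr_ge0//.
    by move: tT; rewrite in_itv/= => /andP[].
  have : (f' t - A * f t) * expR (- A * t) <= B * 1.
    have [h|h] := leP 0 (f' t - A * f t).
      by apply: ler_pM; rewrite ?(ltW e0)//; have := f'A t tT; lra.
    by rewrite mulr1; apply: le_trans B0; rewrite nmulr_rle0// ltW.
  lra.
rewrite /g mulr0 expR0 mulr1 mulr0 subr0 => h.
have : f T * expR (- A * T) <= f 0 + B * T by lra.
by rewrite mulNr expRN ler_pdivrMr ?expR_gt0.
Qed.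

End Dwithin.

(** * The symbol of the weighted cubic form *)

Section Symbol.
Context {R : realType}.
Implicit Types (j l m : int) (B : nat).

(* Bounded in [k], so that energies weighted by it need no a priori regularity. *)
Definition wt B (k : int) : R := 1 + (minn `|k| B)%:R ^+ 8.

Lemma wt_ge1 B k : 1 <= wt B k.
Proof. by rewrite lerDl exprn_ge0. Qed.

Lemma wt_ge0 B k : 0 <= wt B k.
Proof. by rewrite (le_trans ler01)// wt_ge1. Qed.

Lemma wtN B k : wt B (- k) = wt B k.
Proof. by rewrite /wt abszN. Qed.

Lemma wt_le B k : wt B k <= 1 + B%:R ^+ 8.
Proof. by rewrite lerD2l lerXn2r ?nnegrE// ler_nat geq_minr. Qed.

Lemma wt_lt_id B k : (`|k| <= B)%N -> wt B k = 1 + k%:~R ^+ 8.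
Proof.
move=> kB; rewrite /wt (minn_idPl kB) natr_absz intr_norm -[8%N]/(2 * 4)%N !exprM.
by rewrite -normrX ger0_norm ?sqr_ge0.
Qed.

Lemma wt_le_mono B j l : (`|j| <= `|l|)%N -> wt B j <= wt B l.
Proof. by move=> jl; rewrite lerD2l lerXn2r ?nnegrE// ler_nat; lia. Qed.

Lemma expr8_sub_le (X Y : R) : 0 <= X <= Y -> Y ^+ 8 - X ^+ 8 <= 8 * (Y - X) * Y ^+ 7.
Proof.
move=> /andP[X0 XY]; have Y0 : 0 <= Y by lra.
have -> : Y ^+ 8 - X ^+ 8 = (Y - X) * ((Y + X) * ((Y ^+ 2 + X ^+ 2) * (Y ^+ 4 + X ^+ 4))) by ring.
have -> : 8 * (Y - X) * Y ^+ 7 = (Y - X) * ((2 * Y) * ((2 * Y ^+ 2) * (2 * Y ^+ 4))) by ring.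
rewrite ler_wpM2l ?subr_ge0//.
have h n : X ^+ n <= Y ^+ n by rewrite lerXn2r.
have X2 n : 0 <= X ^+ n by rewrite exprn_ge0.
have Y2 n : 0 <= Y ^+ n by rewrite exprn_ge0.
have := h 2; have := h 4; have := X2 2; have := X2 4; have := Y2 2; have := Y2 4.
move=> *; apply: ler_pM; [lra|by rewrite mulr_ge0//; lra|lra|].
by apply: ler_pM; lra.
Qed.

(** The relation [j + l + m = 0] rewrites the symbol as [- W_l m - (W_l - W_j) j + W_m m]. The outer
    terms carry the smallest frequency [m] already; in the middle one [(W_l - W_j) |j|] gains it
    from the difference of the weights. Since [|l| <= 2 |j|], [W_l <= 2^8 W_j], and 2305 is 256 + 8
    * 256 + 1. *)
Lemma symbol_bound_sorted B j l m : j + l + m = 0 ->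
  (`|m| <= `|j|)%N -> (`|j| <= `|l|)%N ->
  `|wt B j * j%:~R + wt B l * l%:~R + wt B m * m%:~R| <= 2305 * `|m%:~R| * wt B j.
Proof.
move=> s mj jl.
have mE : m = - j - l by lia.
set X : R := (minn `|j| B)%:R; set Y : R := (minn `|l| B)%:R; set Z : R := (minn `|m| B)%:R.
have absE (k : int) : `|k%:~R| = `|k|%N%:R :> R by rewrite natr_absz intr_norm.
have X0 : 0 <= X by []. have Z0 : 0 <= Z by [].
have XY : X <= Y by rewrite ler_nat; lia.
have ZX : Z <= X by rewrite ler_nat; lia.
have YX : Y <= 2 * X by rewrite /X /Y -natrM ler_nat; lia.
(* If [B <= |j|], both capped frequencies equal [B]. Otherwise [X] is [|j|] itself and
   [Y - X <= |l| - |j| <= |m|]. *)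
have YXj : (Y - X) * `|j%:~R| <= `|m%:~R| * Y.
  have [Bj|jB] := leqP B `|j|%N.
    have -> : Y = X by rewrite /X /Y; congr (_%:R); lia.
    by rewrite subrr mul0r mulr_ge0.
  rewrite !absE; have -> : (`|j|%N)%:R = X by rewrite /X; congr (_%:R); lia.
  apply: ler_pM; [by rewrite subr_ge0| by []| |by []].
  by rewrite lerBlDr /X /Y -natrD ler_nat; lia.
have sE : wt B j * j%:~R + wt B l * l%:~R + wt B m * m%:~R =
    - (wt B l * m%:~R) - (Y ^+ 8 - X ^+ 8) * j%:~R + wt B m * m%:~R.
  by rewrite /wt -/X -/Y -/Z mE intrB intrN; ring.
rewrite sE.
have wl : wt B l <= 256 * wt B j.
  rewrite /wt -/X -/Y.
  have : Y ^+ 8 <= (2 * X) ^+ 8 by rewrite lerXn2r ?nnegrE//; lra.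
  have : 0 <= X ^+ 8 by rewrite exprn_ge0.
  by rewrite exprMn (_ : 2 ^+ 8 = 256 :> R); [lra|ring].
have wm : wt B m <= wt B j by exact: wt_le_mono.
have yx8 : (Y ^+ 8 - X ^+ 8) * `|j%:~R| <= 8 * `|m%:~R| * (256 * wt B j).
  apply: (@le_trans _ _ (8 * `|m%:~R| * Y ^+ 8)); last first.
    by rewrite ler_wpM2l ?mulr_ge0//; apply: le_trans wl; rewrite /wt -/Y lerDr.
  apply: (@le_trans _ _ (8 * (Y - X) * Y ^+ 7 * `|j%:~R|)).
    by rewrite ler_wpM2r// expr8_sub_le// X0.
  rewrite (_ : 8 * (Y - X) * Y ^+ 7 * `|j%:~R| = 8 * Y ^+ 7 * ((Y - X) * `|j%:~R|)); last by ring.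
  rewrite (_ : 8 * `|m%:~R| * Y ^+ 8 = 8 * Y ^+ 7 * (`|m%:~R| * Y)); last by ring.
  by rewrite ler_wpM2l// mulr_ge0// exprn_ge0//; lra.
have Y8X8 : 0 <= Y ^+ 8 - X ^+ 8 by rewrite subr_ge0 lerXn2r ?nnegrE//; lra.
apply: (le_trans (ler_normD _ _)); apply: (le_trans (lerD (ler_normB _ _) (lexx _))).
rewrite normrN !normrM (ger0_norm Y8X8) !(ger0_norm (wt_ge0 _ _)).
have m0 : 0 <= `|m%:~R| :> R by [].
have := ler_wpM2r m0 wl; have := ler_wpM2r m0 wm.
move: yx8; lra.
Qed.

Lemma min_amgm (u v w x y : R) : 0 <= u -> u <= v -> u <= w -> 0 <= x -> 0 <= y ->
  u * (x * y) <= 2^-1 * (v * x ^+ 2 + w * y ^+ 2).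
Proof.
move=> u0 uv uw x0 y0.
have h1 : u * x ^+ 2 <= v * x ^+ 2 by rewrite ler_wpM2r ?sqr_ge0.
have h2 : u * y ^+ 2 <= w * y ^+ 2 by rewrite ler_wpM2r ?sqr_ge0.
have : 0 <= u * (x - y) ^+ 2 by rewrite mulr_ge0// sqr_ge0.
have -> : u * (x - y) ^+ 2 = u * x ^+ 2 + u * y ^+ 2 - 2 * (u * (x * y)) by ring.
lra.
Qed.

(** The right-hand side runs over all six pairs so that the statement is invariant under
    permutations and the frequencies may be sorted. In the sorted case its first two terms suffice,
    by the inequality of arithmetic and geometric means; the other four are nonnegative. *)
Lemma symbol_bound B j l m (x y z : R) : j + l + m = 0 ->
  0 <= x -> 0 <= y -> 0 <= z ->
  `|wt B j * j%:~R + wt B l * l%:~R + wt B m * m%:~R| * (x * y * z) <=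
  2305 / 2 * (`|m%:~R| * z * (wt B j * x ^+ 2) + `|m%:~R| * z * (wt B l * y ^+ 2)
    + (`|l%:~R| * y * (wt B j * x ^+ 2) + `|l%:~R| * y * (wt B m * z ^+ 2))
    + (`|j%:~R| * x * (wt B l * y ^+ 2) + `|j%:~R| * x * (wt B m * z ^+ 2))).
Proof.
wlog : j l m x y z / (`|m| <= `|j|)%N && (`|j| <= `|l|)%N.
  move=> H s x0 y0 z0.
  have [mj|jm] := leqP `|m|%N `|j|%N; have [jl|lj] := leqP `|j|%N `|l|%N;
  have [ml|lm] := leqP `|m|%N `|l|%N.
  - by apply: H => //; rewrite mj jl.
  - by exfalso; lia.
  - have := H l j m y x z; rewrite ml (ltnW lj) => /(_ isT).
    rewrite [l + j]addrC => /(_ s y0 x0 z0).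
    by rewrite [wt B l * _ + _]addrC [y * x]mulrC => /le_trans; apply; lra.
  - have := H m j l z x y; rewrite (ltnW lm) mj => /(_ isT).
    have -> : m + j + l = j + l + m by lia.
    move=> /(_ s z0 x0 y0).
    have -> : wt B m * m%:~R + wt B j * j%:~R + wt B l * l%:~R = wt B j * j%:~R + wt B l * l%:~R + wt B m * m%:~R by ring.
    have -> : z * x * y = x * y * z by ring.
    by move=> /le_trans; apply; lra.
  - have := H m l j z y x; rewrite (ltnW jm) ml => /(_ isT).
    have -> : m + l + j = j + l + m by lia.
    move=> /(_ s z0 y0 x0).
    have -> : wt B m * m%:~R + wt B l * l%:~R + wt B j * j%:~R = wt B j * j%:~R + wt B l * l%:~R + wt B m * m%:~R by ring.
    have -> : z * y * x = x * y * z by ring.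
    by move=> /le_trans; apply; lra.
  - have := H l m j y z x; rewrite (ltnW lm) jl => /(_ isT).
    have -> : l + m + j = j + l + m by lia.
    move=> /(_ s y0 z0 x0).
    have -> : wt B l * l%:~R + wt B m * m%:~R + wt B j * j%:~R = wt B j * j%:~R + wt B l * l%:~R + wt B m * m%:~R by ring.
    have -> : y * z * x = x * y * z by ring.
    by move=> /le_trans; apply; lra.
  - by exfalso; lia.
  - have := H j m l x z y; rewrite (ltnW lj) (ltnW jm) => /(_ isT).
    have -> : j + m + l = j + l + m by lia.
    move=> /(_ s x0 z0 y0).
    have -> : wt B j * j%:~R + wt B m * m%:~R + wt B l * l%:~R = wt B j * j%:~R + wt B l * l%:~R + wt B m * m%:~R by ring.
    have -> : x * z * y = x * y * z by ring.
    by move=> /le_trans; apply; lra.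
move=> /andP[mj jl] s x0 y0 z0.
have h := symbol_bound_sorted B s mj jl.
have g := @min_amgm _ _ (wt B l) x y (wt_ge0 B j) (lexx _) (wt_le_mono B jl) x0 y0.
have xyz0 : 0 <= x * y * z by rewrite !mulr_ge0.
apply: (le_trans (ler_wpM2r xyz0 h)).
have -> : 2305 * `|m%:~R| * wt B j * (x * y * z) = 2305 * (`|m%:~R| * z) * (wt B j * (x * y)) by ring.
have mz0 : 0 <= `|m%:~R| * z by rewrite mulr_ge0.
apply: (@le_trans _ _ (2305 * (`|m%:~R| * z) * (2^-1 * (wt B j * x ^+ 2 + wt B l * y ^+ 2)))).
  apply: ler_wpM2l; last exact: g.
  by apply: mulr_ge0; [exact: ler0n|exact: mz0].
have p1 : 0 <= `|l%:~R| * y * (wt B j * x ^+ 2) by rewrite !mulr_ge0 ?wt_ge0 ?sqr_ge0.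
have p2 : 0 <= `|l%:~R| * y * (wt B m * z ^+ 2) by rewrite !mulr_ge0 ?wt_ge0 ?sqr_ge0.
have p3 : 0 <= `|j%:~R| * x * (wt B l * y ^+ 2) by rewrite !mulr_ge0 ?wt_ge0 ?sqr_ge0.
have p4 : 0 <= `|j%:~R| * x * (wt B m * z ^+ 2) by rewrite !mulr_ge0 ?wt_ge0 ?sqr_ge0.
lra.
Qed.

End Symbol.

(** * Sums over triples of frequencies adding to zero *)

Section Trilinear.
Context {R : realType}.
Variable M : nat.
Implicit Types (G H : int -> int -> int -> R) (p e : int -> R).

Definition tri G : R := \sum_(j <- zrange M) \sum_(l <- zrange M) \sum_(m <- zrange M)
  (j + l + m == 0)%:R * G j l m.

Lemma eq_tri G H : (forall j l m, j + l + m = 0 -> G j l m = H j l m) -> tri G = tri H.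
Proof.
move=> GH; apply: eq_bigr => j _; apply: eq_bigr => l _; apply: eq_bigr => m _.
by case: eqP => [/GH ->|_]; rewrite ?mul0r.
Qed.

Lemma le_tri G H : (forall j l m, j + l + m = 0 -> G j l m <= H j l m) -> tri G <= tri H.
Proof.
move=> GH; apply: ler_sum => j _; apply: ler_sum => l _; apply: ler_sum => m _.
by case: eqP => [/GH h|_]; rewrite ?mul0r ?mul1r.
Qed.

Lemma tri_swap12 G : tri (fun j l m => G l j m) = tri G.
Proof.
rewrite /tri exchange_big/=; apply: eq_bigr => j _; apply: eq_bigr => l _.
by apply: eq_bigr => m _; rewrite [l + j]addrC.
Qed.

Lemma tri_swap23 G : tri (fun j l m => G j m l) = tri G.
Proof.
apply: eq_bigr => j _; rewrite exchange_big/=; apply: eq_bigr => l _.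
by apply: eq_bigr => m _; rewrite addrAC.
Qed.

Lemma triD G H : tri (fun j l m => G j l m + H j l m) = tri G + tri H.
Proof.
rewrite /tri -big_split/=; apply: eq_bigr => j _; rewrite -big_split/=.
apply: eq_bigr => l _; rewrite -big_split/=; apply: eq_bigr => m _.
by rewrite mulrDr.
Qed.

Lemma triZ (c : R) G : tri (fun j l m => c * G j l m) = c * tri G.
Proof.
rewrite /tri mulr_sumr; apply: eq_bigr => j _; rewrite mulr_sumr.
apply: eq_bigr => l _; rewrite mulr_sumr; apply: eq_bigr => m _.
by rewrite mulrCA.
Qed.

Lemma norm_tri G : `|tri G| <= tri (fun j l m => `|G j l m|).
Proof.
apply: (le_trans (ler_norm_sum _ _ _)); apply: ler_sum => j _.
apply: (le_trans (ler_norm_sum _ _ _)); apply: ler_sum => l _.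
apply: (le_trans (ler_norm_sum _ _ _)); apply: ler_sum => m _.
by rewrite normrM normr_nat.
Qed.

(** Once two frequencies are fixed the constraint leaves at most one value for the third, so the
    triple sum is no larger than the unconstrained double sum. *)
Lemma tri_bound p e : (forall k, 0 <= p k) -> (forall k, 0 <= e k) ->
  tri (fun j l m => p m * e j) <= (\sum_(m <- zrange M) p m) * (\sum_(j <- zrange M) e j).
Proof.
move=> p0 e0; rewrite -(tri_swap23 (fun j l m => p m * e j)) /tri mulrC big_distrlr/=.
apply: ler_sum => j _; apply: ler_sum => l _.
rewrite -mulr_suml mulrC [e j * _]mulrC ler_piMr ?mulr_ge0//.
under eq_bigr => m _.
  rewrite (_ : (j + l + m == 0) = (m == - j - l)); last by apply/eqP/eqP; lia.
  rewrite -[_%:R]mulr1.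
  over.
by rewrite sum_zrange_delta mulr1; case: (_ \in _).
Qed.

End Trilinear.

(** * Energy forms of the quadratic nonlinearity *)

Section EnergyForms.
Context {R : realType}.

(** The constant of [symbol_bound_sorted], unchanged: in [energy_form_weighted] the factors 1/3 of
    the symmetrisation and 1/2 of the mean inequality are offset by six equal sums. *)
Definition symc : R := 2305.

Lemma symc_ge0 : 0 <= symc. Proof. exact: ler0n. Qed.

Variable M : nat.
Implicit Types (a b c d : int -> R).

Definition conv2_re a b c d k : R :=
  \sum_(l <- zrange M) \sum_(m <- zrange M) (l + m == k)%:R * (a l * c m - b l * d m).
Definition conv2_im a b c d k : R :=
  \sum_(l <- zrange M) \sum_(m <- zrange M) (l + m == k)%:R * (a l * d m + b l * c m).

(** The imaginary part of a product of three complex numbers. The identity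
    [|z1 z2 z3|^2 = Re^2 + Im^2] then bounds it in [norm_im3]. *)
Definition im3 (x1 y1 x2 y2 x3 y3 : R) : R :=
  x1 * x2 * y3 + x1 * y2 * x3 + y1 * x2 * x3 - y1 * y2 * y3.

Lemma norm_im3 (x1 y1 x2 y2 x3 y3 n1 n2 n3 : R) : 0 <= n1 -> 0 <= n2 -> 0 <= n3 ->
  x1 ^+ 2 + y1 ^+ 2 = n1 ^+ 2 -> x2 ^+ 2 + y2 ^+ 2 = n2 ^+ 2 ->
  x3 ^+ 2 + y3 ^+ 2 = n3 ^+ 2 -> `|im3 x1 y1 x2 y2 x3 y3| <= n1 * n2 * n3.
Proof.
move=> n10 n20 n30 h1 h2 h3.
rewrite -ler_sqr ?nnegrE ?mulr_ge0// -normrX ger0_norm ?sqr_ge0//.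
rewrite !exprMn -h1 -h2 -h3.
have -> : (x1 ^+ 2 + y1 ^+ 2) * (x2 ^+ 2 + y2 ^+ 2) * (x3 ^+ 2 + y3 ^+ 2) =
  im3 x1 y1 x2 y2 x3 y3 ^+ 2 +
  (x1 * x2 * x3 - x1 * y2 * y3 - y1 * x2 * y3 - y1 * y2 * x3) ^+ 2.
  by rewrite /im3; ring.
by rewrite lerDl sqr_ge0.
Qed.

Lemma conv_sumC k (F : int -> int -> R) :
  \sum_(l <- zrange M) \sum_(m <- zrange M) (l + m == k)%:R * F l m =
  \sum_(l <- zrange M) \sum_(m <- zrange M) (l + m == k)%:R * F m l.
Proof.
rewrite exchange_big/=; apply: eq_bigr => l _; apply: eq_bigr => m _.
by rewrite [m + l]addrC.
Qed.

(** The factorisation [z^2 - z'^2 = (z - z') (z + z')] for convolutions; the mixed terms cancel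
    after exchanging the two summation indices. *)
Lemma conv_diff_re a b c d k :
  conv_re M a b k - conv_re M c d k =
  conv2_re (fun i => a i - c i) (fun i => b i - d i)
           (fun i => a i + c i) (fun i => b i + d i) k.
Proof.
have sym := conv_sumC k.
have [s1 s2] := (sym (fun l m => a l * c m), sym (fun l m => b l * d m)).
have -> : conv2_re (fun i => a i - c i) (fun i => b i - d i)
    (fun i => a i + c i) (fun i => b i + d i) k =
  conv_re M a b k - conv_re M c d k
   + (\sum_(l <- zrange M) \sum_(m <- zrange M) (l + m == k)%:R * (a l * c m)
      - \sum_(l <- zrange M) \sum_(m <- zrange M) (l + m == k)%:R * (a m * c l))
   - (\sum_(l <- zrange M) \sum_(m <- zrange M) (l + m == k)%:R * (b l * d m)
      - \sum_(l <- zrange M) \sum_(m <- zrange M) (l + m == k)%:R * (b m * d l)).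
  rewrite -!sumrB -big_split/= -sumrB; apply: eq_bigr => l _.
  rewrite -!sumrB -big_split/= -sumrB; apply: eq_bigr => m _; ring.
by rewrite s1 s2 !subrr addr0 subr0.
Qed.

Lemma conv_diff_im a b c d k :
  conv_im M a b k - conv_im M c d k =
  conv2_im (fun i => a i - c i) (fun i => b i - d i)
           (fun i => a i + c i) (fun i => b i + d i) k.
Proof.
have sym := conv_sumC k.
have [s1 s2] := (sym (fun l m => a l * d m), sym (fun l m => b l * c m)).
have -> : conv2_im (fun i => a i - c i) (fun i => b i - d i)
    (fun i => a i + c i) (fun i => b i + d i) k =
  conv_im M a b k - conv_im M c d k
   + (\sum_(l <- zrange M) \sum_(m <- zrange M) (l + m == k)%:R * (a l * d m)
      - \sum_(l <- zrange M) \sum_(m <- zrange M) (l + m == k)%:R * (a m * d l))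
   + (\sum_(l <- zrange M) \sum_(m <- zrange M) (l + m == k)%:R * (b l * c m)
      - \sum_(l <- zrange M) \sum_(m <- zrange M) (l + m == k)%:R * (b m * c l)).
  rewrite -!sumrB -!big_split/=; apply: eq_bigr => l _.
  rewrite -!sumrB -!big_split/=; apply: eq_bigr => m _; ring.
by rewrite s1 s2 !subrr !addr0.
Qed.

Section Forms.
Variables (W a b c d n q : int -> R).
Hypotheses (ea : forall k, a (- k) = a k) (ob : forall k, b (- k) = - b k)
  (eW : forall k, W (- k) = W k)
  (n0 : forall k, 0 <= n k) (nE : forall k, a k ^+ 2 + b k ^+ 2 = n k ^+ 2)
  (q0 : forall k, 0 <= q k) (qE : forall k, c k ^+ 2 + d k ^+ 2 = q k ^+ 2).

(** The left side sums the imaginary part of [conj z_k] times the convolution at [k]. For a real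
    function [conj z_k = z_(-k)], so substituting [k = - j] yields a trilinear form without
    conjugates, whose indices can be permuted. *)
Lemma energy_form_tri :
  \sum_(k <- zrange M) W k * k%:~R * (a k * conv2_im a b c d k - b k * conv2_re a b c d k) =
  - tri M (fun j l m => W j * j%:~R * im3 (a j) (b j) (a l) (b l) (c m) (d m)).
Proof.
rewrite -sum_zrangeN /tri -sumrN; apply: eq_bigr => j _.
rewrite eW ea ob intrN mulrN !mulNr opprK; congr (- _).
rewrite /conv2_im /conv2_re !mulr_sumr -big_split/= mulr_sumr.
apply: eq_bigr => l _; rewrite !mulr_sumr -big_split/= mulr_sumr.
apply: eq_bigr => m _.
have -> : (l + m == - j) = (j + l + m == 0) by apply/eqP/eqP; lia.
by rewrite /im3; ring.
Qed.

Lemma energy_form_sym :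
  \sum_(k <- zrange M) W k * k%:~R * (a k * conv2_im a b c d k - b k * conv2_re a b c d k) =
  - (2^-1 * tri M (fun j l m => (W j * j%:~R + W l * l%:~R) *
                         im3 (a j) (b j) (a l) (b l) (c m) (d m))).
Proof.
rewrite energy_form_tri; congr (- _).
set G := fun j l m => _.
have -> : tri M G = 2^-1 * (tri M G + tri M (fun j l m => G l j m)).
  by rewrite tri_swap12; field.
rewrite -triD; congr (_ * _); apply: eq_tri => j l m _.
by rewrite /G /im3; ring.
Qed.

End Forms.

(** Symmetrising the two equal factors turns the symbol into [j + l = - m]: the derivative moves
    onto the third factor, which is integration by parts on the Fourier side. *)
Lemma energy_form_L2 a b c d n q :
  (forall k, a (- k) = a k) -> (forall k, b (- k) = - b k) ->
  (forall k, 0 <= n k) -> (forall k, a k ^+ 2 + b k ^+ 2 = n k ^+ 2) ->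
  (forall k, 0 <= q k) -> (forall k, c k ^+ 2 + d k ^+ 2 = q k ^+ 2) ->
  `|\sum_(k <- zrange M) k%:~R * (a k * conv2_im a b c d k - b k * conv2_re a b c d k)| <=
  2^-1 * ((\sum_(m <- zrange M) `|m%:~R| * q m) * (\sum_(k <- zrange M) n k ^+ 2)).
Proof.
move=> ea ob n0 nE q0 qE.
under eq_bigr do rewrite -[_%:~R]mul1r.
rewrite (@energy_form_sym (fun=> 1))// normrN normrM ger0_norm ?invr_ge0// ler_wpM2l ?invr_ge0//.
apply: (le_trans (norm_tri _ _)).
apply: (@le_trans _ _ (tri M (fun j l m => 2^-1 * ((`|m%:~R| * q m) * n j ^+ 2 + (`|m%:~R| * q m) * n l ^+ 2)))).
  apply: le_tri => j l m s.
  rewrite normrM !mul1r -intrD (_ : j + l = - m); last by lia.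
  rewrite intrN normrN.
  have h := norm_im3 (n0 j) (n0 l) (q0 m) (nE j) (nE l) (qE m).
  apply: (le_trans (ler_wpM2l (normr_ge0 _) h)).
  have mq : 0 <= `|m%:~R| * q m by rewrite mulr_ge0.
  have := @min_amgm R _ _ _ _ _ mq (lexx _) (lexx _) (n0 j) (n0 l).
  by move=> /le_trans; rewrite (_ : _ * (n j * n l) = `|m%:~R| * (n j * n l * q m)); [apply|ring].
rewrite triZ triD.
have s1 := @tri_bound R M (fun m => `|m%:~R| * q m) (fun k => n k ^+ 2) (fun k => mulr_ge0 (normr_ge0 _) (q0 k)) (fun k => sqr_ge0 _).
have -> : tri M (fun j l m => `|m%:~R| * q m * n l ^+ 2) = tri M (fun j l m => `|m%:~R| * q m * n j ^+ 2).
  by rewrite -tri_swap12.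
by move: s1; set u := tri _ _; set v := (_ * _); lra.
Qed.

(** Here all three factors coincide, so the form may be averaged over the place that carries
    [W_j j]; the average has the symbol estimated in [symbol_bound]. *)
Lemma energy_form_weighted B a b n :
  (forall k, a (- k) = a k) -> (forall k, b (- k) = - b k) ->
  (forall k, 0 <= n k) -> (forall k, a k ^+ 2 + b k ^+ 2 = n k ^+ 2) ->
  `|\sum_(k <- zrange M) wt B k * k%:~R * (a k * conv_im M a b k - b k * conv_re M a b k)| <=
  symc * ((\sum_(m <- zrange M) `|m%:~R| * n m) * (\sum_(k <- zrange M) wt B k * n k ^+ 2)).
Proof.
move=> ea ob n0 nE.
rewrite (@energy_form_tri (wt B) a b a b)//; last by move=> k; exact: wtN.
rewrite normrN; set G := fun j l m => _.
have -> : tri M G = 3^-1 * (tri M (fun j l m => (wt B j * j%:~R + wt B l * l%:~R + wt B m * m%:~R) *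
    im3 (a j) (b j) (a l) (b l) (a m) (b m))).
  have -> : tri M G = 3^-1 * (tri M G + tri M (fun j l m => G l j m)
       + tri M (fun j l m => G m j l)).
    rewrite (tri_swap12 M G) -(tri_swap23 M (fun j l m => G m j l)).
    by rewrite (tri_swap12 M G); field.
  rewrite -!triD; congr (_ * _); apply: eq_tri => j l m _.
  by rewrite /G /im3; ring.
rewrite normrM ger0_norm ?invr_ge0//.
pose p m := `|m%:~R| * n m; pose e k := wt B k * n k ^+ 2.
have p0 k : 0 <= p k by rewrite mulr_ge0.
have e0 k : 0 <= e k by rewrite mulr_ge0 ?wt_ge0 ?sqr_ge0.
have key : tri M (fun j l m => `|(wt B j * j%:~R + wt B l * l%:~R + wt B m * m%:~R) *
    im3 (a j) (b j) (a l) (b l) (a m) (b m)|) <=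
  tri M (fun j l m => 2305 / 2 * (p m * e j + p m * e l + (p l * e j + p l * e m) + (p j * e l + p j * e m))).
  apply: le_tri => j l m s; rewrite normrM.
  have h := norm_im3 (n0 j) (n0 l) (n0 m) (nE j) (nE l) (nE m).
  apply: (le_trans (ler_wpM2l (normr_ge0 _) h)).
  exact: symbol_bound.
apply: (@le_trans _ _ (3^-1 * (2305 / 2 * (6 * ((\sum_(m <- zrange M) p m) * (\sum_(k <- zrange M) e k)))))); last first.
  by rewrite /p /e /symc; lra.
apply: ler_wpM2l; first by rewrite invr_ge0 ler0n.
apply: (le_trans (norm_tri _ _)); apply: (le_trans key).
rewrite triZ; apply: ler_wpM2l; first by lra.
rewrite !triD.
have s1 := tri_bound M p0 e0.
have s2 : tri M (fun j l m => p m * e l) = tri M (fun j l m => p m * e j) by rewrite -tri_swap12.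
have s3 : tri M (fun j l m => p l * e j) = tri M (fun j l m => p m * e j) by rewrite -tri_swap23.
have s4 : tri M (fun j l m => p l * e m) = tri M (fun j l m => p m * e j).
  by rewrite -tri_swap23 s2.
have s5 : tri M (fun j l m => p j * e l) = tri M (fun j l m => p m * e j).
  by rewrite -tri_swap12 s3.
have s6 : tri M (fun j l m => p j * e m) = tri M (fun j l m => p m * e j).
  by rewrite -tri_swap12 s4.
rewrite s2 s3 s4 s5 s6.
by move: s1; set u := tri _ _; set v := (_ * _); lra.
Qed.

End EnergyForms.

(** * Persistence of decay and comparison of two solutions *)

Section Modes.
Context {R : realType}.
Implicit Types (u v : R -> R -> R) (t T A : R) (k : int).

Definition dispersion (alpha eps : R) k : R :=
  eps ^+ 2 * (`|k|%:~R `^ alpha) * k%:~R.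

(** The equation as a system of ordinary differential equations for the modes. It is the common
    ground of fractional KdV and, with [eps = 0], of Burgers. *)
Definition modesol (alpha eps T : R) u :=
  (forall t, t \in `[0, T] -> integrableI (u t)) /\
  forall t, t \in `[0, T] -> forall k,
    dwithin T (fun s => fcoef_re (u s) k) t
      (3 * k%:~R * fcoef_im (fun x => u t x ^+ 2) k
       - dispersion alpha eps k * fcoef_im (u t) k) /\
    dwithin T (fun s => fcoef_im (u s) k) t
      (- (3 * k%:~R * fcoef_re (fun x => u t x ^+ 2) k)
       + dispersion alpha eps k * fcoef_re (u t) k).

(** The first two bounds control the error of replacing [u^2] by a finite convolution; the third is
    the Wiener norm that enters Gronwall's inequality. *)
Definition wiener_bound T u A := forall t, t \in `[0, T] ->
  [/\ amp (u t) 0 <= A, forall k, k%:~R ^+ 2 * amp (u t) k <= A &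
      forall M, \sum_(k <- zrange M) `|k%:~R| * amp (u t) k <= A].

Lemma sub_itv0 S T t : S <= T -> t \in `[0, S] -> t \in `[0, T].
Proof. by move=> ST; rewrite !in_itv/= => /andP[-> tS]; rewrite (le_trans tS). Qed.

Lemma modesolW alpha eps S T u : S <= T -> modesol alpha eps T u -> modesol alpha eps S u.
Proof.
move=> ST [Iu du]; split=> [t tS|t tS k]; first exact/Iu/(sub_itv0 ST).
by have [h1 h2] := du t (sub_itv0 ST tS) k; split; apply: dwithinW ST _.
Qed.

Lemma wiener_boundW S T u A : S <= T -> wiener_bound T u A -> wiener_bound S u A.
Proof. by move=> ST h t tS; apply: h; exact: sub_itv0 ST tS. Qed.

Lemma conv_error T u A t k M : (0 < M)%N -> wiener_bound T u A ->
  t \in `[0, T] -> integrableI (u t) ->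
  `|fcoef_re (fun x => u t x ^+ 2) k - conv_re M (fcoef_re (u t)) (fcoef_im (u t)) k| <= 72 * A ^+ 2 / M%:R /\
  `|fcoef_im (fun x => u t x ^+ 2) k - conv_im M (fcoef_re (u t)) (fcoef_im (u t)) k| <= 72 * A ^+ 2 / M%:R.
Proof.
move=> M0 wb tT Iu; have [a0 a2 _] := wb t tT.
have A0 : 0 <= A by apply: le_trans a0; exact: amp_ge0.
have [h1 h2] := fcoef_sqr_conv Iu a2 k M0.
have le : 8 * A * (amp (u t) 0 + 8 * A) / M%:R <= 72 * A ^+ 2 / M%:R.
  rewrite ler_wpM2r ?invr_ge0//.
  have -> : 72 * A ^+ 2 = 8 * A * (A + 8 * A) by ring.
  by rewrite ler_wpM2l ?mulr_ge0// lerD2r.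
by split; apply: le_trans le.
Qed.

Lemma ampE u t k : fcoef_re (u t) k ^+ 2 + fcoef_im (u t) k ^+ 2 = amp (u t) k ^+ 2.
Proof. by rewrite sqr_amp. Qed.

Theorem persistence alpha eps T u A E0 : 0 <= T -> modesol alpha eps T u ->
  wiener_bound T u A ->
  (forall M, \sum_(k <- zrange M) (1 + k%:~R ^+ 8) * fcoef_sq (u 0) k <= E0) ->
  forall k, (1 + k%:~R ^+ 8) * fcoef_sq (u T) k <= E0 * expR (6 * symc * A * T).
Proof.
move=> T0 [Iu du] wb hE0 k.
have t0T : 0 \in `[0, T] by rewrite in_itv/= lexx.
have A0 : 0 <= A by have [a0 _ _] := wb 0 t0T; apply: le_trans a0; exact: amp_ge0.
(* At this cap the weight of mode [k] is already the full [1 + k^8], so a separate choice of [B] for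
   each mode replaces the limit in [B]. The constant [C] depends on [B], but it only multiplies
   [1/M]. *)
pose B := `|k|%N.
pose C := 12 * (1 + B%:R ^+ 8) * A * (72 * A ^+ 2).
apply: (@le_archi _ _ _ (C * T * expR (6 * symc * A * T))); exists B => M BM M0.
pose E t := \sum_(j <- zrange M) wt B j * (fcoef_re (u t) j ^+ 2 + fcoef_im (u t) j ^+ 2).
pose F t j := fcoef_re (fun x => u t x ^+ 2) j.
pose G t j := fcoef_im (fun x => u t x ^+ 2) j.
pose E' t := 6 * \sum_(j <- zrange M) wt B j * j%:~R * (fcoef_re (u t) j * G t j - fcoef_im (u t) j * F t j).
have dE t : t \in `[0, T] -> dwithin T E t (E' t).
  move=> tT; rewrite (_ : E' t = \sum_(j <- zrange M) wt B j *
      (2 * fcoef_re (u t) j * (3 * j%:~R * G t j - dispersion alpha eps j * fcoef_im (u t) j)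
     + 2 * fcoef_im (u t) j * (- (3 * j%:~R * F t j) + dispersion alpha eps j * fcoef_re (u t) j))).
    apply: dwithin_sum => j; apply: dwithinZ; have [h1 h2] := du t tT j.
    by apply: dwithinD; exact: dwithin_sqr.
  by rewrite /E' mulr_sumr; apply: eq_bigr => j _; ring.
have EE t : E t = \sum_(j <- zrange M) wt B j * amp (u t) j ^+ 2.
  by apply: eq_bigr => j _; rewrite ampE.
have bE t : t \in `[0, T] -> E' t <= (6 * symc * A) * E t + C / M%:R.
  move=> tT; have It := Iu t tT; have [_ _ a1] := wb t tT.
  set a := fcoef_re (u t); set b := fcoef_im (u t).
  have main := @energy_form_weighted R M B a b (amp (u t)) (fun k => fcoef_reN _ _)
    (fun k => fcoef_imN k It) (fun k => amp_ge0 _ _) (fun k => ampE _ _ _).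
  have split_E' : E' t = 6 * (\sum_(j <- zrange M) wt B j * j%:~R * (a j * conv_im M a b j - b j * conv_re M a b j)
     + \sum_(j <- zrange M) wt B j * j%:~R * (a j * (G t j - conv_im M a b j) - b j * (F t j - conv_re M a b j))).
    by rewrite /E' -big_split/=; congr (_ * _); apply: eq_bigr => j _; rewrite /a /b; ring.
  have rho0 : 0 <= 72 * A ^+ 2 / M%:R by rewrite divr_ge0 ?mulr_ge0 ?sqr_ge0.
  have err : \sum_(j <- zrange M) wt B j * j%:~R * (a j * (G t j - conv_im M a b j) - b j * (F t j - conv_re M a b j))
      <= (1 + B%:R ^+ 8) * (2 * A) * (72 * A ^+ 2 / M%:R).
    apply: (@le_trans _ _ (\sum_(j <- zrange M) (1 + B%:R ^+ 8) * 2 * (72 * A ^+ 2 / M%:R) * (`|j%:~R| * amp (u t) j))).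
      apply: ler_sum => j _; have [e1 e2] := conv_error j M0 wb tT It.
      apply: (le_trans (ler_norm _)); rewrite !normrM (ger0_norm (wt_ge0 _ _)).
      have r1 : `|a j * (G t j - conv_im M a b j) - b j * (F t j - conv_re M a b j)| <=
          2 * (amp (u t) j * (72 * A ^+ 2 / M%:R)).
        apply: (le_trans (ler_normB _ _)); rewrite (normrM (a j)) (normrM (b j)).
        have -> : 2 * (amp (u t) j * (72 * A ^+ 2 / M%:R)) =
          amp (u t) j * (72 * A ^+ 2 / M%:R) + amp (u t) j * (72 * A ^+ 2 / M%:R) by ring.
        by apply: lerD; apply: ler_pM => //; [exact: norm_fcoef_re_amp|exact: norm_fcoef_im_amp].
      have -> : (1 + B%:R ^+ 8) * 2 * (72 * A ^+ 2 / M%:R) * (`|j%:~R| * amp (u t) j) =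
        (1 + B%:R ^+ 8) * `|j%:~R| * (2 * (amp (u t) j * (72 * A ^+ 2 / M%:R))) by ring.
      apply: ler_pM => //; first by rewrite mulr_ge0 ?wt_ge0.
      by rewrite ler_wpM2r// wt_le.
    rewrite -mulr_sumr.
    have -> : (1 + B%:R ^+ 8) * (2 * A) * (72 * A ^+ 2 / M%:R) = (1 + B%:R ^+ 8) * 2 * (72 * A ^+ 2 / M%:R) * A by ring.
    by rewrite ler_wpM2l ?a1// !mulr_ge0 ?addr_ge0 ?exprn_ge0 ?invr_ge0.
  have Et0 : 0 <= E t by rewrite EE; apply: sumr_ge0 => j _; rewrite mulr_ge0 ?wt_ge0 ?sqr_ge0.
  have m2 : \sum_(j <- zrange M) wt B j * j%:~R * (a j * conv_im M a b j - b j * conv_re M a b j) <= symc * (A * E t).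
    apply: (le_trans (ler_norm _)); apply: (le_trans main).
    by rewrite (ler_wpM2l symc_ge0)// -EE ler_wpM2r.
  rewrite split_E' /C; move: m2 err; rewrite -/(E t).
  set x := \sum_(_ <- _) _; set y := \sum_(_ <- _) _ => m2 err.
  have -> : 12 * (1 + B%:R ^+ 8) * A * (72 * A ^+ 2) / M%:R = 6 * ((1 + B%:R ^+ 8) * (2 * A) * (72 * A ^+ 2 / M%:R)) by ring.
  lra.
have C0 : 0 <= C / M%:R.
  by rewrite divr_ge0// /C !mulr_ge0 ?sqr_ge0// addr_ge0// exprn_ge0.
have gr := gronwall T0 (mulr_ge0 (mulr_ge0 (ler0n _ 6) symc_ge0) A0) C0 dE bE.
have kE : (1 + k%:~R ^+ 8) * fcoef_sq (u T) k <= E T.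
  rewrite -(@wt_lt_id R B k)// EE /E (bigD1_seq k) ?uniq_zrange ?mem_zrange//= -sqr_amp.
  by rewrite lerDl; apply: sumr_ge0 => j _; rewrite mulr_ge0 ?wt_ge0 ?sqr_ge0.
have E00 : E 0 <= E0.
  apply: le_trans (hE0 M); apply: ler_sum => j _; rewrite ler_wpM2r ?fcoef_sq_ge0//.
  rewrite -(@wt_lt_id R `|j| j)// lerD2l lerXn2r ?nnegrE// ler_nat; lia.
apply: (le_trans kE); apply: (le_trans gr).
have -> : E0 * expR (6 * symc * A * T) + C * T * expR (6 * symc * A * T) / M%:R =
  (E0 + C / M%:R * T) * expR (6 * symc * A * T) by ring.
by rewrite ler_wpM2r ?expR_ge0// lerD2r.
Qed.

Lemma norm_dispersion_le alpha eps k : 1 <= alpha <= 2 ->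
  `|dispersion alpha eps k| <= eps ^+ 2 * `|k%:~R| ^+ 3.
Proof.
move=> /andP[a1 a2]; rewrite /dispersion -mulrA normrM (ger0_norm (sqr_ge0 eps)) ler_wpM2l ?sqr_ge0// normrM.
have [->|k0] := eqVneq k 0; first by rewrite !mulr0z !normr0 mulr0 expr0n.
rewrite exprSr ler_wpM2r// ger0_norm ?powR_ge0// -powR_mulrn//.
rewrite intr_norm; apply: ler_powR => //.
by rewrite -intr_norm -[1]/(1%:~R) ler_int; lia.
Qed.

Lemma dispersionB alpha eps eps0 k : dispersion alpha eps k =
  dispersion alpha eps0 k + (eps ^+ 2 - eps0 ^+ 2) * dispersion alpha 1 k.
Proof. by rewrite /dispersion expr1n; ring. Qed.

(** On the difference of the modes the dispersion at [eps] is skew, so what remains is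
    [(eps^2 - eps0^2)] times the dispersion with coefficient 1 applied to [v]. The loss of
    derivatives thus falls on [v]; since [alpha <= 2] the squared symbol is at most [k^6], whence
    the hypothesis on [V]. In the rate, 12 is 6 * 1/2 * 4, the 4 coming from the Wiener norm of
    [u + v]. *)
Theorem mode_difference alpha eps eps0 T u v A V : 1 <= alpha <= 2 -> 0 <= T ->
  modesol alpha eps T u -> modesol alpha eps0 T v ->
  wiener_bound T u A -> wiener_bound T v A ->
  (forall t, t \in `[0, T] -> forall M, \sum_(k <- zrange M) k%:~R ^+ 6 * fcoef_sq (v t) k <= V) ->
  (forall k, fcoef_re (u 0) k = fcoef_re (v 0) k /\ fcoef_im (u 0) k = fcoef_im (v 0) k) ->
  forall k, (fcoef_re (u T) k - fcoef_re (v T) k) ^+ 2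
     + (fcoef_im (u T) k - fcoef_im (v T) k) ^+ 2 <=
    `|eps ^+ 2 - eps0 ^+ 2| * V * T * expR ((12 * A + `|eps ^+ 2 - eps0 ^+ 2|) * T).
Proof.
move=> ha T0 [Iu du] [Iv dv] wu wv hV init k.
have t0T : 0 \in `[0, T] by rewrite in_itv/= lexx.
have A0 : 0 <= A by have [a0 _ _] := wu 0 t0T; apply: le_trans a0; exact: amp_ge0.
have V0 : 0 <= V.
  apply: le_trans (hV 0 t0T 0%N); rewrite sum_zrange0.
  by apply: mulr_ge0; [rewrite exprn_ge0|exact: fcoef_sq_ge0].
set dl := `|eps ^+ 2 - eps0 ^+ 2|.
have dl0 : 0 <= dl by exact: normr_ge0.
pose C := 48 * A * (72 * A ^+ 2).
apply: (@le_archi _ _ _ (C * T * expR ((12 * A + dl) * T))); exists `|k|%N => M BM M0.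
pose x t j := fcoef_re (u t) j - fcoef_re (v t) j.
pose y t j := fcoef_im (u t) j - fcoef_im (v t) j.
pose F t j := fcoef_re (fun x => u t x ^+ 2) j - fcoef_re (fun x => v t x ^+ 2) j.
pose G t j := fcoef_im (fun x => u t x ^+ 2) j - fcoef_im (fun x => v t x ^+ 2) j.
pose E t := \sum_(j <- zrange M) (x t j ^+ 2 + y t j ^+ 2).
pose ff t := \sum_(j <- zrange M) (2 * (eps ^+ 2 - eps0 ^+ 2) * dispersion alpha 1 j * (y t j * fcoef_re (v t) j - x t j * fcoef_im (v t) j)).
pose E' t := 6 * \sum_(j <- zrange M) j%:~R * (x t j * G t j - y t j * F t j) + ff t.
have dE t : t \in `[0, T] -> dwithin T E t (E' t).
  move=> tT; rewrite (_ : E' t = \sum_(j <- zrange M)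
      (2 * x t j * ((3 * j%:~R * fcoef_im (fun x => u t x ^+ 2) j - dispersion alpha eps j * fcoef_im (u t) j)
         - (3 * j%:~R * fcoef_im (fun x => v t x ^+ 2) j - dispersion alpha eps0 j * fcoef_im (v t) j))
     + 2 * y t j * ((- (3 * j%:~R * fcoef_re (fun x => u t x ^+ 2) j) + dispersion alpha eps j * fcoef_re (u t) j)
         - (- (3 * j%:~R * fcoef_re (fun x => v t x ^+ 2) j) + dispersion alpha eps0 j * fcoef_re (v t) j)))).
    apply: dwithin_sum => j; have [h1 h2] := du t tT j; have [g1 g2] := dv t tT j.
    by apply: dwithinD; apply: dwithin_sqr; exact: dwithinB.
  rewrite /E' /ff mulr_sumr -big_split/=; apply: eq_bigr => j _.
  by rewrite (dispersionB alpha eps eps0) /F /G /x /y; ring.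
have bE t : t \in `[0, T] -> E' t <= (12 * A + dl) * E t + (dl * V + C / M%:R).
  move=> tT; have Iut := Iu t tT; have Ivt := Iv t tT.
  have [_ _ au] := wu t tT; have [_ _ av] := wv t tT.
  pose n j := Num.sqrt (x t j ^+ 2 + y t j ^+ 2).
  pose c j := fcoef_re (u t) j + fcoef_re (v t) j.
  pose d j := fcoef_im (u t) j + fcoef_im (v t) j.
  pose q j := Num.sqrt (c j ^+ 2 + d j ^+ 2).
  have nE j : x t j ^+ 2 + y t j ^+ 2 = n j ^+ 2 by rewrite sqr_sqrtr// addr_ge0 ?sqr_ge0.
  have qE j : c j ^+ 2 + d j ^+ 2 = q j ^+ 2 by rewrite sqr_sqrtr// addr_ge0 ?sqr_ge0.
  have main := @energy_form_L2 R M (x t) (y t) c d n q.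
  have {}main := main (fun k => f_equal2 (fun p q => p - q) (fcoef_reN (u t) k) (fcoef_reN (v t) k)).
  have oy j : y t (- j) = - y t j by rewrite /y !fcoef_imN//; ring.
  have {}main := main oy (fun j => sqrtr_ge0 _) nE (fun j => sqrtr_ge0 _) qE.
  have cxe j : conv2_im M (x t) (y t) c d j = conv_im M (fcoef_re (u t)) (fcoef_im (u t)) j - conv_im M (fcoef_re (v t)) (fcoef_im (v t)) j.
    by rewrite conv_diff_im.
  have cxr j : conv2_re M (x t) (y t) c d j = conv_re M (fcoef_re (u t)) (fcoef_im (u t)) j - conv_re M (fcoef_re (v t)) (fcoef_im (v t)) j.
    by rewrite conv_diff_re.
  have split_E' : \sum_(j <- zrange M) j%:~R * (x t j * G t j - y t j * F t j) =
     \sum_(j <- zrange M) j%:~R * (x t j * conv2_im M (x t) (y t) c d j - y t j * conv2_re M (x t) (y t) c d j)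
     + \sum_(j <- zrange M) j%:~R * (x t j * (G t j - conv2_im M (x t) (y t) c d j) - y t j * (F t j - conv2_re M (x t) (y t) c d j)).
    by rewrite -big_split/=; apply: eq_bigr => j _; ring.
  have xle j : `|x t j| <= amp (u t) j + amp (v t) j.
    by apply: (le_trans (ler_normB _ _)); apply: lerD; exact: norm_fcoef_re_amp.
  have yle j : `|y t j| <= amp (u t) j + amp (v t) j.
    by apply: (le_trans (ler_normB _ _)); apply: lerD; exact: norm_fcoef_im_amp.
  have suv : \sum_(j <- zrange M) `|j%:~R| * (amp (u t) j + amp (v t) j) <= 2 * A.
    under eq_bigr do rewrite mulrDr.
    by rewrite big_split/=; have := au M; have := av M; lra.
  have rho0 : 0 <= 72 * A ^+ 2 / M%:R by rewrite divr_ge0 ?mulr_ge0 ?sqr_ge0.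
  have err : \sum_(j <- zrange M) j%:~R * (x t j * (G t j - conv2_im M (x t) (y t) c d j) - y t j * (F t j - conv2_re M (x t) (y t) c d j))
      <= 4 * (72 * A ^+ 2 / M%:R) * (2 * A).
    apply: (@le_trans _ _ (\sum_(j <- zrange M) 4 * (72 * A ^+ 2 / M%:R) * (`|j%:~R| * (amp (u t) j + amp (v t) j)))).
      apply: ler_sum => j _.
      have [e1 e2] := conv_error j M0 wu tT Iut; have [e3 e4] := conv_error j M0 wv tT Ivt.
      have rG : `|G t j - conv2_im M (x t) (y t) c d j| <= 2 * (72 * A ^+ 2 / M%:R).
        rewrite cxe /G.
        set p1 := fcoef_im _ _ in e2 *; set p2 := conv_im _ _ _ _ in e2 *.
        set p3 := fcoef_im _ _ in e4 *; set p4 := conv_im _ _ _ _ in e4 *.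
        have -> : p1 - p3 - (p2 - p4) = (p1 - p2) - (p3 - p4) by ring.
        by apply: (le_trans (ler_normB _ _)); lra.
      have rF : `|F t j - conv2_re M (x t) (y t) c d j| <= 2 * (72 * A ^+ 2 / M%:R).
        rewrite cxr /F.
        set p1 := fcoef_re _ _ in e1 *; set p2 := conv_re _ _ _ _ in e1 *.
        set p3 := fcoef_re _ _ in e3 *; set p4 := conv_re _ _ _ _ in e3 *.
        have -> : p1 - p3 - (p2 - p4) = (p1 - p2) - (p3 - p4) by ring.
        by apply: (le_trans (ler_normB _ _)); lra.
      apply: (le_trans (ler_norm _)); rewrite normrM.
      have -> : 4 * (72 * A ^+ 2 / M%:R) * (`|j%:~R| * (amp (u t) j + amp (v t) j)) =
         `|j%:~R| * ((amp (u t) j + amp (v t) j) * (2 * (72 * A ^+ 2 / M%:R))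
             + (amp (u t) j + amp (v t) j) * (2 * (72 * A ^+ 2 / M%:R))) by ring.
      rewrite ler_wpM2l//; apply: (le_trans (ler_normB _ _)); rewrite !normrM.
      by apply: lerD; apply: ler_pM.
    by rewrite -mulr_sumr ler_wpM2l ?mulr_ge0 ?suv// invr_ge0.
  have EE : E t = \sum_(j <- zrange M) n j ^+ 2 by apply: eq_bigr => j _; rewrite nE.
  have Et0 : 0 <= E t by rewrite EE; apply: sumr_ge0 => j _; rewrite sqr_ge0.
  have qs : \sum_(m <- zrange M) `|m%:~R| * q m <= 4 * A.
    apply: (@le_trans _ _ (2 * \sum_(j <- zrange M) `|j%:~R| * (amp (u t) j + amp (v t) j))); last by lra.
    rewrite mulr_sumr; apply: ler_sum => j _; rewrite mulrCA ler_wpM2l//.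
    have cj : `|c j| <= amp (u t) j + amp (v t) j.
      by apply: (le_trans (ler_normD _ _)); apply: lerD; exact: norm_fcoef_re_amp.
    have dj : `|d j| <= amp (u t) j + amp (v t) j.
      by apply: (le_trans (ler_normD _ _)); apply: lerD; exact: norm_fcoef_im_amp.
    have q0 : 0 <= q j by exact: sqrtr_ge0.
    apply: (@le_trans _ _ (`|c j| + `|d j|)); last by lra.
    rewrite -ler_sqr ?nnegrE ?addr_ge0// -qE (sqrrD `|c j| `|d j|) !real_normK ?num_real//.
    have : 0 <= `|c j| * `|d j| by rewrite mulr_ge0.
    by rewrite -mulr_natl; lra.
  have m2 : \sum_(j <- zrange M) j%:~R * (x t j * conv2_im M (x t) (y t) c d j - y t j * conv2_re M (x t) (y t) c d j) <= 2 * A * E t.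
    apply: (le_trans (ler_norm _)); apply: (le_trans main); rewrite -EE.
    have -> : 2 * A * E t = 2^-1 * ((4 * A) * E t) by field.
    by rewrite ler_wpM2l ?invr_ge0// ler_wpM2r.
  have ffb : ff t <= dl * (E t + V).
    have -> : dl * (E t + V) = dl * E t + dl * V by ring.
    apply: (@le_trans _ _ (\sum_(j <- zrange M) (dl * (x t j ^+ 2 + y t j ^+ 2) + dl * (j%:~R ^+ 6 * fcoef_sq (v t) j)))); last first.
      rewrite big_split/= -!mulr_sumr lerD2l ler_wpM2l//; exact: hV.
    apply: ler_sum => j _; rewrite -mulrDr.
    set X := x t j; set Y := y t j; set h := dispersion alpha 1 j; rewrite /fcoef_sq.
    set a := fcoef_re _ _; set b := fcoef_im _ _.
    have hh : h ^+ 2 <= j%:~R ^+ 6.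
      have := norm_dispersion_le 1 j ha; rewrite expr1n mul1r => hj.
      rewrite -[6%N]/(3 * 2)%N exprM -[h ^+ 2]real_normK ?num_real//.
      rewrite -[X in _ <= X]real_normK ?num_real// lerXn2r ?nnegrE// normrX.
      by [].
    apply: (le_trans (ler_norm _)); rewrite (_ : 2 * _ * h * _ = (eps ^+ 2 - eps0 ^+ 2) * (2 * h * (Y * a - X * b))); last by ring.
    rewrite normrM ler_wpM2l//.
    (* These two sums of squares give [2 |h (Y a - X b)| <= X^2 + Y^2 + h^2 (a^2 + b^2)]: the
       forcing is absorbed in the energy and in [V]. *)
    have q1 : 0 <= (X + h * b) ^+ 2 + (Y - h * a) ^+ 2 by rewrite addr_ge0 ?sqr_ge0.
    have q2 : 0 <= (X - h * b) ^+ 2 + (Y + h * a) ^+ 2 by rewrite addr_ge0 ?sqr_ge0.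
    have q3 : h ^+ 2 * (a ^+ 2 + b ^+ 2) <= j%:~R ^+ 6 * (a ^+ 2 + b ^+ 2).
      by rewrite ler_wpM2r// addr_ge0 ?sqr_ge0.
    have q1' : (X + h * b) ^+ 2 + (Y - h * a) ^+ 2 = X ^+ 2 + Y ^+ 2 + h ^+ 2 * (a ^+ 2 + b ^+ 2) - 2 * h * (Y * a - X * b) by ring.
    have q2' : (X - h * b) ^+ 2 + (Y + h * a) ^+ 2 = X ^+ 2 + Y ^+ 2 + h ^+ 2 * (a ^+ 2 + b ^+ 2) + 2 * h * (Y * a - X * b) by ring.
    rewrite q1' in q1; rewrite q2' in q2; rewrite ler_norml.
    by apply/andP; split; lra.
  rewrite /E' split_E' /C; move: m2 err ffb.
  set s1 := \sum_(_ <- _) _; set s2 := \sum_(_ <- _) _ => m2 err ffb.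
  have -> : 48 * A * (72 * A ^+ 2) / M%:R = 6 * (4 * (72 * A ^+ 2 / M%:R) * (2 * A)) by ring.
  lra.
have C0 : 0 <= dl * V + C / M%:R.
  by rewrite addr_ge0 ?mulr_ge0 ?divr_ge0// /C !mulr_ge0 ?sqr_ge0.
have gr := gronwall T0 (addr_ge0 (mulr_ge0 (ler0n _ 12) A0) dl0) C0 dE bE.
have kE : x T k ^+ 2 + y T k ^+ 2 <= E T.
  rewrite /E (bigD1_seq k) ?uniq_zrange ?mem_zrange//=.
  by rewrite lerDl; apply: sumr_ge0 => j _; rewrite addr_ge0 ?sqr_ge0.
have E00 : E 0 = 0.
  by apply: big1 => j _; rewrite /x /y; have [-> ->] := init j; rewrite !subrr expr0n addr0.
apply: (le_trans kE); apply: (le_trans gr); rewrite E00 le_eqVlt; apply/orP; left; apply/eqP.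
by ring.
Qed.

End Modes.

(** * Sobolev sums and the Wiener norm *)

Section Sobolev.
Context {R : realType}.
Notation mu := (@lebesgue_measure R).
Implicit Types (f g : R -> R) (r K : R) (k : int).

Lemma sob_weight_ge0 r k : 0 <= sob_weight r k.
Proof. exact: powR_ge0. Qed.

Lemma sob_weight_ge1 r k : 0 <= r -> 1 <= sob_weight r k.
Proof.
move=> r0; apply: (@le_trans _ _ (1 `^ r)); first by rewrite powR1.
apply: ge0_ler_powR => //.
- by rewrite nnegrE.
- by rewrite nnegrE addr_ge0// sqr_ge0.
- by rewrite lerDl sqr_ge0.
Qed.

Lemma sob_weight_mono r s k : r <= s -> sob_weight r k <= sob_weight s k.
Proof. by move=> rs; apply: ler_powR => //; rewrite lerDl sqr_ge0. Qed.

Lemma sob_weight_nat (n : nat) k : sob_weight n%:R k = (1 + k%:~R ^+ 2) ^+ n :> R.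
Proof. by rewrite /sob_weight powR_mulrn// addr_ge0// sqr_ge0. Qed.

(** Estimates are made on partial sums because [Hnorm] applies [fine], which sends an infinite sum
    to 0: a small [Hnorm] carries information only together with finiteness of the sum. *)
Definition sobps r f N : R := \sum_(0 <= n < N) sob_term r f n.

Lemma sob_term_ge0 r f n : 0 <= sob_term r f n.
Proof.
by case: n => [|n]; rewrite /= ?addr_ge0 ?mulr_ge0 ?sob_weight_ge0 ?fcoef_sq_ge0.
Qed.

Lemma sobps_ge0 r f N : 0 <= sobps r f N.
Proof. by apply: sumr_ge0 => n _; exact: sob_term_ge0. Qed.

Lemma sobpsE r f M : sobps r f M.+1 = \sum_(k <- zrange M) sob_weight r k * fcoef_sq f k.
Proof.
elim: M => [|M ih]; first by rewrite /sobps big_nat1 sum_zrange0.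
by rewrite /sobps big_nat_recr//= -/(sobps r f M.+1) ih sum_zrangeS.
Qed.

Lemma sobps_le_Hnorm r f N : (sob_sum r f < +oo)%E -> sobps r f N <= Hnorm r f ^+ 2.
Proof.
move=> fin.
have s0 : (0 <= sob_sum r f)%E.
  by apply: nneseries_ge0 => n _ _; rewrite lee_fin sob_term_ge0.
rewrite /Hnorm sqr_sqrtr ?fine_ge0// -lee_fin fineK ?ge0_fin_numE//.
rewrite /sobps -sumEFin; apply: nneseries_lim_ge => n _ _.
by rewrite lee_fin sob_term_ge0.
Qed.

Lemma sob_sum_le r f K : (forall N, sobps r f N <= K) -> (sob_sum r f <= K%:E)%E.
Proof.
move=> h; apply: lime_le.
  by apply: is_cvg_nneseries => n _ _; rewrite lee_fin sob_term_ge0.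
by apply: nearW => N; rewrite sumEFin lee_fin; exact: h.
Qed.

Lemma sob_sum_lty r f K : (forall N, sobps r f N <= K) -> (sob_sum r f < +oo)%E.
Proof. by move=> h; apply: le_lt_trans (sob_sum_le h) _; rewrite ltry. Qed.

Lemma Hnorm_le r f K : (forall N, sobps r f N <= K) -> Hnorm r f <= Num.sqrt K.
Proof.
move=> h; have s0 : (0 <= sob_sum r f)%E.
  by apply: nneseries_ge0 => n _ _; rewrite lee_fin sob_term_ge0.
rewrite ler_wsqrtr// -lee_fin fineK; first exact: sob_sum_le.
by rewrite ge0_fin_numE//; exact: sob_sum_lty h.
Qed.

Lemma fcoef_sqB_le f g k : integrableI f -> integrableI g ->
  fcoef_sq (f \- g) k <= 2 * fcoef_sq f k + 2 * fcoef_sq g k.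
Proof.
move=> If Ig; rewrite /fcoef_sq fcoef_reB// fcoef_imB//.
set a := fcoef_re f k; set b := fcoef_im f k; set c := fcoef_re g k; set d := fcoef_im g k.
have : 0 <= (a + c) ^+ 2 + (b + d) ^+ 2 by rewrite addr_ge0 ?sqr_ge0.
have -> : (a + c) ^+ 2 + (b + d) ^+ 2 = 2 * (a ^+ 2 + b ^+ 2) + 2 * (c ^+ 2 + d ^+ 2)
   - ((a - c) ^+ 2 + (b - d) ^+ 2) by ring.
lra.
Qed.

Lemma fcoef_sqDB_le f g k : integrableI f -> integrableI g ->
  fcoef_sq g k <= 2 * fcoef_sq f k + 2 * fcoef_sq (g \- f) k.
Proof.
move=> If Ig; rewrite /fcoef_sq fcoef_reB// fcoef_imB//.
set a := fcoef_re f k; set b := fcoef_im f k; set c := fcoef_re g k; set d := fcoef_im g k.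
have : 0 <= (2 * a - c) ^+ 2 + (2 * b - d) ^+ 2 by rewrite addr_ge0 ?sqr_ge0.
have -> : (2 * a - c) ^+ 2 + (2 * b - d) ^+ 2 = 2 * (a ^+ 2 + b ^+ 2)
   + 2 * ((c - a) ^+ 2 + (d - b) ^+ 2) - (c ^+ 2 + d ^+ 2) by ring.
lra.
Qed.

Lemma sob_term_lin r f g h n :
  (forall k, fcoef_sq h k <= 2 * fcoef_sq f k + 2 * fcoef_sq g k) ->
  sob_term r h n <= 2 * sob_term r f n + 2 * sob_term r g n.
Proof.
move=> H; have W k : sob_weight r k * fcoef_sq h k <=
    2 * (sob_weight r k * fcoef_sq f k) + 2 * (sob_weight r k * fcoef_sq g k).
  by rewrite ![2 * (_ * _)]mulrCA -mulrDr ler_wpM2l ?sob_weight_ge0.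
case: n => [|n] /=; first exact: W.
by have := W n.+1%:Z; have := W (- n.+1%:Z); lra.
Qed.

Lemma sobps_lin r f g h N :
  (forall k, fcoef_sq h k <= 2 * fcoef_sq f k + 2 * fcoef_sq g k) ->
  sobps r h N <= 2 * sobps r f N + 2 * sobps r g N.
Proof.
move=> H; rewrite /sobps !mulr_sumr -big_split/=.
by apply: ler_sum => n _; exact: sob_term_lin.
Qed.

Lemma sobpsB_le r f g N : integrableI f -> integrableI g ->
  sobps r (f \- g) N <= 2 * sobps r f N + 2 * sobps r g N.
Proof. by move=> If Ig; apply: sobps_lin => k; exact: fcoef_sqB_le. Qed.

Lemma sobpsDB_le r f g N : integrableI f -> integrableI g ->
  sobps r g N <= 2 * sobps r f N + 2 * sobps r (g \- f) N.
Proof. by move=> If Ig; apply: sobps_lin => k; exact: fcoef_sqDB_le. Qed.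

Lemma sobps_monor r s f N : r <= s -> sobps r f N <= sobps s f N.
Proof.
move=> rs; apply: ler_sum => -[|n] _ /=.
  by rewrite ler_wpM2r ?fcoef_sq_ge0// sob_weight_mono.
by rewrite lerD// ler_wpM2r ?fcoef_sq_ge0// sob_weight_mono.
Qed.

Lemma fcoef_sq_le_sobps f k r : 0 <= r -> fcoef_sq f k <= sobps r f `|k|.+1.
Proof.
move=> r0; rewrite sobpsE (bigD1_seq k) ?uniq_zrange ?mem_zrange//=.
rewrite -[leLHS]addr0 lerD//.
  by rewrite ler_peMl ?fcoef_sq_ge0// sob_weight_ge1.
by apply: sumr_ge0 => j _; rewrite mulr_ge0 ?sob_weight_ge0 ?fcoef_sq_ge0.
Qed.

Lemma fcoef_sq_le_Hnorm f k r : 0 <= r -> (sob_sum r f < +oo)%E ->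
  fcoef_sq f k <= Hnorm r f ^+ 2.
Proof.
by move=> r0 fin; apply: le_trans (fcoef_sq_le_sobps f k r0) (sobps_le_Hnorm _ fin).
Qed.

Lemma amp_le_Hnorm f k r : 0 <= r -> (sob_sum r f < +oo)%E -> amp f k <= Hnorm r f.
Proof.
move=> r0 fin; rewrite -ler_sqr ?nnegrE ?amp_ge0 ?sqrtr_ge0// sqr_amp.
exact: fcoef_sq_le_Hnorm.
Qed.

Lemma in_Hp_integrable r f : in_Hp r f -> integrableI f.
Proof.
move=> [_ mf i2 _]; apply: (@le_integrableI _ _ (fun x => 1 + f x ^+ 2)) => //.
  apply: integrableID; last exact: i2.
  by apply: continuous_integrableI; exact: cst_continuous.
move=> x _; have f2 : 0 <= f x ^+ 2 by rewrite sqr_ge0.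
rewrite [leRHS]ger0_norm ?addr_ge0// -[f x ^+ 2]real_normK ?num_real//.
have := sqr_ge0 (`|f x| - 1); have -> : (`|f x| - 1) ^+ 2 = `|f x| ^+ 2 + 1 - 2 * `|f x| by ring.
have := normr_ge0 (f x); lra.
Qed.

Lemma inv_sqr_sum_le M : \sum_(0 <= n < M) (n.+1%:R ^+ 2)^-1 <= 2 :> R.
Proof.
case: M => [|M]; first by rewrite big_nil.
rewrite big_nat_recl// expr1n invr1.
suff : \sum_(0 <= n < M) (n.+2%:R ^+ 2)^-1 <= 1 - M.+1%:R^-1 :> R.
  have : 0 <= M.+1%:R^-1 :> R by rewrite invr_ge0.
  by move: (M.+1%:R^-1) => x; lra.
elim: M => [|M ih]; first by rewrite big_nil invr1 subrr.
rewrite big_nat_recr//=; apply: (le_trans (lerD ih (invr_sqr_telescope (ltn0Sn M)))).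
by rewrite le_eqVlt; apply/orP; left; apply/eqP; ring.
Qed.

(** The term [k = 0] contributes nothing, the inverse of 0 being 0; later sums use this to include
    the zero mode. *)
Lemma sum_zrange_invsqr M :
  \sum_(k <- zrange M) (k%:~R ^+ 2)^-1 <= 4 :> R.
Proof.
have h : \sum_(k <- zrange M) (k%:~R ^+ 2)^-1 = 2 * \sum_(0 <= n < M) (n.+1%:R ^+ 2)^-1 :> R.
  elim: M => [|M ih]; first by rewrite sum_zrange0 big_nil expr0n invr0 mulr0.
  by rewrite sum_zrangeS big_nat_recr//= ih intrN sqrrN; ring.
by rewrite h; have := inv_sqr_sum_le M; lra.
Qed.

(** The Wiener bound comes from [2 |k| |z_k| <= k^4 |z_k|^2 + k^-2], which sums to [K / 2 + 2]. The
    pointwise bounds use [x <= (x^2 + 1) / 2]; the value [K + 3] covers all three without square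
    roots. *)
Lemma sobolev_wiener f K : (forall N, sobps 2 f N <= K) ->
  [/\ amp f 0 <= K + 3, forall k, k%:~R ^+ 2 * amp f k <= K + 3 &
      forall M, \sum_(k <- zrange M) `|k%:~R| * amp f k <= K + 3].
Proof.
move=> hK.
have K0 : 0 <= K by apply: le_trans (hK 0%N); exact: sobps_ge0.
have sq1 (x : R) : 0 <= x -> x ^+ 2 <= K -> x <= K + 3.
  move=> x0 xK; have := sqr_ge0 (x - 1).
  have -> : (x - 1) ^+ 2 = x ^+ 2 + 1 - 2 * x by ring.
  lra.
have w k : sob_weight 2 k * fcoef_sq f k <= K.
  apply: le_trans (hK `|k|.+1); rewrite sobpsE (bigD1_seq k) ?uniq_zrange ?mem_zrange//=.
  by rewrite lerDl; apply: sumr_ge0 => j _; rewrite mulr_ge0 ?sob_weight_ge0 ?fcoef_sq_ge0.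
have w4 (k : int) : k%:~R ^+ 4 <= sob_weight (2 : R) k.
  rewrite (sob_weight_nat 2) -[4%N]/(2 * 2)%N exprM lerXn2r ?nnegrE ?addr_ge0 ?sqr_ge0//.
  by rewrite lerDr.
split.
- apply: sq1; rewrite ?amp_ge0// sqr_amp; apply: le_trans (w 0).
  by rewrite ler_peMl ?fcoef_sq_ge0// sob_weight_ge1.
- move=> k; apply: sq1; first by apply: mulr_ge0; [exact: sqr_ge0|exact: amp_ge0].
  rewrite exprMn sqr_amp -exprM; apply: le_trans (w k).
  by rewrite ler_wpM2r ?fcoef_sq_ge0.
move=> M.
apply: (@le_trans _ _ (\sum_(k <- zrange M) (2^-1 * (sob_weight 2 k * fcoef_sq f k) + 2^-1 * (k%:~R ^+ 2)^-1))).
  apply: ler_sum => k _.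
  have [->|k0] := eqVneq k 0.
    rewrite normr0 mul0r; apply: addr_ge0; apply: mulr_ge0; rewrite ?invr_ge0 ?sqr_ge0//.
    by rewrite mulr_ge0 ?sob_weight_ge0 ?fcoef_sq_ge0.
  have kR : `|k%:~R| != 0 :> R by rewrite normr_eq0 intr_eq0.
  have h4 : k%:~R ^+ 4 * fcoef_sq f k <= sob_weight 2 k * fcoef_sq f k.
    by rewrite ler_wpM2r ?fcoef_sq_ge0.
  have := sqr_ge0 (`|k%:~R| ^+ 2 * amp f k - `|k%:~R|^-1).
  have -> : (`|k%:~R| ^+ 2 * amp f k - `|k%:~R|^-1) ^+ 2 =
     (`|k%:~R| ^+ 2) ^+ 2 * amp f k ^+ 2 + (`|k%:~R| ^+ 2)^-1 - 2 * (`|k%:~R| * amp f k).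
    by field.
  rewrite real_normK ?num_real// -exprM sqr_amp; move: h4; lra.
rewrite big_split/= -!mulr_sumr -sobpsE.
by have := hK M.+1; have := sum_zrange_invsqr M; lra.
Qed.

Lemma decay3_wiener f (C : R) : amp f 0 <= C ->
  (forall k, `|k%:~R| ^+ 3 * amp f k <= C) ->
  [/\ amp f 0 <= 4 * C, forall k, k%:~R ^+ 2 * amp f k <= 4 * C &
      forall M, \sum_(k <- zrange M) `|k%:~R| * amp f k <= 4 * C].
Proof.
move=> c0 h.
have C0 : 0 <= C by apply: le_trans c0; exact: amp_ge0.
split; first by lra.
- move=> k; have [->|k0] := eqVneq k 0; first by rewrite expr0n mul0r; lra.
  have k1 : 1 <= `|k%:~R| :> R by rewrite -intr_norm -[1]/(1%:~R) ler_int; lia.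
  apply: (@le_trans _ _ C); last by lra.
  apply: le_trans (h k); rewrite ler_wpM2r ?amp_ge0// -[leLHS]real_normK ?num_real//.
  by rewrite [leRHS]exprSr ler_peMr// exprn_ge0.
move=> M; apply: (@le_trans _ _ (\sum_(k <- zrange M) C * (k%:~R ^+ 2)^-1)).
  apply: ler_sum => k _; have [->|k0] := eqVneq k 0.
    by rewrite normr0 mul0r mulr_ge0// invr_ge0 sqr_ge0.
  have kR : 0 < k%:~R ^+ 2 :> R by rewrite exprn_even_gt0//= intr_eq0.
  rewrite ler_pdivlMr//; apply: le_trans (h k).
  by rewrite -[X in _ * X <= _]real_normK ?num_real//; rewrite le_eqVlt; apply/orP; left; apply/eqP; ring.
by rewrite -mulr_sumr mulrC; have := sum_zrange_invsqr M; rewrite -(ler_pM2r (_ : 0 < C + 1)); [|lra]; nra.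
Qed.

(* Uniform decay controls the high modes, smallness of each mode the low ones. *)
Lemma sum_small (C e : R) : 0 <= C -> 0 < e ->
  exists L : nat, exists2 eta : R, 0 < eta & forall g : nat -> R,
    (forall n, 0 <= g n) -> (forall n, (0 < n)%N -> g n <= C / n%:R ^+ 2) ->
    (forall n, (n <= L)%N -> g n <= eta) -> forall N, \sum_(0 <= n < N) g n <= e.
Proof.
move=> C0 e0.
pose L := (Num.truncn (2 * C / e)).+1.
have L0 : 0 < L%:R :> R by rewrite ltr0n.
have CL : C / L%:R <= e / 2.
  rewrite ler_pdivrMr// mulrAC ler_pdivlMr// [C * 2]mulrC [e * _]mulrC -ler_pdivrMr//.
  by rewrite ltW// truncnS_gt.
exists L; exists (e / (2 * L.+1%:R)).
  by rewrite divr_gt0// mulr_gt0.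
move=> g g0 gC geta N.
have tail m : \sum_(0 <= n < m) g (L.+1 + n)%N <= C / L%:R - C / (L + m)%:R.
  elim: m => [|m ih]; first by rewrite big_nil addn0 subrr.
  rewrite big_nat_recr//=; apply: (le_trans (lerD ih (gC _ (ltn0Sn _)))).
  have Lm : (0 < L + m)%N by [].
  have := ler_wpM2l C0 (@invr_sqr_telescope R _ Lm); rewrite mulrBr => h.
  have -> : C / L%:R - C / (L + m.+1)%:R = (C / L%:R - C / (L + m)%:R)
     + (C / (L + m)%:R - C / (L + m).+1%:R) by rewrite addnS; ring.
  by rewrite lerD2l addSn.
apply: (@le_trans _ _ (\sum_(0 <= n < L.+1 + N) g n)).
  rewrite [leRHS](big_cat_nat _ (n := N))//=; last by rewrite leq_addl.
  by rewrite lerDl; apply: sumr_ge0.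
rewrite (big_cat_nat _ (n := L.+1))//=; last by rewrite leq_addr.
rewrite -{2}[L.+1]add0n big_addn addKn.
have -> : e = e / 2 + e / 2 by field.
apply: lerD.
  apply: (@le_trans _ _ (\sum_(0 <= n < L.+1) e / (2 * L.+1%:R))).
    by rewrite !big_nat; apply: ler_sum => n nL; apply: geta; lia.
  rewrite sumr_const_nat subn0 -[_ *+ L.+1]mulr_natr le_eqVlt; apply/orP; left; apply/eqP.
  have : L.+1%:R != 0 :> R by rewrite pnatr_eq0.
  by move: (L.+1%:R : R) => y y0; field.
under eq_bigr do rewrite addnC.
apply: (le_trans (tail N)); apply: le_trans CL.
by rewrite lerBlDr lerDl divr_ge0.
Qed.

End Sobolev.

(** * Induction along a real interval *)

Section RealInduction.
Context {R : realType}.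

(** One local hypothesis covers both the passage to a supremum and the step beyond it: [r] and [r']
    range over a whole neighbourhood of [t], on either side. Neither openness nor closedness of [P]
    has to be shown, which suits both compactness arguments and the continuity argument in time. *)
Lemma real_induction (T : R) (P : R -> Prop) : 0 <= T -> P 0 ->
  (forall t, t \in `[0, T] -> exists2 d : R, 0 < d & forall r r',
     r \in `[0, T] -> r' \in `[0, T] -> `|r - t| < d -> `|r' - t| < d ->
     (forall s, s \in `[0, r] -> P s) -> P r') ->
  forall t, t \in `[0, T] -> P t.
Proof.
move=> T0 P0 H.
pose G : set R := [set t | t \in `[0, T] /\ forall s, s \in `[0, t] -> P s].
have G0 : G 0.
  split; first by rewrite in_itv/= lexx.
  move=> s; rewrite in_itv/= => s0; suff -> : s = 0 by [].
  by apply/eqP; rewrite eq_le; case/andP: s0 => -> ->.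
have Gub : ubound G T by move=> t [+ _]; rewrite in_itv/= => /andP[].
have hsG : has_sup G by split; [exists 0|exists T].
set sg := sup G.
have sg0 : 0 <= sg by apply: ub_le_sup G0; exists T.
have sgT : sg <= T by apply: ge_sup; [exists 0|].
have sgI : sg \in `[0, T] by rewrite in_itv/= sg0.
have [d d0 hd] := H sg sgI.
have [r Gr sr] := sup_adherent d0 hsG.
have rsg : r <= sg by apply: ub_le_sup Gr; exists T.
have rd : `|r - sg| < d.
  by rewrite distrC ger0_norm ?subr_ge0//; move: sr; rewrite -/sg; lra.
have [rI Pr] := Gr.
pose r1 := Num.min (sg + d / 2) T.
have r1T : r1 <= T by rewrite /r1 ge_min lexx orbT.
have r1s : r1 <= sg + d / 2 by rewrite /r1 ge_min lexx.
have sr1 : sg <= r1 by rewrite /r1 le_min sgT andbT; lra.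
have Gr1 : G r1.
  split; first by rewrite in_itv/= r1T (le_trans sg0).
  move=> s; rewrite in_itv/= => /andP[s0 sr1'].
  have [sr'|rs] := leP s r; first by apply: Pr; rewrite in_itv/= s0.
  apply: (hd r s) => //; first by rewrite in_itv/= s0 (le_trans sr1').
  rewrite ltr_norml; apply/andP; split.
    by move: rd; rewrite ltr_norml => /andP[h _]; lra.
  by lra.
have r1sg : r1 <= sg by apply: ub_le_sup Gr1; exists T.
have r1E : r1 = T.
  by move: r1sg; rewrite /r1; case: (leP (sg + d / 2) T) => // _; lra.
by move=> t tT; case: Gr1 => _; apply; rewrite r1E.
Qed.

End RealInduction.

(** * Modes and bounds of a fractional KdV solution *)

Section FractionalKdV.
Context {R : realType}.
Implicit Types (alpha eps T : R) (u w : R -> R -> R) (k : int).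

(** Finiteness for differences must be established first, since otherwise the [Hnorm] conditions in
    [fkdv_sol] could not be turned into bounds on modes. *)
Lemma sub_lty r (f g : R -> R) : integrableI f -> integrableI g ->
  (sob_sum r f < +oo)%E -> (sob_sum r g < +oo)%E -> (sob_sum r (f \- g)%R < +oo)%E.
Proof.
move=> If Ig ff fg; apply: (@sob_sum_lty _ _ _ (2 * Hnorm r f ^+ 2 + 2 * Hnorm r g ^+ 2)).
move=> N; apply: (le_trans (sobpsB_le _ _ If Ig)).
by rewrite lerD// ler_wpM2l//; exact: sobps_le_Hnorm.
Qed.

Lemma sob_sum_lty_mono r s (f : R -> R) : r <= s -> (sob_sum s f < +oo)%E -> (sob_sum r f < +oo)%E.
Proof.
move=> rs fin; apply: (@sob_sum_lty _ _ _ (Hnorm s f ^+ 2)) => N.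
by apply: (le_trans (sobps_monor _ _ rs)); exact: sobps_le_Hnorm.
Qed.

Section Solution.
Variables (alpha eps T : R) (u0 : R -> R) (u w : R -> R -> R).
Hypotheses (ha : 1 <= alpha) (sol : fkdv_sol alpha eps u0 T u w).

Let r0 : 0 <= 1 + alpha. Proof. by move: ha; lra. Qed.

Lemma fkdv_integrable t : t \in `[0, T] -> integrableI (u t).
Proof. by case: sol => -[hu _] _ _ _ _ /hu; exact: in_Hp_integrable. Qed.

Lemma fkdv_lty t : t \in `[0, T] -> (sob_sum (1 + alpha) (u t) < +oo)%E.
Proof. by case: sol => -[hu _] _ _ _ _ /hu []. Qed.

Lemma fkdv_integrable_dt t : t \in `[0, T] -> integrableI (w t).
Proof. by case: sol => _ [hw _] _ _ _ /hw; exact: in_Hp_integrable. Qed.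

Lemma fkdv_init k : 0 <= T -> integrableI u0 -> (sob_sum (1 + alpha) u0 < +oo)%E ->
  fcoef_re (u 0) k = fcoef_re u0 k /\ fcoef_im (u 0) k = fcoef_im u0 k.
Proof.
move=> T0 I0 f0; have t0T : 0 \in `[0, T] by rewrite in_itv/= lexx.
have I1 := fkdv_integrable t0T; case: sol => _ _ _ h _.
have fin : (sob_sum 0 (u 0 \- u0)%R < +oo)%E.
  by apply: (sob_sum_lty_mono r0); exact: (sub_lty I1 I0 (fkdv_lty t0T) f0).
have := amp_le_Hnorm k (lexx 0) fin; rewrite h => a0.
have re := norm_fcoef_re_amp (u 0 \- u0) k; have im := norm_fcoef_im_amp (u 0 \- u0) k.
split; apply/eqP; rewrite -subr_eq0 -normr_le0.
  by rewrite -fcoef_reB//; exact: le_trans a0.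
by rewrite -fcoef_imB//; exact: le_trans a0.
Qed.

Lemma fkdv_local_bound t : t \in `[0, T] -> exists2 d : R, 0 < d & forall r r',
  r \in `[0, T] -> r' \in `[0, T] -> `|r - t| < d -> `|r' - t| < d ->
  forall N, sobps (1 + alpha) (u r') N <= 2 * sobps (1 + alpha) (u r) N + 2.
Proof.
move=> tT; case: (sol) => -[_ hc] _ _ _ _.
(* Both [u r] and [u r'] are within 1/2 of [u t], so the squared norm of their difference is at most
   2 * (1/4 + 1/4) = 1; doubling gives the added 2. *)
have [d d0 hd] := hc t tT 2^-1 (ltac:(by rewrite invr_gt0)).
exists d => // r r' rT r'T rd r'd N.
have It := fkdv_integrable tT; have Ir := fkdv_integrable rT.
have Ir' := fkdv_integrable r'T.
have small q : q \in `[0, T] -> `|q - t| < d -> sobps (1 + alpha) (u q \- u t) N <= 4^-1.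
  move=> qT qd; have := hd q qT qd => hq.
  apply: (le_trans (sobps_le_Hnorm _ (sub_lty (fkdv_integrable qT) It (fkdv_lty qT) (fkdv_lty tT)))).
  have -> : 4^-1 = 2^-1 ^+ 2 :> R by field.
  by rewrite lerXn2r ?nnegrE ?sqrtr_ge0 ?invr_ge0// ltW.
apply: (le_trans (sobpsDB_le _ _ Ir Ir')); rewrite lerD2l.
have -> : u r' \- u r = (fun x => u r' x - u t x) \- (fun x => u r x - u t x).
  by apply/funext => x /=; ring.
have h := @sobpsB_le R (1 + alpha) _ _ N (integrableIB Ir' It) (integrableIB Ir It).
have s1 := small r rT rd; have s2 := small r' r'T r'd.
by move: h s1 s2; rewrite /=; lra.
Qed.

Lemma fkdv_bounded : 0 <= T -> exists K, forall t, t \in `[0, T] ->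
  forall N, sobps (1 + alpha) (u t) N <= K.
Proof.
move=> T0.
pose P t := exists K, forall s, s \in `[0, t] -> forall N, sobps (1 + alpha) (u s) N <= K.
have PT : P T.
  apply: (@real_induction R T P) => //; last by rewrite in_itv/= lexx T0.
    exists (Hnorm (1 + alpha) (u 0) ^+ 2) => s; rewrite in_itv/= => s0 N.
    have -> : s = 0 by apply/eqP; rewrite eq_le; case/andP: s0 => -> ->.
    by apply: sobps_le_Hnorm; apply: fkdv_lty; rewrite in_itv/= lexx.
  move=> t tT; have [d d0 hd] := fkdv_local_bound tT; exists d => // r r' rT r'T rd r'd.
  have rr : r \in `[0, r] by move: rT; rewrite !in_itv/= lexx => /andP[->].
  move=> /(_ r rr) [K hK]; exists (2 * K + 2).
  have K0 : 0 <= K by apply: le_trans (hK r rr 0%N); exact: sobps_ge0.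
  move=> s sr' N.
  move: (sr'); rewrite in_itv/= => /andP[s0 sr].
  have sT : s \in `[0, T].
    by move: r'T; rewrite !in_itv/= s0 => /andP[_]; exact: le_trans.
  have [sr1|rs] := leP s r.
    by have := hK s (ltac:(by rewrite in_itv/= s0)) N; lra.
  have sd : `|s - t| < d.
    by move: rd r'd; rewrite !ltr_norml => /andP[h1 h2] /andP[h3 h4]; lra.
  have := hd r s rT sT rd sd N; have := hK r rr N; lra.
by case: PT => K hK; exists K.
Qed.

Lemma fcoef_quotient (c : R) (f g h : R -> R) k : integrableI f -> integrableI g -> integrableI h ->
  fcoef_re ((fun x => (f x - g x) / c) \- h) k = (fcoef_re f k - fcoef_re g k) / c - fcoef_re h k /\
  fcoef_im ((fun x => (f x - g x) / c) \- h) k = (fcoef_im f k - fcoef_im g k) / c - fcoef_im h k.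
Proof.
move=> If Ig Ih.
have -> : (fun x => (f x - g x) / c) = (fun x => c^-1 * (f x - g x)).
  by apply/funext => x; rewrite mulrC.
have Iq : integrableI (fun x => c^-1 * (f x - g x)) by apply: integrableIZ; exact: integrableIB.
by rewrite fcoef_reB// fcoef_imB// fcoef_reZ ?fcoef_imZ ?fcoef_reB ?fcoef_imB //;
  [rewrite ![c^-1 * _]mulrC|exact: integrableIB..].
Qed.

Lemma quotient_lty (c : R) (f g h : R -> R) : integrableI f -> integrableI g -> integrableI h ->
  (sob_sum 0 f < +oo)%E -> (sob_sum 0 g < +oo)%E -> (sob_sum 0 h < +oo)%E ->
  (sob_sum 0 ((fun x => (f x - g x) / c) \- h)%R < +oo)%E.
Proof.
move=> If Ig Ih ff fg fh.
have Iq : integrableI (fun x => c^-1 * (f x - g x)) by apply: integrableIZ; exact: integrableIB.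
have -> : (fun x => (f x - g x) / c) = (fun x => c^-1 * (f x - g x)).
  by apply/funext => x; rewrite mulrC.
pose d x := f x - g x.
have Id : integrableI d by exact: integrableIB.
have fd : (sob_sum 0 d < +oo)%E by exact: (sub_lty If Ig ff fg).
apply: (sub_lty Iq Ih _ fh).
apply: (@sob_sum_lty _ _ _ (c^-1 ^+ 2 * Hnorm 0 d ^+ 2)) => N.
have sc j : fcoef_sq (fun x => c^-1 * d x) j = c^-1 ^+ 2 * fcoef_sq d j.
  by rewrite /fcoef_sq fcoef_reZ// fcoef_imZ//; ring.
have -> : sobps 0 (fun x => c^-1 * d x) N = c^-1 ^+ 2 * sobps 0 d N.
  rewrite /sobps mulr_sumr; apply: eq_bigr => -[|n] _ /=; rewrite !sc; ring.
by rewrite ler_wpM2l ?sqr_ge0//; exact: sobps_le_Hnorm.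
Qed.

(** A mode is bounded by the [L^2] norm, so the [L^2] limit of the difference quotients is a limit
    in each mode; the equation then identifies the derivative. *)
Lemma fkdv_modesol : modesol alpha eps T u.
Proof.
split=> [t|t tT k]; first exact: fkdv_integrable.
case: (sol) => _ [hw _] hd _ heq.
have It := fkdv_integrable tT; have Iw := fkdv_integrable_dt tT.
have [eq1 eq2] := heq t tT k.
have fw : (sob_sum 0 (w t) < +oo)%E by have [] := hw t tT.
have est e : 0 < e -> exists2 d : R, 0 < d & forall s, s \in `[0, T] -> 0 < `|s - t| < d ->
    amp ((fun x => (u s x - u t x) / (s - t)) \- w t) k <= e.
  move=> e0; have [d d0 hs] := hd t tT e e0; exists d => // s sT sd.
  apply: le_trans (ltW (hs s sT sd)); apply: (amp_le_Hnorm k (lexx 0)).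
  apply: (quotient_lty _ (fkdv_integrable sT) It Iw _ _ fw).
    by apply: sob_sum_lty_mono (fkdv_lty sT); exact: r0.
  by apply: sob_sum_lty_mono (fkdv_lty tT); exact: r0.
split.
- have -> : 3 * k%:~R * fcoef_im (fun x => u t x ^+ 2) k - dispersion alpha eps k * fcoef_im (u t) k = fcoef_re (w t) k.
    by move: eq1; rewrite /dispersion; lra.
  apply: dwithin_eps => e e0; have [d d0 hs] := est e e0; exists d => // s sT sd.
  have [<- _] := fcoef_quotient (s - t) k (fkdv_integrable sT) It Iw.
  by apply: le_trans (hs s sT sd); exact: norm_fcoef_re_amp.
- have -> : - (3 * k%:~R * fcoef_re (fun x => u t x ^+ 2) k) + dispersion alpha eps k * fcoef_re (u t) k = fcoef_im (w t) k.
    by move: eq2; rewrite /dispersion; lra.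
  apply: dwithin_eps => e e0; have [d d0 hs] := est e e0; exists d => // s sT sd.
  have [_ <-] := fcoef_quotient (s - t) k (fkdv_integrable sT) It Iw.
  by apply: le_trans (hs s sT sd); exact: norm_fcoef_im_amp.
Qed.

End Solution.
End FractionalKdV.

(** * Uniformity on compact sets and periodic functions *)

Section Calculus.
Context {R : realType}.
Implicit Types (f : R -> R) (T t e : R).

Lemma bounded_of_locally_bounded T (h : R -> R) : 0 <= T ->
  (forall t, t \in `[0, T] -> exists2 d : R, 0 < d & exists C, forall s, s \in `[0, T] ->
     `|s - t| < d -> `|h s| <= C) ->
  exists C, forall s, s \in `[0, T] -> `|h s| <= C.
Proof.
move=> T0 H.
pose P r := exists C, forall s, s \in `[0, r] -> `|h s| <= C.
apply: (@real_induction R T P) => //; last by rewrite in_itv/= lexx T0.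
  exists `|h 0| => s; rewrite in_itv/= => s0.
  by have -> : s = 0 by apply/eqP; rewrite eq_le; case/andP: s0 => -> ->.
move=> t tT; have [d d0 [C hd]] := H t tT; exists d => // r r' rT r'T rd r'd.
have rr : r \in `[0, r] by move: rT; rewrite !in_itv/= lexx => /andP[->].
move=> /(_ r rr) [K hK]; exists (Num.max K C) => s.
rewrite in_itv/= => /andP[s0 sr].
have sT : s \in `[0, T].
  by move: r'T; rewrite !in_itv/= s0 => /andP[_]; exact: le_trans.
have [sr1|rs] := leP s r.
  by apply: (le_trans (hK s _)); rewrite ?in_itv/= ?s0// le_max lexx.
apply: (le_trans (hd s sT _)); last by rewrite le_max lexx orbT.
by move: rd r'd; rewrite !ltr_norml => /andP[h1 h2] /andP[h3 h4]; lra.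
Qed.

Lemma joint_continuity T (F : R * R -> R) : {within `[0, T] `*` setT, continuous F} ->
  forall t x e, t \in `[0, T] -> 0 < e -> exists2 d : R, 0 < d & forall s y,
    s \in `[0, T] -> `|s - t| < d -> `|y - x| < d -> `|F (s, y) - F (t, x)| < e.
Proof.
move=> /subspace_continuousP cF t x e tT e0.
have /cvgrPdist_lt /(_ e e0) := cF (t, x) (conj tT I).
rewrite near_withinE => -[[A B] /= [[d1 /= d10 h1] [d2 /= d20 h2]] hAB].
exists (Num.min d1 d2); first by rewrite lt_min d10.
move=> s y sT; rewrite !lt_min => /andP[s1 _] /andP[_ y2].
rewrite distrC; apply: (hAB (s, y)) => //.
by split; [apply: h1|apply: h2]; rewrite /= distrC.
Qed.

(** The compactness of the period is expressed by induction on the length [r] of the initial segment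
    [[- pi, - pi + r]] on which the estimate is uniform. *)
Lemma uniform_in_Iper T (F : R * R -> R) : {within `[0, T] `*` setT, continuous F} ->
  forall t e, t \in `[0, T] -> 0 < e -> exists2 d : R, 0 < d & forall s x,
    s \in `[0, T] -> Iper x -> `|s - t| < d -> `|F (s, x) - F (t, x)| <= e.
Proof.
move=> cF t e tT e0; have p0 := @pi_gt0 R.
pose P r := exists2 d : R, 0 < d & forall s x, s \in `[0, T] -> - pi <= x <= - pi + r ->
  `|s - t| < d -> `|F (s, x) - F (t, x)| <= e.
have loc x : exists2 d : R, 0 < d & forall s y, s \in `[0, T] -> `|s - t| < d -> `|y - x| < d ->
    `|F (s, y) - F (t, y)| <= e.
  have e20 : 0 < e / 2 by lra.
  have [d d0 hd] := joint_continuity cF x tT e20; exists d => // s y sT sd yd.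
  have h1 := hd s y sT sd yd; have h2 := hd t y tT (ltac:(by rewrite subrr normr0)) yd.
  have -> : F (s, y) - F (t, y) = (F (s, y) - F (t, x)) - (F (t, y) - F (t, x)) by ring.
  by apply: (le_trans (ler_normB _ _)); lra.
have [d d0 hd] : P (2 * pi).
  apply: (@real_induction R (2 * pi) P); last by rewrite in_itv/= lexx; lra.
  - lra.
  - have [d d0 hd] := loc (- pi); exists d => // s x sT; rewrite addr0 => xp sd.
    have -> : x = - pi by apply/eqP; rewrite eq_le; case/andP: xp => -> ->.
    by apply: hd => //; rewrite subrr normr0.
  move=> q qT; have [d d0 hd] := loc (- pi + q); exists d => // r r' rT r'T rd r'd.
  have rr : r \in `[0, r] by move: rT; rewrite !in_itv/= lexx => /andP[->].
  move=> /(_ r rr) [d1 d10 h1]; exists (Num.min d d1); first by rewrite lt_min d0.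
  move=> s x sT /andP[x0 xr]; rewrite lt_min => /andP[sd sd1].
  have [xr1|rx] := leP x (- pi + r); first by apply: h1 => //; rewrite x0.
  apply: hd => //.
  by move: rd r'd; rewrite !ltr_norml => /andP[g1 g2] /andP[g3 g4]; apply/andP; split; lra.
exists d => // s x sT Ix sd; apply: hd => //.
by move: Ix; rewrite /Iper/= in_itv/= => /andP[-> h]; lra.
Qed.

Lemma MVT_itv T f (f' : R -> R) s t : (forall r, r \in `[0, T] -> is_derive r 1 f (f' r)) ->
  s \in `[0, T] -> t \in `[0, T] ->
  exists2 c, c \in `[0, T] & `|c - t| <= `|s - t| /\ f s - f t = f' c * (s - t).
Proof.
move=> df; rewrite !in_itv/= => /andP[s0 sT] /andP[t0 tT].
have dc r : r \in `[0, T] -> {for r, continuous f}.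
  by move=> rT; apply/differentiable_continuous/derivable1_diffP; case: (df r rT).
have seg (a b : R) : a <= b -> 0 <= a -> b <= T -> exists2 c, c \in `[a, b] & f b - f a = f' c * (b - a).
  move=> ab a0 bT.
  have d1 r : r \in `]a, b[ -> is_derive r 1 f (f' r).
    rewrite in_itv/= => /andP[ar rb]; apply: (df r); rewrite in_itv/=; apply/andP; split; lra.
  have c1 : {within `[a, b], continuous f}.
    apply/subspace_continuousP => r; rewrite /= in_itv/= => /andP[ar rb].
    by apply: cvg_within_filter; apply: dc; rewrite in_itv/=; apply/andP; split; lra.
  exact: (MVT_segment ab d1 c1).
have [st|ts] := leP s t.
  have [c] := seg s t st s0 tT; rewrite in_itv/= => /andP[c1 c2] h.
  exists c; first by rewrite in_itv/=; apply/andP; split; lra.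
  split; last by rewrite -opprB h; ring.
  by rewrite !ler0_norm ?subr_le0//; lra.
have [c] := seg t s (ltW ts) t0 sT; rewrite in_itv/= => /andP[c1 c2] h.
exists c; first by rewrite in_itv/=; apply/andP; split; lra.
split=> //; rewrite !ger0_norm ?subr_ge0 ?(ltW ts)//; lra.
Qed.

Lemma derivable_continuous f : (forall x : R, derivable f x 1) -> continuous f.
Proof. by move=> df x; exact/differentiable_continuous/derivable1_diffP. Qed.

Lemma derivable_is_derive f (x : R) : derivable f x 1 -> is_derive x 1 f (derive1 f x).
Proof. by move=> df; split=> //; rewrite derive1E. Qed.

Lemma periodic_derive1 f : periodic2pi f -> periodic2pi (derive1 f).
Proof.
move=> pf x; rewrite /derive1.
have E : (fun h => h^-1 *: (f (h + (x + 2 * pi)) - f (x + 2 * pi))) =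
    (fun h => h^-1 *: (f (h + x) - f x)).
  by apply/funext => h; rewrite addrA !pf.
by rewrite E.
Qed.

Lemma periodic_int f (n : int) x : periodic2pi f -> f (x + 2 * pi * n%:~R) = f x.
Proof.
move=> pf; have pn (m : nat) y : f (y + 2 * pi * m%:R) = f y.
  elim: m y => [|m ih] y; first by rewrite mulr0 addr0.
  by rewrite -(natr1 m) mulrDr mulr1 addrA pf ih.
case: n => n; first exact: pn.
by rewrite NegzE intrN -(pn n.+1 (x + _)); congr f; rewrite -pmulrn; ring.
Qed.

Lemma periodic_reduce (x : R) : exists n : int, Iper (x + 2 * pi * n%:~R).
Proof.
have p0 := @pi2_gt0 R; have p1 := @pi_gt0 R.
pose m := Num.floor ((x + pi) / (2 * pi)).
exists (- m); rewrite /Iper/= in_itv/= intrN.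
have h1 : m%:~R <= (x + pi) / (2 * pi) by exact: floor_le.
have h2 : (x + pi) / (2 * pi) < m%:~R + 1 by have := floorD1_gt ((x + pi) / (2 * pi)); rewrite intrD.
rewrite ler_pdivlMr// in h1; rewrite ltr_pdivrMr// in h2.
by apply/andP; split; lra.
Qed.

Lemma continuous_bounded_Iper f : continuous f -> exists B, forall x, Iper x -> `|f x| <= B.
Proof.
move=> cf; have p1 := @pi_gt0 R.
have ab : - pi <= pi :> R by lra.
have cw : {within `[- pi, pi], continuous (fun x => `|f x|)}.
  by apply: continuous_subspaceT => x; apply: cvg_norm; exact: cf.
have [c cI hc] := EVT_max ab cw.
by exists `|f c| => x Ix; exact: hc.
Qed.

Lemma periodic_bounded f : continuous f -> periodic2pi f -> exists B, forall x, `|f x| <= B.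
Proof.
move=> cf pf; have [B hB] := continuous_bounded_Iper cf; exists B => x.
by have [n Ix] := periodic_reduce x; rewrite -(periodic_int n x pf); exact: hB.
Qed.

Lemma periodic_max f : continuous f -> periodic2pi f -> exists c, forall x, f x <= f c.
Proof.
move=> cf pf; have p1 := @pi_gt0 R.
have ab : - pi <= pi :> R by lra.
have cw : {within `[- pi, pi], continuous f} by exact: continuous_subspaceT.
have [c cI hc] := EVT_max ab cw.
exists c => x; have [n Ix] := periodic_reduce x; rewrite -(periodic_int n x pf).
exact: hc.
Qed.

End Calculus.

(** * Fourier decay of the initial datum *)

Section SmoothData.
Context {R : realType}.
Implicit Types (f : R -> R) (k : int).

Lemma fcoef_sq_derive f (f' : R -> R) k :
  periodic2pi f -> (forall x : R, is_derive x 1 f (f' x)) -> continuous f' ->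
  fcoef_sq f' k = k%:~R ^+ 2 * fcoef_sq f k.
Proof.
move=> pf df cf'; have [h1 h2] := fcoef_derive k pf df cf'.
by rewrite /fcoef_sq h1 h2; ring.
Qed.

Lemma fcoef_sq_bounded f k (B : R) : integrableI f -> (forall x, Iper x -> `|f x| <= B) ->
  fcoef_sq f k <= 2 * B ^+ 2.
Proof.
move=> If fB; have h1 := norm_fcoef_re_le k If fB; have h2 := norm_fcoef_im_le k If fB.
have B0 : 0 <= B by apply: le_trans h1.
rewrite /fcoef_sq mulr_natl mulr2n; apply: lerD.
  by rewrite -[leLHS]real_normK ?num_real// lerXn2r ?nnegrE.
by rewrite -[leLHS]real_normK ?num_real// lerXn2r ?nnegrE.
Qed.

Lemma smooth_is_derive f n (x : R) : smooth f -> is_derive x 1 (derive1n n f) (derive1n n.+1 f x).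
Proof. by move=> sf; rewrite derive1nS; apply: derivable_is_derive; exact: sf. Qed.

Lemma smooth_continuous f n : smooth f -> continuous (derive1n n f).
Proof. by move=> sf; apply: derivable_continuous => x; exact: sf. Qed.

Lemma smooth_periodic f n : periodic2pi f -> periodic2pi (derive1n n f).
Proof. by move=> pf; elim: n => [//|n ih]; rewrite derive1nS; exact: periodic_derive1. Qed.

Lemma smooth_fcoef_sq f n k : smooth f -> periodic2pi f ->
  fcoef_sq (derive1n n f) k = k%:~R ^+ (2 * n) * fcoef_sq f k.
Proof.
move=> sf pf; elim: n => [|n ih]; first by rewrite muln0 expr0 mul1r.
rewrite (fcoef_sq_derive k (smooth_periodic n pf) (fun x => smooth_is_derive n x sf)).
  by rewrite ih mulrA -exprD mulnS.
exact: smooth_continuous.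
Qed.

(** Five derivatives bound [k^10 |z_k|^2], two powers more than the weight, so the sum is dominated
    by a multiple of [sum 1/k^2]. The zero mode is bounded separately. *)
Lemma smooth_energy f : smooth f -> periodic2pi f ->
  exists E0, forall M, \sum_(k <- zrange M) (1 + k%:~R ^+ 8) * fcoef_sq f k <= E0.
Proof.
move=> sf pf.
have [B0 hB0] := continuous_bounded_Iper (smooth_continuous (n := 0%N) sf).
have [B5 hB5] := continuous_bounded_Iper (smooth_continuous (n := 5%N) sf).
have I0 : integrableI f by exact: continuous_integrableI (smooth_continuous (n := 0%N) sf).
have I5 := continuous_integrableI (smooth_continuous (n := 5%N) sf).
pose C := 4 * B5 ^+ 2.
have C0 : 0 <= C by rewrite mulr_ge0// sqr_ge0.
exists (2 * B0 ^+ 2 + C * 4) => M.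
apply: (@le_trans _ _ (\sum_(k <- zrange M) ((k == 0)%:R * (2 * B0 ^+ 2) + C * (k%:~R ^+ 2)^-1))).
  apply: ler_sum => k _; have [->|k0] := eqVneq k 0.
    rewrite mul1r expr0n expr0n addr0 mul1r invr0 mulr0 addr0.
    exact: fcoef_sq_bounded.
  rewrite mul0r add0r.
  have kR : 0 < k%:~R ^+ 2 :> R by rewrite exprn_even_gt0//= intr_eq0.
  have k1 : 1 <= k%:~R ^+ 2 :> R.
    rewrite -[leRHS]real_normK ?num_real// exprn_ege1//.
    by rewrite -intr_norm -[1]/(1%:~R) ler_int; lia.
  rewrite ler_pdivlMr//.
  have h5 := fcoef_sq_bounded k I5 hB5; rewrite (smooth_fcoef_sq 5 k sf pf) in h5.
  have s0 := fcoef_sq_ge0 f k.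
  have k8 : 1 <= k%:~R ^+ 8 :> R by rewrite -[8%N]/(2 * 4)%N exprM exprn_ege1.
  apply: (@le_trans _ _ ((2 * k%:~R ^+ 8) * fcoef_sq f k * k%:~R ^+ 2)).
    by rewrite ler_wpM2r ?(ltW kR)// ler_wpM2r//; lra.
  have -> : 2 * k%:~R ^+ 8 * fcoef_sq f k * k%:~R ^+ 2 = 2 * (k%:~R ^+ (2 * 5) * fcoef_sq f k) by ring.
  by rewrite /C; lra.
rewrite big_split/= -mulr_sumr lerD//.
  rewrite (sum_zrange_delta (fun=> 2 * B0 ^+ 2)) mem_zrange/= mul1r; exact: lexx.
by rewrite ler_wpM2l// sum_zrange_invsqr.
Qed.

End SmoothData.

(** * The Burgers solution along characteristics *)

Section Characteristics.
Context {R : realType}.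
Variables (u0 : R -> R) (T : R) (v : R -> R -> R).
Hypotheses (T0 : 0 <= T) (sol : burgers_sol u0 T v).

Let vt (s x : R) : R := derive1 (fun s => v s x) s.
Let vx (s x : R) : R := derive1 (v s) x.

Let cvt : {within `[0, T] `*` setT, continuous (fun p : R * R => vt p.1 p.2)}.
Proof. by case: sol => _ _ _ h _; exact: h. Qed.

Let cvx : {within `[0, T] `*` setT, continuous (fun p : R * R => vx p.1 p.2)}.
Proof. by case: sol => _ _ _ _ h; exact: h. Qed.

Let dvt (s x : R) : s \in `[0, T] -> is_derive s 1 (fun s => v s x) (vt s x).
Proof. by case: sol => _ _ h _ _ sT; apply: derivable_is_derive; have [] := h s x sT. Qed.

Let dvx (s x : R) : s \in `[0, T] -> is_derive x 1 (v s) (vx s x).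
Proof. by case: sol => _ _ h _ _ sT; apply: derivable_is_derive; have [] := h s x sT. Qed.

Let eqv (s x : R) : s \in `[0, T] -> vt s x = - 6 * v s x * vx s x.
Proof.
case: sol => _ _ h _ _ sT; have [_ _] := h s x sT.
by rewrite -/(vt s x) -/(vx s x) => e; apply/eqP; rewrite -subr_eq0 -e; apply/eqP; ring.
Qed.

(** The chain rule for a function of two variables: the increment is split at [(t, X s)]. The time
    part is handled by the mean value theorem and joint continuity of [v_t], the space part by the
    difference quotient of [v t] at the fixed point [X t]. *)
Lemma dwithin_along_line (x c t : R) : t \in `[0, T] ->
  dwithin T (fun s => v s (x + c * s)) t (vt t (x + c * t) + c * vx t (x + c * t)).
Proof.
move=> tT; pose X s := x + c * s.
have /is_derive1_caratheodory [g [hg cg gl]] := dvx (X t) tT.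
apply: dwithin_eps => e e0.
have e20 : 0 < e / 2 by lra.
have [d1 d10 h1] := joint_continuity cvt (X t) tT e20.
have c0 : 0 < `|c| + 1 by have := normr_ge0 c; lra.
have e3 : 0 < e / 2 / (`|c| + 1) by rewrite divr_gt0.
move/cvgrPdist_lt: cg => /(_ _ e3) [d2 /= d20 h2].
exists (Num.min d1 (Num.min d1 d2 / (`|c| + 1))).
  by rewrite lt_min d10 divr_gt0// lt_min d10.
move=> s sT /andP[st0]; rewrite lt_min => /andP[sd1 sd2].
have XX : X s - X t = c * (s - t) by rewrite /X; ring.
have Xd : `|X s - X t| < Num.min d1 d2.
  rewrite XX normrM; rewrite ltr_pdivlMr// in sd2; apply: le_lt_trans sd2.
  by rewrite mulrC ler_wpM2l//; lra.
have [q qT [qt hq]] := MVT_itv (fun r rT => dvt (X s) rT) sT tT.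
have snt : s - t != 0 by rewrite -normr_gt0.
have -> : (v s (x + c * s) - v t (x + c * t)) / (s - t) - (vt t (x + c * t) + c * vx t (x + c * t))
   = (vt q (X s) - vt t (X t)) + c * (g (X s) - g (X t)).
  rewrite gl -/(X s) -/(X t).
  have -> : v s (X s) - v t (X t) = (v s (X s) - v t (X s)) + (v t (X s) - v t (X t)) by ring.
  by rewrite hq hg XX; field.
move: Xd; rewrite lt_min => /andP[Xd1 Xd2].
have k1 : `|vt q (X s) - vt t (X t)| < e / 2.
  by apply: (h1 q (X s)) => //; exact: le_lt_trans sd1.
have k2 : `|g (X t) - g (X s)| < e / 2 / (`|c| + 1) by apply: h2 => /=; rewrite distrC.
apply: (le_trans (ler_normD _ _)); rewrite normrM [`|g _ - _|]distrC.
have : `|c| * `|g (X t) - g (X s)| <= (`|c| + 1) * (e / 2 / (`|c| + 1)).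
  by apply: ler_pM => //; [lra|exact: ltW].
by rewrite mulrCA mulfV ?gt_eqF// mulr1; lra.
Qed.

Lemma vx_along_line_bounded (x c : R) : exists C, forall s, s \in `[0, T] -> `|vx s (x + c * s)| <= C.
Proof.
apply: bounded_of_locally_bounded => // t tT.
have [d d0 hd] := joint_continuity cvx (x + c * t) tT ltr01.
have c0 : 0 < `|c| + 1 by have := normr_ge0 c; lra.
exists (Num.min d (d / (`|c| + 1))); first by rewrite lt_min d0 divr_gt0.
exists (`|vx t (x + c * t)| + 1) => s sT; rewrite lt_min => /andP[sd1 sd2].
have /= h := hd s (x + c * s) sT sd1.
have {}h : `|vx s (x + c * s) - vx t (x + c * t)| < 1.
  apply: h; have -> : x + c * s - (x + c * t) = c * (s - t) by ring.
  rewrite normrM; rewrite ltr_pdivlMr// in sd2; apply: le_lt_trans sd2.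
  by rewrite mulrC ler_wpM2l//; lra.
have -> : vx s (x + c * s) = vx t (x + c * t) + (vx s (x + c * s) - vx t (x + c * t)) by ring.
by apply: (le_trans (ler_normD _ _)); lra.
Qed.

(** The straight line of slope [6 * u0 x] is tried directly instead of solving for the
    characteristic. Along it [y = v - u0 x] satisfies [y' = - 6 v_x y] with [y 0 = 0], and [v_x] is
    bounded there, so Gronwall's inequality for [y^2] gives [y = 0]. *)
Lemma burgers_characteristics (x t : R) : t \in `[0, T] -> v t (x + 6 * t * u0 x) = u0 x.
Proof.
move=> tT; pose c := 6 * u0 x; pose y s := v s (x + c * s) - u0 x.
have [C hC] := vx_along_line_bounded x c.
have C0 : 0 <= C by apply: le_trans (hC t tT).
have t0 : 0 <= t by move: tT; rewrite in_itv/= => /andP[].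
have tT' : t <= T by move: tT; rewrite in_itv/= => /andP[].
have dy s : s \in `[0, t] -> dwithin t (fun s => y s ^+ 2) s (2 * y s * (- 6 * vx s (x + c * s) * y s)).
  move=> st; have sT := sub_itv0 tT' st.
  apply: dwithin_sqr.
  have := dwithinB (dwithin_along_line x c sT) (dwithin_cst T s (u0 x)).
  rewrite subr0 (eqv _ sT) => h; apply: (dwithinW tT').
  have -> : - 6 * vx s (x + c * s) * y s = - 6 * v s (x + c * s) * vx s (x + c * s) + c * vx s (x + c * s).
    by rewrite /y /c; ring.
  exact: h.
have by' s : s \in `[0, t] -> 2 * y s * (- 6 * vx s (x + c * s) * y s) <= (12 * C) * y s ^+ 2 + 0.
  move=> st; have := hC s (sub_itv0 tT' st); rewrite ler_norml => /andP[h1 h2].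
  rewrite addr0 (_ : 2 * y s * _ = (12 * (- vx s (x + c * s))) * y s ^+ 2); last by ring.
  by rewrite ler_wpM2r ?sqr_ge0//; lra.
have := gronwall t0 (mulr_ge0 (ler0n _ 12) C0) (lexx 0) dy by'.
have y0 : y 0 = 0 by rewrite /y mulr0 addr0; case: sol => -> _ _ _ _; rewrite subrr.
rewrite y0 mul0r addr0 expr0n mul0r => yt.
have : y t ^+ 2 == 0 by rewrite eq_le yt sqr_ge0.
rewrite sqrf_eq0 /y subr_eq0 => /eqP h; rewrite -[RHS]h.
by congr (v t _); rewrite /c; ring.
Qed.

(** The time derivative of a mode is computed under the integral, since difference quotients
    converge uniformly on the period; then [v_t = - 3 (v^2)_x] and integration by parts give the
    mode equations. *)
Lemma burgers_modesol alpha :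
  (forall t, t \in `[0, T] -> continuous (vx t)) -> modesol alpha 0 T v.
Proof.
move=> cx.
have per t : periodic2pi (v t) by case: sol => _ h _ _ _ x; exact: h.
have cv t : t \in `[0, T] -> continuous (v t).
  by move=> tT; apply: derivable_continuous => x; have [] := dvx x tT.
have Iv t : t \in `[0, T] -> integrableI (v t).
  by move=> tT; apply: continuous_integrableI; exact: cv.
split=> // t tT k.
have dsq (x : R) : is_derive x 1 (fun x => v t x ^+ 2) (2 * (v t x * vx t x)).
  have := is_deriveM (dvx x tT) (dvx x tT).
  by rewrite (_ : _ *: _ + _ = 2 * (v t x * vx t x))// /GRing.scale/=; ring.
have csq : continuous (fun x => 2 * (v t x * vx t x)).
  move=> x; apply: cvgM; first exact: cvg_cst.
  by apply: cvgM; [exact: cv|exact: cx].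
have psq : periodic2pi (fun x => v t x ^+ 2) by move=> x; rewrite per.
have [f1 f2] := fcoef_derive k psq dsq csq.
have Isq := continuous_integrableI csq.
have vtE : vt t = (fun x => - 3 * (2 * (v t x * vx t x))).
  by apply/funext => x; rewrite eqv//; ring.
have Ivt : integrableI (vt t) by rewrite vtE; exact: integrableIZ.
have disp0 : dispersion alpha 0 k = 0 by rewrite /dispersion expr0n/= !mul0r.
have g1 : fcoef_re (vt t) k = 3 * k%:~R * fcoef_im (fun x => v t x ^+ 2) k - dispersion alpha 0 k * fcoef_im (v t) k.
  by rewrite vtE fcoef_reZ// f1 disp0; ring.
have g2 : fcoef_im (vt t) k = - (3 * k%:~R * fcoef_re (fun x => v t x ^+ 2) k) + dispersion alpha 0 k * fcoef_re (v t) k.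
  by rewrite vtE fcoef_imZ// f2 disp0; ring.
rewrite -g1 -g2.
have est e : 0 < e -> exists2 d : R, 0 < d & forall s, s \in `[0, T] -> 0 < `|s - t| < d ->
    forall x, Iper x -> `|((fun x => (v s x - v t x) / (s - t)) \- vt t) x| <= e.
  move=> e0; have [d d0 hd] := uniform_in_Iper cvt tT e0; exists d => // s sT /andP[st sd] x Ix.
  have [q qT [qt hq]] := MVT_itv (fun r rT => dvt x rT) sT tT.
  have snt : s - t != 0 by rewrite -normr_gt0.
  rewrite /= hq mulfK//; apply: (hd q x) => //; exact: le_lt_trans sd.
have Iq s : s \in `[0, T] -> integrableI ((fun x => (v s x - v t x) / (s - t)) \- vt t).
  move=> sT; apply: integrableIB => //.
  under eq_fun do rewrite mulrC.
  by apply: integrableIZ; apply: integrableIB; exact: Iv.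
split; apply: dwithin_eps => e e0; have [d d0 hd] := est e e0; exists d => // s sT sd.
- have [<- _] := fcoef_quotient (s - t) k (Iv s sT) (Iv t tT) Ivt.
  by apply: norm_fcoef_re_le; [exact: Iq|exact: hd].
- have [_ <-] := fcoef_quotient (s - t) k (Iv s sT) (Iv t tT) Ivt.
  by apply: norm_fcoef_im_le; [exact: Iq|exact: hd].
Qed.

End Characteristics.

(** * Regularity through a uniform diffeomorphism *)

Section FlowMap.
Context {R : realType}.
Variables (Phi phi : R -> R) (c0 : R).
Hypotheses (c00 : 0 < c0) (dPhi : forall x : R, is_derive x 1 Phi (phi x))
  (phic : forall x, c0 <= phi x).

Let cPhi : continuous Phi.
Proof. by apply: derivable_continuous => x; have [] := dPhi x. Qed.

Lemma flow_expanding x y : x <= y -> c0 * (y - x) <= Phi y - Phi x.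
Proof.
move=> xy; have cw : {within `[x, y], continuous Phi} by exact: continuous_subspaceT.
have [c _ ->] := MVT_segment xy (fun x _ => dPhi x) cw.
by rewrite ler_wpM2r ?subr_ge0.
Qed.

Lemma flow_inverse : exists2 Psi : R -> R, cancel Phi Psi & cancel Psi Phi.
Proof.
have inj : injective Phi.
  move=> x y; wlog xy : x y / x <= y.
    by move=> H; case: (leP x y) => [/H//|/ltW yx e]; apply/esym/(H _ _ yx).
  move=> e; have := flow_expanding xy; rewrite e subrr pmulr_rle0// subr_le0 => yx.
  by apply/eqP; rewrite eq_le xy.
have surj y : exists x, Phi x = y.
  (* [Phi] expands distances by at least [c0], so moving by [b] to either side of 0 carries it past
     [y], and the intermediate value theorem applies. *)
  pose b := `|y - Phi 0| / c0.
  have b0 : 0 <= b by rewrite divr_ge0// ltW.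
  have nb : - b <= 0 by rewrite oppr_le0.
  have cb : c0 * b = `|y - Phi 0| by rewrite /b mulrC divfK// gt_eqF.
  have h1 := flow_expanding b0; have h2 := flow_expanding nb.
  rewrite subr0 cb in h1; rewrite sub0r opprK cb in h2.
  have n1 := ler_norm (y - Phi 0); have n2 := ler_norm (- (y - Phi 0)).
  rewrite normrN in n2.
  have bb : - b <= b by lra.
  have cw : {within `[- b, b], continuous Phi} by exact: continuous_subspaceT.
  have [|c _ <-] := @IVT R Phi (- b) b y bb cw; last by exists c.
  by rewrite ge_min le_max; apply/andP; split; apply/orP; [left|right]; lra.
pose Psi y := projT1 (cid (surj y)).
have PsiK y : Phi (Psi y) = y by rewrite /Psi; case: cid.
by exists Psi => x; [apply: inj; rewrite PsiK|exact: PsiK].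
Qed.

(** Writing [h] as [g] composed with the inverse flow, regularity known along the flow is
    transferred to [h] at every point. The form [g' x / phi x] can be fed back in as the next
    [g]. *)
Lemma derive_through_flow (h g g' : R -> R) : (forall x, h (Phi x) = g x) ->
  (forall x : R, is_derive x 1 g (g' x)) -> forall x, is_derive (Phi x) 1 h (g' x / phi x).
Proof.
move=> hg dg x; have [Psi PhiK PsiK] := flow_inverse.
have -> : h = g \o Psi by apply/funext => y; rewrite /= -hg PsiK.
have p0 : phi x != 0 by rewrite gt_eqF// (lt_le_trans c00).
have Kx : \forall y \near x, Psi (Phi y) = y by exists 1 => //= z _; exact: PhiK.
have cx : \forall y \near x, {for y, continuous Phi} by exists 1 => //= z _; exact: cPhi.
have dPsi := is_derive_inverse Kx cx (dPhi x) p0.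
by apply: is_derive1_comp dPsi; rewrite PhiK.
Qed.

Lemma continuous_through_flow (h g : R -> R) : (forall x, h (Phi x) = g x) ->
  continuous g -> continuous h.
Proof.
move=> hg cg; have [Psi PhiK PsiK] := flow_inverse.
have -> : h = g \o Psi by apply/funext => y; rewrite /= -hg PsiK.
have cPsi : continuous Psi.
  apply: derivable_continuous => y; rewrite -[y]PsiK.
  have p0 : phi (Psi y) != 0 by rewrite gt_eqF// (lt_le_trans c00).
  have Kx : \forall z \near Psi y, Psi (Phi z) = z by exists 1 => //= z _; exact: PhiK.
  have cx : \forall z \near Psi y, {for z, continuous Phi} by exists 1 => //= z _; exact: cPhi.
  have dPsi := is_derive_inverse Kx cx (dPhi (Psi y)) p0.
  by case: dPsi.
by move=> y; apply: continuous_comp; [exact: cPsi|exact: cg].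
Qed.

Lemma bounded_through_flow (h g : R -> R) (B : R) : (forall x, h (Phi x) = g x) ->
  (forall x, `|g x| <= B) -> forall y, `|h y| <= B.
Proof.
by move=> hg gB y; have [Psi _ PsiK] := flow_inverse; rewrite -(PsiK y) hg.
Qed.

End FlowMap.

(** * Burgers regularity before the critical time *)

Section BurgersRegularity.
Context {R : realType}.
Implicit Types (f g : R -> R).

Lemma is_derive_mul f g (x a b : R) : is_derive x 1 f a -> is_derive x 1 g b ->
  is_derive x 1 (fun y => f y * g y) (a * g x + f x * b).
Proof.
move=> df dg; have := is_deriveM df dg.
by rewrite (_ : _ *: _ + _ = a * g x + f x * b)// /GRing.scale/=; ring.
Qed.

Variables (u0 : R -> R) (T : R) (v : R -> R -> R).
Hypotheses (T0 : 0 <= T) (sol : burgers_sol u0 T v) (su0 : smooth u0) (pu0 : periodic2pi u0)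
  (Tc : forall x, T * (- 6 * derive1 u0 x) < 1).

(** Periodicity makes [- 6 u0'] attain its maximum [m], so the pointwise strict inequality at time
    [T] becomes uniform. The minimum with 1 handles [m < 0], where the worst time is 0 instead of
    [T]. *)
Lemma flow_uniform : exists2 c0 : R, 0 < c0 & forall t x, t \in `[0, T] ->
  c0 <= 1 + 6 * t * derive1 u0 x.
Proof.
have c1 : continuous (fun x => - 6 * derive1 u0 x).
  move=> x; apply: cvgM; first exact: cvg_cst.
  exact: (@smooth_continuous R u0 1 su0).
have p1 : periodic2pi (fun x => - 6 * derive1 u0 x).
  by move=> x; rewrite (periodic_derive1 pu0).
have [c hc] := periodic_max c1 p1; have Tcc := Tc c.
set m := - 6 * derive1 u0 c in hc Tcc.
exists (Num.min 1 (1 - T * m)); first by rewrite lt_min ltr01 subr_gt0.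
move=> t x; rewrite in_itv/= => /andP[t0 tT]; have hx := hc x.
have h1 : t * (- 6 * derive1 u0 x) <= t * m by rewrite ler_wpM2l.
have h2 : 1 + 6 * t * derive1 u0 x = 1 - t * (- 6 * derive1 u0 x) by ring.
rewrite h2 ge_min; have [m0|m0] := leP 0 m.
  have : t * m <= T * m by rewrite ler_wpM2r.
  by move=> h3; apply/orP; right; lra.
have : t * m <= 0 by rewrite mulr_ge0_le0// ltW.
by move=> h3; apply/orP; left; lra.
Qed.

Theorem burgers_regularity : exists2 C : R, 0 <= C & forall t, t \in `[0, T] ->
  [/\ continuous (derive1 (v t)), amp (v t) 0 <= C &
      forall k, `|k%:~R| ^+ 3 * amp (v t) k <= C].
Proof.
have [c0 c00 hc0] := flow_uniform.
pose a n := derive1n n u0.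
have da n (x : R) : is_derive x 1 (a n) (a n.+1 x) by exact: smooth_is_derive.
have ca n : continuous (a n) by exact: smooth_continuous.
have bnd n : exists B, forall x, `|a n x| <= B.
  by apply: periodic_bounded; [exact: ca|exact: smooth_periodic].
have [[B0 hB0] [B2 hB2] [B3 hB3]] := And3 (bnd 0%N) (bnd 2%N) (bnd 3%N).
have B20 : 0 <= B2 by apply: le_trans (hB2 0).
have B30 : 0 <= B3 by apply: le_trans (hB3 0).
have B00 : 0 <= B0 by apply: le_trans (hB0 0).
(* The supremum of the third space derivative, given along the flow by [a3 psi^4 - 18 t a2^2 psi^5],
   with [psi <= 1 / c0]. *)
pose D := B3 * c0^-1 ^+ 4 + 18 * T * B2 ^+ 2 * c0^-1 ^+ 5.
have D0 : 0 <= D.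
  by rewrite addr_ge0// !mulr_ge0 ?exprn_ge0 ?sqr_ge0 ?invr_ge0// ltW.
exists (2 * B0 + 2 * D); first by rewrite addr_ge0// mulr_ge0.
move=> t tT; move: (tT); rewrite in_itv/= => /andP[t0 tT'].
pose Phi x := x + 6 * t * u0 x; pose phi x := 1 + 6 * t * a 1%N x.
pose psi x := (phi x)^-1.
have phic x : c0 <= phi x by exact: hc0.
have phi0 x : 0 < phi x by exact: lt_le_trans (phic x).
have phin x : phi x != 0 by rewrite gt_eqF.
have dlin n (x : R) : is_derive x 1 (fun y => 6 * t * a n y) (6 * t * a n.+1 x).
  have := is_deriveZ (6 * t) (da n x); exact.
have dPhi (x : R) : is_derive x 1 Phi (phi x).
  have := is_deriveD (is_derive_id x (1 : R)) (dlin 0%N x); exact.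
have dphi (x : R) : is_derive x 1 phi (6 * t * a 2%N x).
  have := is_deriveD (is_derive_cst (1 : R) x (1 : R)) (dlin 1%N x); rewrite add0r; exact.
have dpsi (x : R) : is_derive x 1 psi (- (6 * t * a 2%N x * psi x ^+ 2)).
  have := is_deriveV (phin x) (dphi x).
  by rewrite (_ : - _ *: _ = - (6 * t * a 2%N x * psi x ^+ 2))// /GRing.scale/= /psi exprVn; ring.
have char x : v t (Phi x) = a 0%N x by exact: (burgers_characteristics T0 sol).
have d1 (x : R) := derive_through_flow c00 dPhi phic char (da 0%N) x.
pose h1 := derive1 (v t).
have h1E x : h1 (Phi x) = a 1%N x * psi x by rewrite /h1 derive1E; have [_ ->] := d1 x.
have dg1 (x : R) : is_derive x 1 (fun y => a 1%N y * psi y) (a 2%N x * psi x ^+ 2).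
  have := is_derive_mul (da 1%N x) (dpsi x).
  rewrite (_ : _ + _ = a 2%N x * psi x ^+ 2)//.
  (* The terms in [a 1] cancel because [phi - 6 t a1 = 1]; this is what keeps the next two
     derivatives short. *)
  have -> : a 2%N x * psi x = a 2%N x * psi x ^+ 2 * phi x by rewrite /psi; field.
  by rewrite /phi; ring.
have d2 (x : R) := derive_through_flow c00 dPhi phic h1E dg1 x.
pose h2 := derive1 h1.
have h2E x : h2 (Phi x) = a 2%N x * (psi x * (psi x * psi x)).
  rewrite /h2 derive1E; have [_ ->] := d2 x; rewrite -/(psi x).
  by move: (psi x) (a 2%N x) => p q; ring.
have dg2 (x : R) : is_derive x 1 (fun y => a 2%N y * (psi y * (psi y * psi y)))
    (a 3%N x * psi x ^+ 3 - 18 * t * a 2%N x ^+ 2 * psi x ^+ 4).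
  apply: (is_derive_eq (is_derive_mul (da 2%N x) (is_derive_mul (dpsi x) (is_derive_mul (dpsi x) (dpsi x))))).
  by move: (psi x) (a 2%N x) (a 3%N x) => p q r; ring.
have d3 (x : R) := derive_through_flow c00 dPhi phic h2E dg2 x.
pose h3 := derive1 h2.
have h3E x : h3 (Phi x) = a 3%N x * psi x ^+ 4 - 18 * t * a 2%N x ^+ 2 * psi x ^+ 5.
  rewrite /h3 derive1E; have [_ ->] := d3 x; rewrite -/(psi x).
  by move: (psi x) (a 2%N x) (a 3%N x) => p q r; ring.
have [Psi _ PsiK] := flow_inverse c00 dPhi phic.
have D1 (y : R) : is_derive y 1 (v t) (h1 y).
  by apply: derivable_is_derive; rewrite -(PsiK y); have [] := d1 (Psi y).
have D2 (y : R) : is_derive y 1 h1 (h2 y).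
  by apply: derivable_is_derive; rewrite -(PsiK y); have [] := d2 (Psi y).
have D3 (y : R) : is_derive y 1 h2 (h3 y).
  by apply: derivable_is_derive; rewrite -(PsiK y); have [] := d3 (Psi y).
have cpsi : continuous psi by apply: derivable_continuous => x; have [] := dpsi x.
have cpsin n : continuous (fun x => psi x ^+ n).
  by move=> x; apply: (@continuous_comp _ _ _ psi (fun y => y ^+ n)); [exact: cpsi|exact: exprn_continuous].
have ch3 : continuous h3.
  apply: (continuous_through_flow c00 dPhi phic h3E) => x; apply: cvgB.
    by apply: cvgM; [exact: ca|exact: cpsin].
  apply: cvgM; last exact: cpsin.
  apply: cvgM; first exact: cvg_cst.
  by apply: (cvgM (f := a 2%N) (g := a 2%N)); exact: ca.
have ch2 : continuous h2 by apply: derivable_continuous => x; have [] := D3 x.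
have ch1 : continuous h1 by apply: derivable_continuous => x; have [] := D2 x.
have cv : continuous (v t) by apply: derivable_continuous => x; have [] := D1 x.
have pv : periodic2pi (v t) by case: sol => _ h _ _ _ x; exact: h.
have p1 : periodic2pi h1 := periodic_derive1 pv.
have p2 : periodic2pi h2 := periodic_derive1 p1.
have vB y : `|v t y| <= B0 by exact: (bounded_through_flow c00 dPhi phic char).
have psiB x : 0 <= psi x <= c0^-1.
  by rewrite invr_ge0 (ltW (phi0 x))/= lef_pV2 ?posrE.
have h3B y : `|h3 y| <= D.
  apply: (bounded_through_flow c00 dPhi phic h3E) => x.
  have psin n : `|psi x ^+ n| <= c0^-1 ^+ n.
    have /andP[q0 q1] := psiB x.
    by rewrite ger0_norm ?exprn_ge0// lerXn2r ?nnegrE// invr_ge0 ltW.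
  apply: (le_trans (ler_normB _ _)); rewrite (normrM (a 3%N x)) (normrM (18 * t * a 2%N x ^+ 2)); apply: lerD.
    by apply: ler_pM.
  apply: ler_pM => //; rewrite normrM normrX ger0_norm ?mulr_ge0//.
  apply: ler_pM; rewrite ?mulr_ge0 ?sqr_ge0//.
    by rewrite ler_wpM2l.
  by rewrite lerXn2r ?nnegrE.
have sqle (x B : R) : 0 <= x -> 0 <= B -> x ^+ 2 <= 2 * B ^+ 2 -> x <= 2 * B.
  move=> x0 B00' h; rewrite -ler_sqr ?nnegrE ?mulr_ge0// exprMn.
  by have := sqr_ge0 B; lra.
split=> //.
- have : amp (v t) 0 <= 2 * B0.
    apply: sqle => //; first exact: amp_ge0.
    by rewrite sqr_amp; apply: (fcoef_sq_bounded 0 (continuous_integrableI cv)) => x _; exact: vB.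
  by move: D0; lra.
- move=> k.
  have : `|k%:~R| ^+ 3 * amp (v t) k <= 2 * D.
    apply: sqle => //; first by rewrite mulr_ge0 ?exprn_ge0 ?amp_ge0.
    have -> : (`|k%:~R| ^+ 3 * amp (v t) k) ^+ 2 = fcoef_sq h3 k.
      rewrite (fcoef_sq_derive k p2 D3 ch3) (fcoef_sq_derive k p1 D2 ch2).
      rewrite (fcoef_sq_derive k pv D1 ch1) -sqr_amp -[k%:~R ^+ 2]real_normK ?num_real//; ring.
    by apply: (fcoef_sq_bounded k (continuous_integrableI ch3)) => x _; exact: h3B.
  by move: B00; lra.
Qed.

End BurgersRegularity.

(** * Consequences of uniform decay of the modes *)

Section Decay.
Context {R : realType}.
Implicit Types (f g : R -> R) (k : int) (K r e : R).

Definition decay8 f K := forall k, (1 + k%:~R ^+ 8) * fcoef_sq f k <= K.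

Lemma decay8_ge0 f K : decay8 f K -> 0 <= K.
Proof.
move=> h; apply: le_trans (h 0); rewrite mulr_ge0 ?fcoef_sq_ge0//.
Qed.

Lemma int_ge1 k : k != 0 -> 1 <= k%:~R ^+ 2 :> R.
Proof.
move=> k0; rewrite -[leRHS]real_normK ?num_real// exprn_ege1//.
by rewrite -intr_norm -[1]/(1%:~R) ler_int; lia.
Qed.

Lemma expr8_sqr4 k : k%:~R ^+ 8 = (k%:~R ^+ 2) ^+ 4 :> R.
Proof. by rewrite -exprM. Qed.

Lemma sob_weight_le6 r k : r <= 3 -> k != 0 -> sob_weight r k <= 8 * k%:~R ^+ 6 :> R.
Proof.
move=> r3 k0; apply: (le_trans (sob_weight_mono k r3)); rewrite (sob_weight_nat 3).
have k1 := int_ge1 k0.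
have -> : 8 * k%:~R ^+ 6 = (2 * k%:~R ^+ 2) ^+ 3 :> R by ring.
have k2 : 0 <= k%:~R ^+ 2 :> R by rewrite sqr_ge0.
by apply: lerXn2r; rewrite ?nnegrE; lra.
Qed.

Lemma decay8_weight f K r k : decay8 f K -> r <= 3 -> k != 0 ->
  sob_weight r k * fcoef_sq f k <= 8 * K / k%:~R ^+ 2.
Proof.
move=> h r3 k0; have k1 := int_ge1 k0.
have s0 := fcoef_sq_ge0 f k.
rewrite ler_pdivlMr; last by lra.
apply: (@le_trans _ _ (8 * k%:~R ^+ 6 * fcoef_sq f k * k%:~R ^+ 2)).
  by rewrite ler_wpM2r ?(le_trans ler01)// ler_wpM2r// sob_weight_le6.
have -> : 8 * k%:~R ^+ 6 * fcoef_sq f k * k%:~R ^+ 2 = 8 * (k%:~R ^+ 8 * fcoef_sq f k) by ring.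
by have := h k; rewrite mulrDl mul1r; lra.
Qed.

Lemma decay8_term f K r n : decay8 f K -> r <= 3 -> (0 < n)%N ->
  sob_term r f n <= 16 * K / n%:R ^+ 2.
Proof.
move=> h r3; case: n => // n _ /=.
have h1 := @decay8_weight f K r n.+1%:Z h r3 isT.
have h2 := @decay8_weight f K r (- n.+1%:Z) h r3 isT.
rewrite intrN sqrrN in h2.
have -> : 16 * K / n.+1%:R ^+ 2 = 8 * K / n.+1%:~R ^+ 2 + 8 * K / n.+1%:~R ^+ 2 by rewrite -pmulrn; ring.
exact: lerD.
Qed.

Lemma sob_weight0E r : sob_weight r 0 = 1 :> R.
Proof. by rewrite /sob_weight expr0n addr0 powR1. Qed.

Lemma decay8_sobps f K r N : decay8 f K -> r <= 3 -> sobps r f N <= 33 * K.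
Proof.
move=> h r3; have K0 := decay8_ge0 h.
case: N => [|N]; first by rewrite /sobps big_nil mulr_ge0.
rewrite /sobps big_nat_recl//=.
have t0 : sob_weight r 0 * fcoef_sq f 0 <= K.
  by rewrite sob_weight0E; have := h 0; rewrite expr0n addr0.
have : \sum_(0 <= n < N) sob_term r f n.+1 <= 16 * K * \sum_(0 <= n < N) (n.+1%:R ^+ 2)^-1.
  by rewrite mulr_sumr; apply: ler_sum => n _; exact: decay8_term.
have := @inv_sqr_sum_le R N.
set S := \sum_(_ <= _ < _) (_ ^+ 2)^-1 => S2 h2.
have : 16 * K * S <= 16 * K * 2 by rewrite ler_wpM2l// mulr_ge0.
move: h2; set s := \sum_(_ <= _ < _) _ => h2 h3; move: t0 h2 h3.
by set q := _ * fcoef_sq f 0; lra.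
Qed.

Lemma decay8_sum6 f K M : decay8 f K ->
  \sum_(k <- zrange M) k%:~R ^+ 6 * fcoef_sq f k <= 4 * K.
Proof.
move=> h; have K0 := decay8_ge0 h.
apply: (@le_trans _ _ (\sum_(k <- zrange M) K * (k%:~R ^+ 2)^-1)).
  apply: ler_sum => k _; have [->|k0] := eqVneq k 0.
    by rewrite expr0n mul0r mulr_ge0// invr_ge0 sqr_ge0.
  have k1 := int_ge1 k0; have s0 := fcoef_sq_ge0 f k.
  rewrite ler_pdivlMr; last by lra.
  have -> : k%:~R ^+ 6 * fcoef_sq f k * k%:~R ^+ 2 = k%:~R ^+ 8 * fcoef_sq f k by ring.
  by have := h k; rewrite mulrDl mul1r; lra.
rewrite -mulr_sumr mulrC.
exact: ler_wpM2r (sum_zrange_invsqr M).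
Qed.

(** The threshold [eta] depends on the decay constants alone and not on the functions, so one choice
    serves all times and all nearby parameters. *)
Lemma decay8_small r K K' e : 0 <= r <= 3 -> 0 <= K -> 0 <= K' -> 0 < e ->
  exists2 eta : R, 0 < eta & forall f g, integrableI f -> integrableI g ->
    decay8 f K -> decay8 g K' -> (forall k, fcoef_sq (f \- g) k <= eta) ->
    forall N, sobps r (f \- g) N <= e.
Proof.
move=> /andP[r0 r3] K0 K'0 e0.
have C0 : 0 <= 32 * (K + K') by rewrite mulr_ge0// addr_ge0.
have [L [eta eta0 H]] := sum_small C0 e0.
(* An upper bound for the weights of the modes [|k| <= L], as [r <= 3], doubled because a term of
   the Sobolev sum carries both [k] and [- k]. *)
pose w : R := 2 * (1 + L%:R ^+ 2) ^+ 3.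
have L0 : 0 < 1 + L%:R ^+ 2 :> R by rewrite ltr_wpDr// sqr_ge0.
have w0 : 0 < w by rewrite /w mulr_gt0// exprn_gt0.
exists (eta / w); first by rewrite divr_gt0.
move=> f g If Ig df dg small N; apply: H => [n|n n0|n nL].
- exact: sob_term_ge0.
- apply: (le_trans (sob_term_lin _ _ (fun k => fcoef_sqB_le k If Ig))).
  have h1 := decay8_term df r3 n0; have h2 := decay8_term dg r3 n0.
  have -> : 32 * (K + K') / n%:R ^+ 2 = 2 * (16 * K / n%:R ^+ 2) + 2 * (16 * K' / n%:R ^+ 2) by ring.
  by apply: lerD; rewrite ler_wpM2l.
have one (k : int) : (`|k| <= L)%N -> sob_weight r k * fcoef_sq (f \- g) k <= eta / 2.
  move=> kL; apply: (@le_trans _ _ ((1 + L%:R ^+ 2) ^+ 3 * (eta / w))).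
    apply: ler_pM; rewrite ?sob_weight_ge0 ?fcoef_sq_ge0 ?small//.
    apply: (le_trans (sob_weight_mono k r3)); rewrite (sob_weight_nat 3).
    rewrite lerXn2r ?nnegrE ?(ltW L0) ?addr_ge0 ?sqr_ge0// lerD2l.
    by rewrite -[leLHS]real_normK ?num_real// lerXn2r ?nnegrE// -intr_norm -natr_absz ler_nat.
  rewrite /w le_eqVlt; apply/orP; left; apply/eqP.
  have : (1 + L%:R ^+ 2) ^+ 3 != 0 :> R by rewrite gt_eqF// exprn_gt0.
  by move: ((1 + L%:R ^+ 2) ^+ 3) => y y0; field.
case: n nL => [|n] nL /=; first by have := one 0 isT; lra.
have h1 := one n.+1%:Z nL; have h2 := one (- n.+1%:Z) nL.
by rewrite [leRHS](_ : eta = eta / 2 + eta / 2); [exact: lerD|field].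
Qed.

End Decay.

(** * The continuity argument in time *)

Section Approximation.
Context {R : realType}.
Variables (alpha eps0 T A Kv E0 : R) (u0 : R -> R) (v : R -> R -> R).
Hypotheses (ha : 1 <= alpha <= 2) (T0 : 0 <= T)
  (I0 : integrableI u0) (f0 : (sob_sum (1 + alpha) u0 < +oo)%E)
  (hE0 : forall M, \sum_(k <- zrange M) (1 + k%:~R ^+ 8) * fcoef_sq u0 k <= E0)
  (mv : modesol alpha eps0 T v) (wv : wiener_bound T v A)
  (dv : forall t, t \in `[0, T] -> decay8 (v t) Kv)
  (iv : forall k, fcoef_re u0 k = fcoef_re (v 0) k /\ fcoef_im u0 k = fcoef_im (v 0) k).

Let ha1 : 1 <= alpha. Proof. by case/andP: ha. Qed.
Let s03 : 0 <= 1 + alpha <= 3. Proof. by case/andP: ha => h1 h2; apply/andP; split; lra. Qed.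
Let t0T : 0 \in `[0, T]. Proof. by rewrite in_itv/= lexx T0. Qed.
Let A0 : 0 <= A.
Proof. by have [a0 _ _] := wv t0T; apply: le_trans a0; exact: amp_ge0. Qed.
Let Kv0 : 0 <= Kv. Proof. exact: decay8_ge0 (dv t0T). Qed.
Let E00 : 0 <= E0.
Proof.
apply: le_trans (hE0 0%N); rewrite sum_zrange0 mulr_ge0 ?fcoef_sq_ge0//.
Qed.

(** The assumed bound is chosen against the improved one: closeness to [v] yields
    [2 * (33 * Kv) + 2], and [fkdv_local_bound] turns a bound [X] into [2 * X + 2] at neighbouring
    times. So [boot] is exactly what propagates. *)
Definition boot : R := 2 * (2 * (33 * Kv) + 2) + 2.
(** [boot + 3] is the Wiener bound that [boot] entails for [u]; adding [A] makes the same constant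
    valid for [v]. *)
Definition boot_wiener : R := boot + 3 + A.
Definition boot_decay : R := E0 * expR (6 * symc * boot_wiener * T).

Let boot0 : 0 <= boot. Proof. by rewrite !addr_ge0// !mulr_ge0// addr_ge0// !mulr_ge0. Qed.
Let bw0 : 0 <= boot_wiener.
Proof. by apply: addr_ge0; [apply: addr_ge0; [exact: boot0|exact: ler0n]|exact: A0]. Qed.
Let bd0 : 0 <= boot_decay. Proof. by apply: mulr_ge0; [exact: E00|exact: expR_ge0]. Qed.

Lemma boot_wiener_bound S (u : R -> R -> R) :
  (forall t, t \in `[0, S] -> forall N, sobps (1 + alpha) (u t) N <= boot) ->
  wiener_bound S u boot_wiener.
Proof.
move=> h t tS.
have [|h1 h2 h3] := @sobolev_wiener R (u t) boot.
  move=> N; apply: le_trans (h t tS N); apply: sobps_monor.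
  by move: ha1; lra.
have le : boot + 3 <= boot_wiener by rewrite lerDl.
by split=> *; apply: le_trans le.
Qed.

Lemma wiener_bound_le S (u : R -> R -> R) (C D : R) : C <= D -> wiener_bound S u C -> wiener_bound S u D.
Proof. by move=> CD h t tS; have [h1 h2 h3] := h t tS; split=> *; apply: le_trans CD. Qed.

(** While the partial sums of [u] stay below [boot], persistence gives a decay of [u] independent of
    [eps], and [mode_difference] makes [u - v] small mode by mode. Together these put [u] within
    distance 1 of [v], which improves the bound and lets it extend in time. *)
Theorem approximation e : 0 < e -> exists2 d : R, 0 < d &
  forall eps (u w : R -> R -> R), `|eps ^+ 2 - eps0 ^+ 2| < d -> fkdv_sol alpha eps u0 T u w ->
  forall t, t \in `[0, T] -> [/\ forall N, sobps (1 + alpha) (u t) N <= boot,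
    decay8 (u t) boot_decay & forall k, fcoef_sq (u t \- v t) k <= e].
Proof.
move=> e0.
have [eta eta0 heta] := decay8_small s03 bd0 Kv0 (@ltr01 R).
(* The estimate of [mode_difference] per unit of [|eps^2 - eps0^2|], with [V = 4 * Kv]; requiring
   that quantity to be below 1 frees the exponent from [eps]. *)
pose Q := 4 * Kv * T * expR ((12 * boot_wiener + 1) * T).
have Q0 : 0 <= Q by rewrite !mulr_ge0 ?expR_ge0.
pose m := Num.min e eta.
have m0 : 0 < m by rewrite lt_min e0.
exists (Num.min 1 (m / (Q + 1))).
  by rewrite lt_min ltr01 divr_gt0//; move: Q0; lra.
move=> eps u w; rewrite lt_min => /andP[dl1 dlm] sol.
set dl := `|eps ^+ 2 - eps0 ^+ 2| in dl1 dlm.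
have dl0 : 0 <= dl by exact: normr_ge0.
have mu := fkdv_modesol ha1 sol.
have init k := fkdv_init ha1 sol k T0 I0 f0.
have Iu t : t \in `[0, T] -> integrableI (u t) by move=> tT; exact: (fkdv_integrable sol tT).
have Iv t : t \in `[0, T] -> integrableI (v t) by case: mv => + _; exact.
have sq0 k : fcoef_sq (u 0) k = fcoef_sq u0 k.
  by rewrite /fcoef_sq; have [-> ->] := init k.
have improve t : t \in `[0, T] ->
    (forall s, s \in `[0, t] -> forall N, sobps (1 + alpha) (u s) N <= boot) ->
    [/\ decay8 (u t) boot_decay, forall k, fcoef_sq (u t \- v t) k <= m &
        forall N, sobps (1 + alpha) (u t) N <= 2 * (33 * Kv) + 2].
  move=> tT hb; have t0 : 0 <= t by move: tT; rewrite in_itv/= => /andP[].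
  have tT' : t <= T by move: tT; rewrite in_itv/= => /andP[].
  have wu := boot_wiener_bound hb.
  have wv' : wiener_bound t v boot_wiener.
    apply: (@wiener_bound_le _ _ A); last exact: wiener_boundW tT' wv.
    by rewrite /boot_wiener lerDr addr_ge0.
  have mut := modesolW tT' mu; have mvt := modesolW tT' mv.
  have du : decay8 (u t) boot_decay.
    move=> k; have hE M : \sum_(k <- zrange M) (1 + k%:~R ^+ 8) * fcoef_sq (u 0) k <= E0.
      by apply: le_trans (hE0 M); apply: ler_sum => j _; rewrite sq0.
    apply: (le_trans (persistence t0 mut wu hE k)).
    rewrite ler_wpM2l// ler_expR ler_wpM2l//.
    by apply: mulr_ge0 => //; apply: mulr_ge0; [exact: ler0n|exact: symc_ge0].
  have diff k : fcoef_sq (u t \- v t) k <= m.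
    rewrite /fcoef_sq fcoef_reB ?fcoef_imB; [|by [exact: Iu|exact: Iv]..].
    have init' j : fcoef_re (u 0) j = fcoef_re (v 0) j /\ fcoef_im (u 0) j = fcoef_im (v 0) j.
      by have [-> ->] := init j; exact: iv.
    have hV s : s \in `[0, t] -> forall M, \sum_(k <- zrange M) k%:~R ^+ 6 * fcoef_sq (v s) k <= 4 * Kv.
      by move=> st M; apply: decay8_sum6; apply: dv; exact: sub_itv0 tT' st.
    apply: (le_trans (mode_difference ha t0 mut mvt wu wv' hV init' k)).
    rewrite -/dl; apply: (@le_trans _ _ (dl * Q)).
      rewrite /Q -!mulrA ler_wpM2l// !mulrA; apply: ler_pM; rewrite ?mulr_ge0 ?expR_ge0//.
        by rewrite ler_wpM2l// mulr_ge0.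
      rewrite ler_expR; apply: ler_pM => //.
        by rewrite addr_ge0// mulr_ge0.
      by rewrite lerD2l ltW.
    move: dlm; rewrite ltr_pdivlMr; last by move: Q0; lra.
    by move=> h; apply: ltW; apply: le_lt_trans h; rewrite ler_wpM2l// lerDl.
  split=> // N.
  have sm : sobps (1 + alpha) (u t \- v t) N <= 1.
    apply: heta; [exact: Iu|exact: Iv|exact: du|exact: dv|].
    by move=> k; apply: (le_trans (diff k)); rewrite /m ge_min lexx orbT.
  apply: (le_trans (sobpsDB_le _ _ (Iv t tT) (Iu t tT))).
  have vs : sobps (1 + alpha) (v t) N <= 33 * Kv.
    by apply: decay8_sobps; [exact: dv|case/andP: s03].
  by move: sm vs; lra.
have all : forall t, t \in `[0, T] -> forall N, sobps (1 + alpha) (u t) N <= boot.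
  pose P t := forall N, sobps (1 + alpha) (u t) N <= boot.
  apply: (@real_induction R T P) => //.
    move=> N; have -> : sobps (1 + alpha) (u 0) N = sobps (1 + alpha) (v 0) N.
      apply: eq_bigr => -[|n] _ /=; rewrite /fcoef_sq; repeat
        match goal with |- context[fcoef_re (u 0) ?j] => 
          have [-> ->] := init j; have [-> ->] := iv j end; by [].
    apply: (@le_trans _ _ (33 * Kv)); last by rewrite /boot; move: Kv0; lra.
    by apply: decay8_sobps; [exact: dv|case/andP: s03].
  move=> t tT; have [d d0 hd] := fkdv_local_bound sol tT.
  exists d => // r r' rT r'T rd r'd hb N.
  apply: (le_trans (hd r r' rT r'T rd r'd N)); rewrite /boot lerD2r ler_wpM2l//.
  by have [_ _] := improve r rT hb; exact.
move=> t tT.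
have hb s : s \in `[0, t] -> forall N, sobps (1 + alpha) (u s) N <= boot.
  move=> st; apply: all; apply: sub_itv0 st; by move: tT; rewrite in_itv/= => /andP[].
have [h1 h2 _] := improve t tT hb; split => //; first exact: all.
by move=> k; apply: (le_trans (h2 k)); rewrite /m ge_min lexx.
Qed.

End Approximation.

(** * Convergence of the time derivatives in [L^2] *)

Section TimeDerivative.
Context {R : realType}.
Implicit Types (f g : R -> R) (k : int) (A K : R).

Definition wiener1 f A := [/\ amp f 0 <= A, forall k, k%:~R ^+ 2 * amp f k <= A &
  forall M, \sum_(k <- zrange M) `|k%:~R| * amp f k <= A].

Lemma wiener1_ge0 f A : wiener1 f A -> 0 <= A.
Proof. by case=> h _ _; apply: le_trans h; exact: amp_ge0. Qed.

Lemma wiener1_amp f A k : wiener1 f A -> amp f k <= A.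
Proof.
case=> h0 h2 _; have [->//|k0] := eqVneq k 0.
by apply: le_trans (h2 k); rewrite ler_peMl ?amp_ge0// int_ge1.
Qed.

Lemma wiener1_sum f A M : wiener1 f A -> \sum_(k <- zrange M) amp f k <= 2 * A.
Proof.
case=> h0 h2 h1.
apply: (@le_trans _ _ (\sum_(k <- zrange M) ((k == 0)%:R * amp f 0 + `|k%:~R| * amp f k))).
  apply: ler_sum => k _; have [->|k0] := eqVneq k 0.
    by rewrite mul1r normr0 mul0r addr0.
  rewrite mul0r add0r ler_peMl ?amp_ge0//.
  by rewrite -intr_norm -[1]/(1%:~R) ler_int; lia.
rewrite big_split/= (sum_zrange_delta (fun=> amp f 0)) mem_zrange/= mul1r.
by have := h1 M; lra.
Qed.

(** Young's inequality for a bounded sequence convolved with a summable one. *)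
Lemma conv_pair_bound M k (p q : int -> R) (P : R) :
  (forall l, 0 <= p l <= P) -> (forall l, 0 <= q l) ->
  \sum_(l <- zrange M) \sum_(m <- zrange M) (l + m == k)%:R * (p l * q m) <=
  P * \sum_(m <- zrange M) q m.
Proof.
move=> hp q0; rewrite exchange_big/= mulr_sumr; apply: ler_sum => m _.
under eq_bigr => l _.
  rewrite (_ : (l + m == k) = (l == k - m)); last by apply/eqP/eqP; lia.
  over.
rewrite (sum_zrange_delta (fun l => p l * q m)).
have /andP[p0 pP] := hp (k - m).
have h : p (k - m) * q m <= P * q m by rewrite ler_wpM2r.
case: (_ \in _); rewrite ?mul1r// mul0r mulr_ge0//.
exact: le_trans pP.
Qed.

Lemma norm_sum2_le M k (F G : int -> int -> R) :
  (forall l m, l + m = k -> `|F l m| <= G l m) ->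
  `|\sum_(l <- zrange M) \sum_(m <- zrange M) (l + m == k)%:R * F l m| <=
  \sum_(l <- zrange M) \sum_(m <- zrange M) (l + m == k)%:R * G l m.
Proof.
move=> FG; apply: (le_trans (ler_norm_sum _ _ _)); apply: ler_sum => l _.
apply: (le_trans (ler_norm_sum _ _ _)); apply: ler_sum => m _.
by rewrite normrM normr_nat; case: eqP => [/FG h|_]; rewrite ?mul1r ?mul0r.
Qed.

Lemma decay8_amp f K k : decay8 f K -> amp f k <= K + 1 /\ k%:~R ^+ 4 * amp f k <= K + 1.
Proof.
move=> h; have K0 := decay8_ge0 h.
have sq1 (x : R) : 0 <= x -> x ^+ 2 <= K -> x <= K + 1.
  move=> x0 xK; have := sqr_ge0 (x - 1).
  have -> : (x - 1) ^+ 2 = x ^+ 2 + 1 - 2 * x by ring.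
  lra.
have s0 := fcoef_sq_ge0 f k.
have k8 : 0 <= k%:~R ^+ 8 * fcoef_sq f k.
  by apply: mulr_ge0 => //; rewrite expr8_sqr4 exprn_ge0// sqr_ge0.
have k4 : 0 <= k%:~R ^+ 4 :> R by rewrite -[4%N]/(2 * 2)%N exprM sqr_ge0.
have hk := h k; rewrite mulrDl mul1r in hk.
split; apply: sq1; rewrite ?amp_ge0 ?sqr_amp//; first by lra.
  by apply: mulr_ge0 => //; exact: amp_ge0.
by rewrite exprMn -exprM sqr_amp; lra.
Qed.

Lemma norm_cmul_le (x y z t n1 n2 : R) :
  `|x| <= n1 -> `|y| <= n1 -> `|z| <= n2 -> `|t| <= n2 ->
  `|x * z - y * t| <= 2 * (n1 * n2) /\ `|x * t + y * z| <= 2 * (n1 * n2).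
Proof.
move=> h1 h2 h3 h4.
have e1 : `|x| * `|z| <= n1 * n2 by apply: ler_pM.
have e2 : `|y| * `|t| <= n1 * n2 by apply: ler_pM.
have e3 : `|x| * `|t| <= n1 * n2 by apply: ler_pM.
have e4 : `|y| * `|z| <= n1 * n2 by apply: ler_pM.
split; [apply: (le_trans (ler_normB _ _))|apply: (le_trans (ler_normD _ _))];
  by rewrite !normrM; lra.
Qed.

(** On [l + m = k] one has [k^2 <= 2 l^2 + 2 m^2], so the weight passes to one factor, whose
    weighted modes are summable by decay, while the other stays bounded. *)
Lemma fcoef_sqr_decay f A K k : integrableI f -> wiener1 f A -> decay8 f K ->
  k%:~R ^+ 2 * `|fcoef_re (fun x => f x ^+ 2) k| <= 32 * (K + 1) ^+ 2 /\
  k%:~R ^+ 2 * `|fcoef_im (fun x => f x ^+ 2) k| <= 32 * (K + 1) ^+ 2.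
Proof.
move=> If wf df; have K0 := decay8_ge0 df; have A0 := wiener1_ge0 wf.
have [a0 a2 _] := wf.
set a := fcoef_re f; set b := fcoef_im f.
have k20 : 0 <= k%:~R ^+ 2 :> R by rewrite sqr_ge0.
have p0 l : 0 <= amp f l <= K + 1.
  by rewrite amp_ge0/=; have [] := decay8_amp l df.
have q0 l : 0 <= l%:~R ^+ 2 * amp f l by rewrite mulr_ge0 ?amp_ge0 ?sqr_ge0.
have S M : \sum_(m <- zrange M) m%:~R ^+ 2 * amp f m <= 4 * (K + 1).
  apply: (@le_trans _ _ (\sum_(m <- zrange M) (K + 1) * (m%:~R ^+ 2)^-1)).
    apply: ler_sum => m _; have [->|m0] := eqVneq m 0.
      by rewrite expr0n mul0r mulr_ge0 ?addr_ge0// invr_ge0 sqr_ge0.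
    have m1 := @int_ge1 R m m0; rewrite ler_pdivlMr; last by lra.
    have [_] := decay8_amp m df.
    by have -> : m%:~R ^+ 2 * amp f m * m%:~R ^+ 2 = m%:~R ^+ 4 * amp f m by ring.
  rewrite -mulr_sumr mulrC; apply: ler_wpM2r; first by rewrite addr_ge0.
  exact: sum_zrange_invsqr.
have bound M : k%:~R ^+ 2 * (\sum_(l <- zrange M) \sum_(m <- zrange M) (l + m == k)%:R *
    (2 * (amp f l * amp f m))) <= 32 * (K + 1) ^+ 2.
  have step : k%:~R ^+ 2 * (\sum_(l <- zrange M) \sum_(m <- zrange M) (l + m == k)%:R *
      (2 * (amp f l * amp f m))) <=
    4 * (\sum_(l <- zrange M) \sum_(m <- zrange M) (l + m == k)%:R * (amp f l * (m%:~R ^+ 2 * amp f m)))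
    + 4 * (\sum_(l <- zrange M) \sum_(m <- zrange M) (l + m == k)%:R * (amp f m * (l%:~R ^+ 2 * amp f l))).
    rewrite !mulr_sumr -big_split/=; apply: ler_sum => l _.
    rewrite !mulr_sumr -big_split/=; apply: ler_sum => m _.
    case: eqP => [lm|_]; last by rewrite !mul0r !mulr0 addr0.
    rewrite !mul1r -lm intrD.
    have amp2 : 0 <= amp f l * amp f m by rewrite mulr_ge0 ?amp_ge0.
    have : 0 <= 2 * (amp f l * amp f m) * (l%:~R - m%:~R) ^+ 2.
      by rewrite mulr_ge0 ?sqr_ge0// mulr_ge0.
    have -> : 2 * (amp f l * amp f m) * (l%:~R - m%:~R) ^+ 2 =
      4 * (amp f l * (m%:~R ^+ 2 * amp f m)) + 4 * (amp f m * (l%:~R ^+ 2 * amp f l))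
      - (l%:~R + m%:~R) ^+ 2 * (2 * (amp f l * amp f m)) by ring.
    by rewrite subr_ge0.
  have b1 := @conv_pair_bound M k _ _ _ p0 q0.
  have b2 : \sum_(l <- zrange M) \sum_(m <- zrange M) (l + m == k)%:R * (amp f m * (l%:~R ^+ 2 * amp f l)) =
    \sum_(l <- zrange M) \sum_(m <- zrange M) (l + m == k)%:R * (amp f l * (m%:~R ^+ 2 * amp f m)).
    by rewrite conv_sumC.
  have b3 : (K + 1) * \sum_(m <- zrange M) m%:~R ^+ 2 * amp f m <= (K + 1) * (4 * (K + 1)).
    by rewrite ler_wpM2l ?addr_ge0.
  rewrite b2 in step; apply: (le_trans step).
  have -> : 32 * (K + 1) ^+ 2 = 8 * ((K + 1) * (4 * (K + 1))) by ring.
  by move: b1 b3; set s := \sum_(_ <- _) _; set s' := _ * \sum_(_ <- _) _ => b1 b3; lra.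
pose C := k%:~R ^+ 2 * (8 * A * (amp f 0 + 8 * A)).
have fin M (p c : R) : `|p - c| <= 8 * A * (amp f 0 + 8 * A) / M%:R ->
    `|c| <= \sum_(l <- zrange M) \sum_(m <- zrange M) (l + m == k)%:R *
      (2 * (amp f l * amp f m)) -> k%:~R ^+ 2 * `|p| <= 32 * (K + 1) ^+ 2 + C / M%:R.
  move=> h h2; have h3 := le_trans (ler_wpM2l k20 h2) (bound M).
  have -> : C / M%:R = k%:~R ^+ 2 * (8 * A * (amp f 0 + 8 * A) / M%:R) by rewrite /C; ring.
  apply: le_trans (lerD h3 (ler_wpM2l k20 h)); rewrite -mulrDr ler_wpM2l//.
  by rewrite -[X in `|X| <= _](subrKC c) ler_normD.
split; apply: (@le_archi _ _ _ C); exists 0%N => M _ M0;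
  have [h1 h2] := fcoef_sqr_conv If a2 k M0; [apply: fin h1 _|apply: fin h2 _];
  apply: norm_sum2_le => l m _;
  by have [] := norm_cmul_le (norm_fcoef_re_amp f l) (norm_fcoef_im_amp f l)
    (norm_fcoef_re_amp f m) (norm_fcoef_im_amp f m).
Qed.

(** A bound on each mode of [f - g] is enough: the convolution pairs it with the modes of [f + g],
    which are summable by the Wiener bound. *)
Lemma fcoef_sqr_diff f g A (kap : R) k : integrableI f -> integrableI g ->
  wiener1 f A -> wiener1 g A ->
  (forall l, `|fcoef_re f l - fcoef_re g l| <= kap) ->
  (forall l, `|fcoef_im f l - fcoef_im g l| <= kap) ->
  `|fcoef_re (fun x => f x ^+ 2) k - fcoef_re (fun x => g x ^+ 2) k| <= 8 * A * kap /\
  `|fcoef_im (fun x => f x ^+ 2) k - fcoef_im (fun x => g x ^+ 2) k| <= 8 * A * kap.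
Proof.
move=> If Ig wf wg hx hy.
have kap0 : 0 <= kap by apply: le_trans (hx 0).
have A0 := wiener1_ge0 wf.
have [_ f2 _] := wf; have [_ g2 _] := wg.
pose q m := 2 * (amp f m + amp g m).
have q0 m : 0 <= q m by rewrite mulr_ge0 ?addr_ge0 ?amp_ge0.
have cb M : \sum_(l <- zrange M) \sum_(m <- zrange M) (l + m == k)%:R * (kap * q m) <= 8 * A * kap.
  apply: (le_trans (@conv_pair_bound M k (fun=> kap) q kap _ q0)); first by move=> l; rewrite kap0/=.
  rewrite mulrC ler_wpM2r// /q -mulr_sumr big_split/=.
  by have := wiener1_sum M wf; have := wiener1_sum M wg; lra.
have cm m : `|fcoef_re f m + fcoef_re g m| <= amp f m + amp g m.
  by apply: (le_trans (ler_normD _ _)); apply: lerD; exact: norm_fcoef_re_amp.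
have dm m : `|fcoef_im f m + fcoef_im g m| <= amp f m + amp g m.
  by apply: (le_trans (ler_normD _ _)); apply: lerD; exact: norm_fcoef_im_amp.
pose C := 8 * A * (amp f 0 + 8 * A) + 8 * A * (amp g 0 + 8 * A).
have fin M (p1 p2 c1 c2 : R) : `|p1 - c1| <= 8 * A * (amp f 0 + 8 * A) / M%:R ->
    `|p2 - c2| <= 8 * A * (amp g 0 + 8 * A) / M%:R -> `|c1 - c2| <= 8 * A * kap ->
    `|p1 - p2| <= 8 * A * kap + C / M%:R.
  move=> hf hg h; have -> : p1 - p2 = (c1 - c2) + ((p1 - c1) - (p2 - c2)) by ring.
  apply: (le_trans (ler_normD _ _)); apply: lerD => //.
  by apply: (le_trans (ler_normB _ _)); rewrite /C mulrDl; exact: lerD.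
split; apply: (@le_archi _ _ _ C); exists 0%N => M _ M0;
  have [f1 f3] := fcoef_sqr_conv If f2 k M0; have [g1 g3] := fcoef_sqr_conv Ig g2 k M0;
  [apply: (fin _ _ _ _ _ f1 g1); rewrite conv_diff_re
  |apply: (fin _ _ _ _ _ f3 g3); rewrite conv_diff_im];
  apply: le_trans (cb M); apply: norm_sum2_le => l m _;
  by rewrite mulrCA; have [] := norm_cmul_le (hx l) (hy l) (cm m) (dm m).
Qed.

Definition mode_eq (alpha eps : R) f w := forall k,
  fcoef_re w k = 3 * k%:~R * fcoef_im (fun x => f x ^+ 2) k
    - dispersion alpha eps k * fcoef_im f k /\
  fcoef_im w k = - (3 * k%:~R * fcoef_re (fun x => f x ^+ 2) k)
    + dispersion alpha eps k * fcoef_re f k.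

(** The dispersion costs at most three powers of [|k|] and the modes of [f] decay like [|k|^-4]. The
    remaining [|k|^-1] is square summable. *)
Lemma mode_eq_decay alpha eps (E : R) f w A K k : 1 <= alpha <= 2 -> eps ^+ 2 <= E ->
  integrableI f -> wiener1 f A -> decay8 f K -> mode_eq alpha eps f w ->
  k%:~R ^+ 2 * fcoef_sq w k <= 2 * (96 * (K + 1) ^+ 2 + E * (K + 1)) ^+ 2.
Proof.
move=> ha eE If wf df hw; have K0 := decay8_ge0 df; have [w1 w2] := hw k.
set D := 96 * (K + 1) ^+ 2 + E * (K + 1).
have E0 : 0 <= E by apply: le_trans eE; exact: sqr_ge0.
have [c1 c2] := fcoef_sqr_decay k If wf df; have [_ a4] := decay8_amp k df.
have dk := norm_dispersion_le eps k ha.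
have kk : `|k%:~R| * `|k%:~R| = k%:~R ^+ 2 :> R by rewrite -expr2 real_normK ?num_real.
have disp (z : R) : `|z| <= amp f k -> `|k%:~R| * `|dispersion alpha eps k * z| <= E * (K + 1).
  move=> za; rewrite normrM.
  apply: (@le_trans _ _ (`|k%:~R| * (eps ^+ 2 * `|k%:~R| ^+ 3 * amp f k))).
    by rewrite ler_wpM2l//; apply: ler_pM.
  have -> : `|k%:~R| * (eps ^+ 2 * `|k%:~R| ^+ 3 * amp f k) = eps ^+ 2 * ((`|k%:~R| ^+ 2) ^+ 2 * amp f k) by ring.
  rewrite real_normK ?num_real// -exprM.
  apply: ler_pM => //; first exact: sqr_ge0.
  by rewrite mulr_ge0 ?amp_ge0// -[(2 * 2)%N]/(2 * 2)%N exprM sqr_ge0.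
have nl (z : R) : k%:~R ^+ 2 * `|z| <= 32 * (K + 1) ^+ 2 -> `|k%:~R| * `|3 * k%:~R * z| <= 96 * (K + 1) ^+ 2.
  move=> hz; rewrite !normrM (ger0_norm (ler0n _ 3)).
  have -> : `|k%:~R| * (3 * `|k%:~R| * `|z|) = 3 * ((`|k%:~R| * `|k%:~R|) * `|z|) by ring.
  by rewrite kk; lra.
have h1 : `|k%:~R| * `|fcoef_re w k| <= D.
  rewrite w1; apply: (@le_trans _ _ (`|k%:~R| * (`|3 * k%:~R * fcoef_im (fun x => f x ^+ 2) k| + `|dispersion alpha eps k * fcoef_im f k|))).
    by rewrite ler_wpM2l// ler_normB.
  by rewrite mulrDr; apply: lerD; [exact: nl|apply: disp; exact: norm_fcoef_im_amp].
have h2 : `|k%:~R| * `|fcoef_im w k| <= D.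
  rewrite w2; apply: (@le_trans _ _ (`|k%:~R| * (`|3 * k%:~R * fcoef_re (fun x => f x ^+ 2) k| + `|dispersion alpha eps k * fcoef_re f k|))).
    by rewrite ler_wpM2l//; apply: (le_trans (ler_normD _ _)); rewrite normrN.
  by rewrite mulrDr; apply: lerD; [exact: nl|apply: disp; exact: norm_fcoef_re_amp].
have sq (z : R) : `|k%:~R| * `|z| <= D -> k%:~R ^+ 2 * z ^+ 2 <= D ^+ 2.
  move=> hz; rewrite -exprMn -[leLHS]real_normK ?num_real// normrM lerXn2r ?nnegrE ?mulr_ge0//.
  by apply: le_trans hz; rewrite mulr_ge0.
rewrite /fcoef_sq mulrDr; have := sq _ h1; have := sq _ h2; lra.
Qed.

(** The dispersion is unbounded, so closeness of [f] and [g] is used on the modes up to [L] only;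
    above [L] the decay of each time derivative takes over. *)
Lemma dt_small alpha eps0 A K (e : R) : 1 <= alpha <= 2 -> 0 < e ->
  exists2 eta : R, 0 < eta & forall eps f g wf wg,
    `|eps ^+ 2 - eps0 ^+ 2| <= eta ->
    integrableI f -> integrableI g -> integrableI wf -> integrableI wg ->
    wiener1 f A -> wiener1 g A -> decay8 f K -> decay8 g K ->
    (forall k, fcoef_sq (f \- g) k <= eta ^+ 2) ->
    mode_eq alpha eps f wf -> mode_eq alpha eps0 g wg ->
    forall N, sobps 0 (wf \- wg) N <= e.
Proof.
move=> ha e0; pose E := eps0 ^+ 2 + 1.
pose D := 96 * (K + 1) ^+ 2 + E * (K + 1).
have C0 : 0 <= 16 * D ^+ 2 by rewrite mulr_ge0// sqr_ge0.
have [L [eta1 eta10 HS]] := sum_small C0 e0.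
(* On [|k| <= L] the difference of time-derivative modes is at most [eta * H]: the summands come
   from the nonlinearity, from the dispersion of [f - g], and from the change of coefficient acting
   on [g]. *)
pose H := 24 * L%:R * A + E * L%:R ^+ 3 + L%:R ^+ 3 * A.
have H1 : 0 < 4 * H ^+ 2 + 1 by have := sqr_ge0 H; lra.
(* As [eta <= 1], [(eta * H)^2 <= eta * H^2 <= eta1 / 4]. The 4 accounts for the real and imaginary
   parts at both [k] and [- k]. *)
pose eta := Num.min 1 (eta1 / (4 * H ^+ 2 + 1)).
have eta0 : 0 < eta by rewrite lt_min ltr01 divr_gt0.
exists eta => // eps f g wf wg hd If Ig Iwf Iwg wnf wng df dg small mf mg N.
have etale1 : eta <= 1 by rewrite /eta ge_min lexx.
have A0 := wiener1_ge0 wnf.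
have eE : eps ^+ 2 <= E.
  move: hd; rewrite ler_norml => /andP[_ h]; rewrite /E; lra.
have e0E : eps0 ^+ 2 <= E by rewrite /E lerDl.
have E0 : 0 <= E by apply: le_trans eE; exact: sqr_ge0.
have xy l : `|fcoef_re f l - fcoef_re g l| <= eta /\ `|fcoef_im f l - fcoef_im g l| <= eta.
  have am : amp (f \- g) l <= eta.
    by rewrite -ler_sqr ?nnegrE ?amp_ge0 ?(ltW eta0)// sqr_amp.
  rewrite -fcoef_reB// -fcoef_imB//.
  by split; apply: le_trans am; [exact: norm_fcoef_re_amp|exact: norm_fcoef_im_amp].
have term0 (k : int) : sob_weight 0 k = 1 :> R by rewrite /sob_weight powRr0.
have W k : k != 0 -> fcoef_sq (wf \- wg) k <= 8 * D ^+ 2 / k%:~R ^+ 2.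
  move=> k0; have k1 := @int_ge1 R k k0.
  rewrite ler_pdivlMr; last by lra.
  have h1 := mode_eq_decay k ha eE If wnf df mf; have h2 := mode_eq_decay k ha e0E Ig wng dg mg.
  have k2 : 0 <= k%:~R ^+ 2 :> R by rewrite sqr_ge0.
  have := ler_wpM2l k2 (fcoef_sqB_le k Iwf Iwg).
  by move: h1 h2; rewrite -/D; lra.
have S k : (`|k| <= L)%N -> fcoef_sq (wf \- wg) k <= eta1 / 2.
  move=> kL; rewrite /fcoef_sq fcoef_reB// fcoef_imB//.
  have [w1 w2] := mf k; have [g1 g2] := mg k.
  have [d1 d2] := fcoef_sqr_diff k If Ig wnf wng (fun l => (xy l).1) (fun l => (xy l).2).
  have kL' : `|k%:~R| <= L%:R :> R by rewrite -intr_norm -natr_absz ler_nat.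
  have dk := norm_dispersion_le eps k ha; have dk1 := norm_dispersion_le 1 k ha.
  have k3 : `|k%:~R| ^+ 3 <= L%:R ^+ 3 :> R by rewrite lerXn2r ?nnegrE.
  have gk := wiener1_amp k wng.
  have L30 : 0 <= L%:R ^+ 3 :> R by rewrite exprn_ge0.
  have main (G0 x b : R) : `|G0| <= 8 * A * eta -> `|x| <= eta -> `|b| <= A ->
     `|3 * k%:~R * G0| + `|dispersion alpha eps k * x| + `|(eps ^+ 2 - eps0 ^+ 2) * dispersion alpha 1 k * b| <= eta * H.
    move=> hG hxx hb.
    have q1 : `|3 * k%:~R * G0| <= 3 * L%:R * (8 * A * eta).
      rewrite !normrM (ger0_norm (ler0n _ 3)); apply: ler_pM => //.
      by rewrite ler_wpM2l.
    have q2 : `|dispersion alpha eps k * x| <= E * L%:R ^+ 3 * eta.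
      rewrite normrM; apply: ler_pM => //; apply: (le_trans dk).
      by apply: ler_pM; rewrite ?sqr_ge0 ?exprn_ge0.
    have q3 : `|(eps ^+ 2 - eps0 ^+ 2) * dispersion alpha 1 k * b| <= eta * L%:R ^+ 3 * A.
      rewrite normrM; apply: ler_pM => //; rewrite normrM; apply: ler_pM => //.
      by apply: (le_trans dk1); rewrite expr1n mul1r.
    have -> : eta * H = 3 * L%:R * (8 * A * eta) + E * L%:R ^+ 3 * eta + eta * L%:R ^+ 3 * A by rewrite /H; ring.
    by apply: lerD => //; apply: lerD.
  have r1 : `|fcoef_re wf k - fcoef_re wg k| <= eta * H.
    have [_ x2] := xy k.
    apply: le_trans (main _ _ _ d2 x2 (le_trans (norm_fcoef_im_amp g k) gk)).
    rewrite w1 g1 (dispersionB alpha eps eps0).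
    set G1 := fcoef_im (fun x => f x ^+ 2) k; set G2 := fcoef_im (fun x => g x ^+ 2) k.
    set b1 := fcoef_im f k; set b2 := fcoef_im g k.
    rewrite [X in `|X| <= _](_ : _ = 3 * k%:~R * (G1 - G2)
      - (dispersion alpha eps0 k + (eps ^+ 2 - eps0 ^+ 2) * dispersion alpha 1 k) * (b1 - b2)
      - (eps ^+ 2 - eps0 ^+ 2) * dispersion alpha 1 k * b2); last by ring.
    by apply: (le_trans (ler_normB _ _)); rewrite lerD2r; exact: ler_normB.
  have r2 : `|fcoef_im wf k - fcoef_im wg k| <= eta * H.
    have [x1 _] := xy k.
    apply: le_trans (main _ _ _ d1 x1 (le_trans (norm_fcoef_re_amp g k) gk)).
    rewrite w2 g2 (dispersionB alpha eps eps0).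
    set F1 := fcoef_re (fun x => f x ^+ 2) k; set F2 := fcoef_re (fun x => g x ^+ 2) k.
    set a1 := fcoef_re f k; set a2 := fcoef_re g k.
    rewrite [X in `|X| <= _](_ : _ = - (3 * k%:~R * (F1 - F2))
      + (dispersion alpha eps0 k + (eps ^+ 2 - eps0 ^+ 2) * dispersion alpha 1 k) * (a1 - a2)
      + (eps ^+ 2 - eps0 ^+ 2) * dispersion alpha 1 k * a2); last by ring.
    apply: (le_trans (ler_normD _ _)); rewrite lerD2r.
    by apply: (le_trans (ler_normD _ _)); rewrite normrN.
  have sq (z : R) : `|z| <= eta * H -> z ^+ 2 <= eta1 / 4.
    move=> hz; rewrite -[leLHS]real_normK ?num_real//.
    apply: (@le_trans _ _ ((eta * H) ^+ 2)).
      by rewrite lerXn2r ?nnegrE//; apply: le_trans hz.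
    have : eta * (4 * H ^+ 2 + 1) <= eta1.
      by rewrite -ler_pdivlMr// /eta ge_min lexx orbT.
    have : eta ^+ 2 * H ^+ 2 <= eta * H ^+ 2.
      by rewrite ler_wpM2r ?sqr_ge0// expr2 ler_piMr// ltW.
    rewrite exprMn; move: eta0; lra.
  by have := sq _ r1; have := sq _ r2; lra.
apply: HS => [n|n n0|n nL].
- exact: sob_term_ge0.
- case: n n0 => // n _ /=; rewrite !term0 !mul1r.
  have h1 := W n.+1%:Z isT; have h2 := W (- n.+1%:Z) isT.
  rewrite intrN sqrrN in h2.
  rewrite (_ : 16 * D ^+ 2 / n.+1%:R ^+ 2 = 8 * D ^+ 2 / n.+1%:~R ^+ 2 + 8 * D ^+ 2 / n.+1%:~R ^+ 2); last by rewrite -pmulrn; ring.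
  exact: lerD.
- case: n nL => [|n] nL /=; rewrite !term0 !mul1r; first by have := S 0 isT; lra.
  have h1 := S n.+1%:Z nL; have h2 := S (- n.+1%:Z) nL.
  by rewrite [leRHS](_ : eta1 = eta1 / 2 + eta1 / 2); [exact: lerD|field].
Qed.

End TimeDerivative.

(** * Continuity in the parameter and the zero-dispersion limit *)

Section Assembly.
Context {R : realType}.

Lemma persistence_decay alpha eps T (u0 : R -> R) (v : R -> R -> R) A E0 : 0 <= T ->
  modesol alpha eps T v -> wiener_bound T v A ->
  (forall M, \sum_(k <- zrange M) (1 + k%:~R ^+ 8) * fcoef_sq u0 k <= E0) ->
  (forall k, fcoef_re u0 k = fcoef_re (v 0) k /\ fcoef_im u0 k = fcoef_im (v 0) k) ->
  forall t, t \in `[0, T] -> decay8 (v t) (E0 * expR (6 * symc * A * T)).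
Proof.
move=> T0 mv wv hE0 iv t tT k.
have t0T : 0 \in `[0, T] by rewrite in_itv/= lexx.
have A0 : 0 <= A by have [a0 _ _] := wv 0 t0T; apply: le_trans a0; exact: amp_ge0.
have E00 : 0 <= E0.
  by apply: le_trans (hE0 0%N); rewrite sum_zrange0 mulr_ge0 ?fcoef_sq_ge0.
move: tT; rewrite in_itv/= => /andP[t0 tT].
have hE M : \sum_(k <- zrange M) (1 + k%:~R ^+ 8) * fcoef_sq (v 0) k <= E0.
  apply: le_trans (hE0 M); apply: ler_sum => j _.
  by rewrite /fcoef_sq; have [-> ->] := iv j.
apply: (le_trans (persistence t0 (modesolW tT mv) (wiener_boundW tT wv) hE k)).
rewrite ler_wpM2l// ler_expR ler_wpM2l//.
by apply: mulr_ge0 => //; apply: mulr_ge0; [exact: ler0n|exact: symc_ge0].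
Qed.

(** For a reference solution the Wiener bound needs no comparison: its [H^(1+alpha)] sums are
    bounded by compactness of the time interval, and dominate the [H^2] sums as [alpha >= 1]. *)
Lemma fkdv_wiener alpha eps T (u0 : R -> R) (u w : R -> R -> R) : 1 <= alpha -> 0 <= T ->
  fkdv_sol alpha eps u0 T u w -> exists A, wiener_bound T u A.
Proof.
move=> ha T0 sol; have [K hK] := fkdv_bounded sol T0; exists (K + 3) => t tT.
apply: sobolev_wiener => N; apply: le_trans (hK t tT N); apply: sobps_monor; lra.
Qed.

Lemma fkdv_mode_eq alpha eps T (u0 : R -> R) (u w : R -> R -> R) t :
  fkdv_sol alpha eps u0 T u w -> t \in `[0, T] -> mode_eq alpha eps (u t) (w t).
Proof.
move=> [_ _ _ _ h] tT k; have [h1 h2] := h t tT k.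
by split; [move: h1|move: h2]; rewrite /dispersion; lra.
Qed.

Lemma Hnorm_lt r (f : R -> R) (e : R) : 0 < e ->
  (forall N, sobps r f N <= (e / 2) ^+ 2) -> Hnorm r f < e.
Proof.
move=> e0 h; apply: (le_lt_trans (Hnorm_le h)).
by rewrite sqrtr_sqr ger0_norm; lra.
Qed.

Lemma decay8_le (f : R -> R) (K K' : R) : K <= K' -> decay8 f K -> decay8 f K'.
Proof. by move=> KK' h k; apply: le_trans KK'. Qed.

End Assembly.

Theorem theorem4p1 (R : realType) (alpha : R) (u0 : R -> R) (Tc : R)
    (v : R -> R -> R) (u w : R -> R -> R -> R) :
  1 <= alpha <= 2 ->
  smooth u0 -> in_Hp (1 + alpha) u0 ->
  0 < Tc ->
  (* Tc < t_c = 1 / max_x (- 6 u0'(x))  (t_c = +oo if this max is <= 0) *)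
  (forall x, Tc * (- 6 * derive1 u0 x) < 1) ->
  burgers_sol u0 Tc v ->
  (forall eps, 0 < eps -> fkdv_sol alpha eps u0 Tc (u eps) (w eps)) ->
  (* continuity of eps |-> u(.,.;eps) into C([0,Tc];H^{1+alpha}_p) cap C^1([0,Tc];L^2_p) *)
  (forall eps0, 0 < eps0 -> forall e : R, 0 < e -> exists2 d : R, 0 < d &
     forall eps, 0 < eps -> `|eps - eps0| < d ->
       forall t, t \in `[0, Tc] ->
         Hnorm (1 + alpha) (u eps t \- u eps0 t) < e /\
         Hnorm 0 (w eps t \- w eps0 t) < e) /\
  (* ||u(t;eps) - v^b(t)||_{1+alpha} -> 0 as eps -> 0, uniformly in t in [0,Tc] *)
  (forall e : R, 0 < e -> exists2 d : R, 0 < d &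
     forall eps, 0 < eps < d ->
       forall t, t \in `[0, Tc] -> Hnorm (1 + alpha) (u eps t \- v t) < e).
Proof.
move=> ha su0 hu0 Tc0 hTc bsol sol.
have ha1 : 1 <= alpha by case/andP: ha.
have T0 := ltW Tc0.
have s03 : 0 <= 1 + alpha <= 3 by case/andP: ha => h1 h2; apply/andP; split; lra.
have I0 := in_Hp_integrable hu0.
have [pu0 _ _ f0] := hu0.
have [E0 hE0] := smooth_energy su0 pu0.
have t0T : 0 \in `[0, Tc] by rewrite in_itv/= lexx.
split.
- move=> eps0 eps00 e e0.
  have sol0 := sol eps0 eps00.
  have mv := fkdv_modesol ha1 sol0.
  have [A wv] := fkdv_wiener ha1 T0 sol0.
  have iv k : fcoef_re u0 k = fcoef_re (u eps0 0) k /\ fcoef_im u0 k = fcoef_im (u eps0 0) k.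
    by have [-> ->] := fkdv_init ha1 sol0 k T0 I0 f0.
  have dv := persistence_decay T0 mv wv hE0 iv.
  set Kv := E0 * _ in dv.
  have Kv0 := decay8_ge0 (dv 0 t0T).
  pose K := boot_decay Tc A Kv E0; pose B := boot_wiener A Kv.
  have sq0 : 0 < (e / 2) ^+ 2 by rewrite exprn_gt0//; lra.
  have A0 : 0 <= A by have [a0 _ _] := wv 0 t0T; apply: le_trans a0; exact: amp_ge0.
  have K0 : 0 <= K.
    apply: mulr_ge0; last exact: expR_ge0.
    by apply: le_trans (hE0 0%N); rewrite sum_zrange0 mulr_ge0 ?fcoef_sq_ge0.
  have [eta1 eta10 h1] := decay8_small s03 K0 Kv0 sq0.
  (* One decay constant must hold for both solutions, hence the maximum. *)
  have [eta2 eta20 h2] := @dt_small R alpha eps0 B (Num.max K Kv) _ ha sq0.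
  have m0 : 0 < Num.min eta1 (eta2 ^+ 2) by rewrite lt_min eta10 exprn_gt0.
  have [d d0 hd] := approximation ha T0 I0 f0 hE0 mv wv dv iv m0.
  pose d1 := Num.min d eta2.
  have d10 : 0 < d1 by rewrite lt_min d0.
  have c0 : 0 < 2 * eps0 + 1 by lra.
  (* With [|eps - eps0| < 1], the factor [eps + eps0] of [eps^2 - eps0^2] is at most
     [2 * eps0 + 1]. *)
  exists (Num.min 1 (d1 / (2 * eps0 + 1))); first by rewrite lt_min ltr01 divr_gt0.
  move=> eps ep; rewrite lt_min => /andP[e1 e2] t tT.
  have sole := sol eps ep.
  have dd : `|eps ^+ 2 - eps0 ^+ 2| < d1.
    rewrite subr_sqr normrM; move: e2; rewrite ltr_pdivlMr// => e2.
    apply: le_lt_trans e2; rewrite ler_wpM2l// ger0_norm ?addr_ge0 ?ltW//.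
    by move: e1; rewrite ltr_norml => /andP[_]; lra.
  move: (dd); rewrite lt_min => /andP[dd1 dd2].
  have [b1 b2 b3] := hd eps _ _ dd1 sole t tT.
  have Iu := fkdv_integrable sole tT; have Iv := fkdv_integrable sol0 tT.
  split; apply: Hnorm_lt => // N.
    apply: (h1 _ _ Iu Iv b2 (dv t tT)).
    by move=> k; apply: (le_trans (b3 k)); rewrite ge_min lexx.
  have wu : wiener_bound Tc (u eps) B.
    by apply: (boot_wiener_bound ha T0 wv) => s sT; have [] := hd eps _ _ dd1 sole s sT.
  have wu0 : wiener_bound Tc (u eps0) B.
    apply: wiener_bound_le wv; rewrite /B /boot_wiener lerDr /boot.
    by move: Kv0; lra.
  apply: (h2 eps _ _ _ _ (ltW dd2) Iu Iv (fkdv_integrable_dt sole tT)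
    (fkdv_integrable_dt sol0 tT) (wu t tT) (wu0 t tT) _ _ _
    (fkdv_mode_eq sole tT) (fkdv_mode_eq sol0 tT)).
  + by apply: decay8_le b2; rewrite le_max lexx.
  + by apply: decay8_le (dv t tT); rewrite le_max lexx orbT.
  + by move=> k; apply: (le_trans (b3 k)); rewrite ge_min lexx orbT.
- move=> e e0.
  have [C C0 reg] := burgers_regularity T0 bsol su0 pu0 hTc.
  have mv : modesol alpha 0 Tc v.
    by apply: (burgers_modesol bsol) => t tT; have [] := reg t tT.
  have wv : wiener_bound Tc v (4 * C).
    by move=> t tT; have [_ r0 r3] := reg t tT; exact: decay3_wiener.
  have iv k : fcoef_re u0 k = fcoef_re (v 0) k /\ fcoef_im u0 k = fcoef_im (v 0) k.
    have -> : v 0 = u0 by apply/funext => x; case: bsol => -> _ _ _ _.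
    by [].
  have dv := persistence_decay T0 mv wv hE0 iv.
  set Kv := E0 * _ in dv.
  have Kv0 := decay8_ge0 (dv 0 t0T).
  pose K := boot_decay Tc (4 * C) Kv E0.
  have sq0 : 0 < (e / 2) ^+ 2 by rewrite exprn_gt0//; lra.
  have K0 : 0 <= K.
    apply: mulr_ge0; last exact: expR_ge0.
    by apply: le_trans (hE0 0%N); rewrite sum_zrange0 mulr_ge0 ?fcoef_sq_ge0.
  have [eta1 eta10 h1] := decay8_small s03 K0 Kv0 sq0.
  have [d d0 hd] := approximation ha T0 I0 f0 hE0 mv wv dv iv eta10.
  (* For [eps < 1] one has [eps^2 <= eps], so [eps < d] controls the parameter [eps^2 - 0^2] of the
     approximation. *)
  exists (Num.min 1 d); first by rewrite lt_min ltr01.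
  move=> eps /andP[ep]; rewrite lt_min => /andP[e1 ed] t tT.
  have sole := sol eps ep.
  have dd : `|eps ^+ 2 - 0 ^+ 2| < d.
    rewrite expr0n subr0 ger0_norm ?sqr_ge0//; apply: le_lt_trans ed.
    by rewrite expr2 ler_piMr// ltW.
  have [_ b2 b3] := hd eps _ _ dd sole t tT.
  have Iv : integrableI (v t) by case: mv => h _; exact: h.
  apply: Hnorm_lt => // N.
  exact: (h1 _ _ (fkdv_integrable sole tT) Iv b2 (dv t tT) b3).
Qed.
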